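(* Let $\omega\in\mathbb{T}$. There exists a common hypercyclic vector for all composition operators $C_\varphi$ acting on $H(\mathbb{D})$, where $\varphi$ ranges over all $\varphi\in\mathrm{Aut}(\mathbb{D})$ admitting $\omega$ as attractive fixed point. Moreover, the set of these common hypercyclic vectors is a residual set in $H(\mathbb{D})$.
   Context: $\mathbb{D}$ is the open unit disk, $\mathbb{T}=\partial\mathbb{D}$, $\mathrm{Aut}(\mathbb{D})$ is the set of (holomorphic) automorphisms of $\mathbb{D}$, and $H(\mathbb{D})$ is the F-space of holomorphic functions on $\mathbb{D}$ (topology of uniform convergence on compact sets). $C_\varphi(f)=f\circ\varphi$. The automorphisms admitting $\omega\in\mathbb{T}$ as attractive fixed point are the parabolic ones whose single fixed point is $\omega$, and the hyperbolic ones (two fixed points, both on $\mathbb{T}$) for which $\omega$ is the attractive one, i.e. the iterates of $\varphi$ converge to $\omega$ on $\mathbb{D}$. A hypercyclic vector for a continuous linear operator $R$ on $X$ is an $x\in X$ such that $\{R^nx:\ n\geq1\}$ is dense in $X$; a common hypercyclic vector for a family of operators is a vector that is hypercyclic for each of them. ''Residual set'' means dense $G_\delta$ set. *)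

(* Defs.v *)
From HB Require Import structures.
From mathcomp Require Import all_boot all_order all_algebra.
From mathcomp Require Import all_classical all_reals all_analysis.
From mathcomp Require Export complex.

Set Implicit Arguments.
Unset Strict Implicit.
Unset Printing Implicit Defensive.

Import Order.TTheory GRing.Theory Num.Theory.
Import numFieldNormedType.Exports.

Local Open Scope classical_set_scope.
Local Open Scope ring_scope.

(* The complex plane with its usual topology, as a normed space over itself. *)
HB.instance Definition _ (R : realType) := NormedModule.copy R[i] R[i]^o.

Definition unit_disk (R : realType) : set R[i] := [set z | `|z| < 1].

Definition unit_circle (R : realType) : set R[i] := [set z | `|z| = 1].

Definition closed_unit_disk (R : realType) : set R[i] := [set z | `|z| <= 1].

Arguments unit_disk : clear implicits.
Arguments unit_circle : clear implicits.
Arguments closed_unit_disk : clear implicits.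

(* [derivable _ z 1] is the existence of the limit of the difference quotient
   over complex increments, i.e. complex differentiability at z. The values
   of the extension by 0 off the (open) disk are irrelevant. *)
Definition holomorphic (R : realType) (f : unit_disk R -> R[i]) : Prop :=
  forall z, unit_disk R z -> derivable ('valL_0 f) z 1.

Definition holomorphic_map (R : realType) (phi : unit_disk R -> unit_disk R) :
  Prop := holomorphic (fun z => set_val (phi z)).

(* H(D), with the topology induced by that of compact convergence. *)
Definition holo_space (R : realType) :=
  set_type [set f : {family compact, unit_disk R -> R[i]} | holomorphic f].
HB.instance Definition _ (R : realType) := Topological.on (holo_space R).

Record disk_aut (R : realType) := DiskAut {
  disk_aut_fun :> unit_disk R -> unit_disk R ;
  disk_aut_holo : holomorphic_map disk_aut_fun ;
  disk_aut_biholo : exists psi : unit_disk R -> unit_disk R,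
    [/\ holomorphic_map psi, cancel disk_aut_fun psi & cancel psi disk_aut_fun]
}.

Lemma open_unit_disk (R : realType) : open (unit_disk R).
Proof.
rewrite (_ : unit_disk R = ball (0 : R[i]) 1); first exact: ball_open.
by apply/seteqP; split => z; rewrite /unit_disk /ball /= sub0r normrN.
Qed.

Lemma valL_disk (R : realType) (f : unit_disk R -> R[i]) (z : unit_disk R) :
  'valL_0 f (set_val z) = f z.
Proof. exact: (congr1 (fun g => g z) (valLK 0 f)). Qed.

Lemma holomorphic_comp (R : realType) (f : unit_disk R -> R[i])
    (phi : unit_disk R -> unit_disk R) :
  holomorphic f -> holomorphic_map phi -> holomorphic (f \o phi).
Proof.
move=> fh ph z Dz.
pose G := 'valL_0 (fun z => set_val (phi z)).
have GE (w : unit_disk R) : G (set_val w) = set_val (phi w) by exact: valL_disk.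
apply: (@near_eq_derivable _ _ _ ('valL_0 f \o G)).
  apply: filterS (open_nbhs_nbhs (conj (@open_unit_disk R) Dz)) => w Dw.
  have -> : w = set_val (exist _ w (mem_set Dw) : unit_disk R) by [].
  by rewrite [RHS]valL_disk [LHS]/comp GE valL_disk.
apply/derivable1_diffP/differentiable_comp; first exact/derivable1_diffP/ph.
apply/derivable1_diffP/fh.
have -> : z = set_val (exist _ z (mem_set Dz) : unit_disk R) by [].
by rewrite GE; exact: set_valP.
Qed.

Definition comp_op (R : realType) (phi : disk_aut R) (f : holo_space R) :
    holo_space R :=
  exist _ (set_val f \o phi)
    (mem_set (holomorphic_comp (set_valP f) (@disk_aut_holo R phi))).

(* Automorphisms extend continuously to the closed disk; eta in the closed disk
   is a fixed point when the extension takes the value eta at eta. *)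
Definition fixed_point (R : realType) (phi : disk_aut R) (eta : R[i]) : Prop :=
  closed_unit_disk R eta /\
  'valL_0 (fun z => set_val (phi z)) @ within (unit_disk R) (nbhs eta) --> eta.

Definition parabolic (R : realType) (phi : disk_aut R) : Prop :=
  exists2 a, unit_circle R a & fixed_point phi = [set a].

Definition hyperbolic (R : realType) (phi : disk_aut R) : Prop :=
  exists a b, [/\ unit_circle R a, unit_circle R b, a <> b
    & fixed_point phi = [set a; b]].

Definition attractive_fixed_point (R : realType) (phi : disk_aut R)
    (omega : R[i]) : Prop :=
  fixed_point phi omega /\
  (parabolic phi \/
   hyperbolic phi /\
   forall z, set_val (iter n phi z) @[n --> \oo] --> omega).

Definition hypercyclic (X : topologicalType) (T : X -> X) (x : X) : Prop :=
  dense [set iter n T x | n in [set n | (1 <= n)%N]].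

Definition common_hypercyclic (R : realType) (omega : R[i]) :
    set (holo_space R) :=
  [set f | forall phi : disk_aut R, attractive_fixed_point phi omega ->
    hypercyclic (comp_op phi) f].

(* Main.v *)
Require Import Defs.
From mathcomp Require Import all_boot all_order all_algebra.
From mathcomp Require Import all_classical all_reals all_analysis borel_hierarchy.
From mathcomp Require Import ring lra.

Set Implicit Arguments.
Unset Strict Implicit.
Unset Printing Implicit Defensive.

Import Order.TTheory GRing.Theory Num.Theory.
Import numFieldNormedType.Exports.
Import Normc.

Local Notation Re := (@complex.Re _).
Local Notation Im := (@complex.Im _).

Local Open Scope classical_set_scope.
Local Open Scope ring_scope.

(* The Cayley transform carries the disk to the right half-plane and [omega] to
   infinity. By Schwarz-Pick, the automorphisms attracted by [omega] become the
   maps [w |-> s w + i t] with [s > 1], or [s = 1] and [t != 0]; each of them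
   lies in a one-parameter group, described by a time [l > 0] and a real [c],
   and the parameters [(l, c)] are exhausted by countably many rectangles.
   For a rectangle [K] and an open set [V], the functions having, for each
   parameter in [K], an iterate in [V] form an open set, by compactness of [K].
   This set is dense: the [n]-th iterate hardly changes while [l] moves by
   [e / n], so by divergence of the harmonic series finitely many parameters at
   widely separated times [n l] control all of [K]; given [g] and [h], the sum
   of [g] and of the translates of [h] at these times, each multiplied by a
   function peaked at its own translate, is close to [g] and has all the
   prescribed iterates close to [h]. Baire's theorem, applied to the rectangles
   and to a countable base of open sets [V], concludes. *)

(** The obstacle is that the parameter [(l, c)] is two-dimensional, while the step in [l] tolerable
    at the [n]-th iterate shrinks like [1 / n]: a harmonic sweep pays for one dimension only. It
    suffices because the other one is free. In the hyperbolic case, running the map with centre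
    [- i c] for a time [k] and undoing the one with centre [- i c'] amounts to a shift by
    [i (c - c') (1 - exp (- k))], so one finite net in [c] serves all times; in the parabolic case
    time can be rescaled so that [c] is only a sign. The number of translates is known only after
    the gap [D] between their times, and [D] only after the allowed error. The peaks therefore decay
    quadratically in time, which bounds the total error independently of the number of terms. A peak
    controls far translates of bounded functions only, so [g] and [h] are first replaced by bounded
    functions close to them on a rectangle. Cauchy's formula serves twice: through the maximum
    principle for Schwarz-Pick, and through Weierstrass' theorem for the completeness behind Baire.
    Of its constant, only nonvanishing matters. *)

(** * The modulus as a real number *)

Section complex_norm.
Context {R : realType}.
Implicit Types (z w : R[i]) (x y e : R).

Lemma normc_ge0 z : 0 <= normc z.
Proof. by case: z => a b /=; exact: sqrtr_ge0. Qed.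

Lemma ler_normcD z w : normc (z + w) <= normc z + normc w.
Proof. exact: le_normcD. Qed.

Lemma normcBC z w : normc (z - w) = normc (w - z).
Proof. by rewrite -normcN opprB. Qed.

Lemma ler_normcB z w : normc (z - w) <= normc z + normc w.
Proof. by rewrite -(normcN w) ler_normcD. Qed.

Lemma lerB_normcD z w : normc z - normc w <= normc (z + w).
Proof.
by rewrite lerBlDr -{1}(addrK w z) ler_normcB.
Qed.

Lemma lerB_normcB z w : normc z - normc w <= normc (z - w).
Proof. by rewrite -(normcN w) lerB_normcD. Qed.

Lemma normc_real x : normc (x%:C)%C = `|x|.
Proof. by rewrite /= expr0n addr0 sqrtr_sqr. Qed.

Lemma normcX z n : normc (z ^+ n) = normc z ^+ n.
Proof. by elim: n => [|n IHn]; rewrite ?expr0 ?normc1// !exprS normcM IHn. Qed.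

Lemma normcE z : `|z| = (normc z)%:C%C.
Proof. by []. Qed.

Lemma normc_sqr z : normc z ^+ 2 = Re z ^+ 2 + Im z ^+ 2.
Proof. by case: z => a b /=; rewrite sqr_sqrtr// addr_ge0 ?sqr_ge0. Qed.

Lemma normc_i : normc ('i%C : R[i]) = 1.
Proof. by rewrite /= expr0n add0r expr1n sqrtr1. Qed.

Lemma ler_Re_normc z : `|Re z| <= normc z.
Proof.
by rewrite -(ler_pXn2r (n:=2)) ?nnegrE ?normc_ge0// normc_sqr real_normK ?num_real//
  lerDl sqr_ge0.
Qed.

Lemma ler_Im_normc z : `|Im z| <= normc z.
Proof.
by rewrite -(ler_pXn2r (n:=2)) ?nnegrE ?normc_ge0// normc_sqr real_normK ?num_real//
  lerDr sqr_ge0.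
Qed.

Lemma normc_le_ReIm z : normc z <= `|Re z| + `|Im z|.
Proof.
have n0 := addr_ge0 (normr_ge0 (Re z)) (normr_ge0 (Im z)).
rewrite -(ler_pXn2r (n:=2)) ?nnegrE ?normc_ge0// normc_sqr sqrrD.
rewrite !real_normK ?num_real// -addrA lerD2l lerDr.
by rewrite mulrn_wge0// mulr_ge0.
Qed.

Lemma normc_eq0 z : (normc z == 0) = (z == 0).
Proof. by apply/eqP/eqP => [/eq0_normc|->]//; rewrite normc0. Qed.

Lemma normc_gt0 z : (0 < normc z) = (z != 0).
Proof. by rewrite lt0r normc_ge0 andbT normc_eq0. Qed.

Lemma cReD z w : Re (z + w) = Re z + Re w. Proof. by case: z; case: w. Qed.
Lemma cImD z w : Im (z + w) = Im z + Im w. Proof. by case: z; case: w. Qed.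
Lemma cReN z : Re (- z) = - Re z. Proof. by case: z. Qed.
Lemma cImN z : Im (- z) = - Im z. Proof. by case: z. Qed.
Lemma cReM z w : Re (z * w) = Re z * Re w - Im z * Im w.
Proof. by case: z; case: w. Qed.
Lemma cImM z w : Im (z * w) = Re z * Im w + Im z * Re w.
Proof. by case: z; case: w. Qed.
Lemma complex_eqP z w : Re z = Re w -> Im z = Im w -> z = w.
Proof. by case: z => a b; case: w => c d /= -> ->. Qed.

Lemma sqr_normc_inj x y : 0 <= x -> 0 <= y -> x ^+ 2 = y ^+ 2 -> x = y.
Proof. by move=> x0 y0 /eqP; rewrite eqrXn2// => /eqP. Qed.

Lemma nbhs_normcP z (A : set R[i]) :
  nbhs z A <-> exists2 e : R, 0 < e & forall w, normc (w - z) < e -> A w.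
Proof.
split.
  move/nbhs_ballP => [[a b] /=]; rewrite ltcE/= => /andP[/eqP b0 a0] H.
  exists a => // w wz; apply: H; rewrite /ball /= normcE -opprB normcN.
  by rewrite ltcE /= b0 eqxx.
move=> [e e0 H]; apply/nbhs_ballP; exists (e%:C)%C; first by rewrite /= ltcR.
by move=> w; rewrite /ball /= normcE -opprB normcN ltcR => /H.
Qed.

End complex_norm.

(** * Complex differentiability with real bounds *)

Section complex_derivative.
Context {R : realType}.
Implicit Types (f g : R[i] -> R[i]) (a b k l h : R[i]).

Definition is_dC f a l := forall e : R, 0 < e -> exists2 d : R, 0 < d &
  forall b, normc (b - a) < d ->
    normc (f b - f a - l * (b - a)) <= e * normc (b - a).

Lemma derivableC f a : derivable f a 1 <-> exists l, is_dC f a l.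
Proof.
split.
  move=> /cvg_ex[l Hl]; exists l => e e0.
  have : nbhs l [set w | normc (w - l) < e] by apply/nbhs_normcP; exists e.
  move=> /Hl; rewrite /nbhs /= /dnbhs /within /= => /nbhs_normcP[d d0 Hd].
  exists d => // b bd; have [->|bN] := eqVneq b a.
    by rewrite !subrr mulr0 subrr normc0 mulr0.
  have ba0 : b - a != 0 by rewrite subr_eq0.
  have /= := Hd (b - a); rewrite subr0 => /(_ bd ba0).
  rewrite [X in f X](_ : _ = b); last first.
    by rewrite -[(b - a) *: 1]/((b - a) * 1) mulr1 subrK.
  rewrite -[_ *: _]/((b - a)^-1 * (f b - f a)) => H.
  rewrite [X in normc X](_ : _ = ((b - a)^-1 * (f b - f a) - l) * (b - a)).
    by rewrite normcM ler_wpM2r ?normc_ge0// ltW.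
  by field.
move=> [l Hl]; apply/cvg_ex; exists l => A /nbhs_normcP[e e0 HA].
have e20 : 0 < e / 2 by lra.
have [d d0 Hd] := Hl _ e20.
rewrite /nbhs /= /dnbhs /within /=; apply/nbhs_normcP; exists d => // h; rewrite subr0 => hd h0.
apply: HA; rewrite -[_ *: _]/(h^-1 * (f (h * 1 + a) - f a)) mulr1.
have := Hd (h + a); rewrite addrK => /(_ hd).
rewrite (_ : h^-1 * _ - l = (f (h + a) - f a - l * h) / h); last by field.
rewrite normcM normcV ltr_pdivrMr ?normc_gt0// => /le_lt_trans; apply.
rewrite ltr_pM2r ?normc_gt0//; lra.
Qed.

Definition contC f a := forall e : R, 0 < e -> exists2 d : R, 0 < d &
  forall b, normc (b - a) < d -> normc (f b - f a) < e.

Lemma contC_cst k a : contC (fun=> k) a.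
Proof. by move=> e e0; exists 1 => // b _; rewrite subrr normc0. Qed.

Lemma contC_id a : contC id a.
Proof. by move=> e e0; exists e. Qed.

Lemma contC_comp f g a : contC g a -> contC f (g a) -> contC (fun z => f (g z)) a.
Proof.
move=> gc fc e /fc[d /gc[r r0 Hr] Hd]; exists r => // b /Hr; exact: Hd.
Qed.

Lemma contCD f g a : contC f a -> contC g a -> contC (fun z => f z + g z) a.
Proof.
move=> fc gc e e0; have e2 : 0 < e / 2 by lra.
have [d1 d10 H1] := fc _ e2; have [d2 d20 H2] := gc _ e2.
exists (Num.min d1 d2); first by rewrite lt_min d10.
move=> b; rewrite lt_min => /andP[/H1 b1 /H2 b2].
have -> : f b + g b - (f a + g a) = (f b - f a) + (g b - g a) by ring.
by apply: (le_lt_trans (ler_normcD _ _)); lra.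
Qed.

Lemma contC_near f a : contC f a -> exists2 d : R, 0 < d &
  forall b, normc (b - a) < d -> normc (f b) < normc (f a) + 1.
Proof.
move=> /(_ 1 ltr01)[d d0 Hd]; exists d => // b /Hd H.
by have := lerB_normcB (f b) (f a); lra.
Qed.

Lemma contCM f g a : contC f a -> contC g a -> contC (fun z => f z * g z) a.
Proof.
move=> fc gc e e0.
pose F := normc (f a) + 1; pose G := normc (g a) + 1.
have F0 : 0 < F by rewrite /F; have := normc_ge0 (f a); lra.
have G0 : 0 < G by rewrite /G; have := normc_ge0 (g a); lra.
have eF : 0 < e / 2 / F by rewrite !divr_gt0.
have eG : 0 < e / 2 / G by rewrite !divr_gt0.
have [d1 d10 H1] := fc _ eG; have [d2 d20 H2] := gc _ eF.
have [d3 d30 H3] := contC_near fc.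
exists (Num.min d1 (Num.min d2 d3)); first by rewrite !lt_min d10 d20.
move=> b; rewrite !lt_min => /and3P[/H1 b1 /H2 b2 /H3 b3].
have -> : f b * g b - f a * g a = f b * (g b - g a) + (f b - f a) * g a by ring.
apply: (le_lt_trans (ler_normcD _ _)); rewrite !normcM.
rewrite ltr_pdivlMr// in b1; rewrite ltr_pdivlMr// in b2.
have h1 : normc (f b) * normc (g b - g a) <= F * normc (g b - g a).
  by rewrite ler_wpM2r ?normc_ge0// ltW.
have h2 : normc (f b - f a) * normc (g a) <= normc (f b - f a) * G.
  by rewrite ler_wpM2l ?normc_ge0// /G; lra.
lra.
Qed.

Lemma contCN f a : contC f a -> contC (fun z => - f z) a.
Proof.
move=> fc e e0; have [d d0 H] := fc e e0; exists d => // b /H.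
by rewrite -opprD normcN.
Qed.

Lemma contCB f g a : contC f a -> contC g a -> contC (fun z => f z - g z) a.
Proof. by move=> fc gc; apply: contCD => //; exact: contCN. Qed.

Lemma contCV f a : f a != 0 -> contC f a -> contC (fun z => (f z)^-1) a.
Proof.
move=> fa0 fc e e0; have n0 : 0 < normc (f a) by rewrite normc_gt0.
pose N := normc (f a); have N0 : 0 < N by [].
have [|d1 d10 H1] := fc (N / 2); first by rewrite divr_gt0.
have [|d2 d20 H2] := fc (e * (N ^+ 2 / 2)).
  by rewrite mulr_gt0// divr_gt0// exprn_gt0.
exists (Num.min d1 d2); first by rewrite lt_min d10.
move=> b; rewrite lt_min => /andP[/H1 b1 /H2 b2].
have fb : N / 2 < normc (f b).
  have := lerB_normcB (f a) (f b); rewrite normcBC -/N; lra.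
have fb0 : f b != 0 by rewrite -normc_gt0; lra.
have -> : (f b)^-1 - (f a)^-1 = - ((f b - f a) / (f b * f a)).
  by field; rewrite fa0 fb0.
rewrite normcN normcM normcV normcM ltr_pdivrMr ?mulr_gt0//; last lra.
apply: (lt_le_trans b2); rewrite ler_wpM2l// ?ltW// expr2 mulrAC -/N.
by rewrite ltr_pM2r.
Qed.

Lemma contCX f a n : contC f a -> contC (fun z => f z ^+ n) a.
Proof.
move=> fc; elim: n => [|n IH]; first exact: contC_cst.
rewrite (_ : (fun z => _) = (fun z => f z * f z ^+ n)); first exact: contCM.
by apply/funext => z; rewrite exprS.
Qed.

Lemma contC_near_eq f g a (r : R) : 0 < r ->
  (forall b, normc (b - a) < r -> f b = g b) -> contC f a -> contC g a.
Proof.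
move=> r0 fg fc e e0; have [d d0 H] := fc e e0.
exists (Num.min r d); first by rewrite lt_min r0.
move=> b; rewrite lt_min => /andP[/fg <- /H].
by rewrite -(fg a)// subrr normc0.
Qed.

(* Caratheodory's form of complex differentiability: the slope extends
   continuously to the base point. *)
Definition holoC f a := exists2 q, contC q a & forall b, f b - f a = q b * (b - a).

Lemma holoC_is_dC f a : holoC f a <-> exists l, is_dC f a l.
Proof.
split.
  move=> [q qc fq]; exists (q a) => e e0; have [d d0 H] := qc e e0.
  by exists d => // b /H/ltW h; rewrite fq -mulrBl normcM ler_wpM2r ?normc_ge0.
move=> [l Hl]; exists (fun b => if b == a then l else (f b - f a) / (b - a)).
  move=> e e0; have e2 : 0 < e / 2 by lra.
  have [d d0 H] := Hl _ e2; exists d => // b /H h; rewrite eqxx; move: h.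
  case: eqVneq => [-> _|ba]; first by rewrite subrr normc0.
  have ba0 : b - a != 0 by rewrite subr_eq0.
  rewrite -ler_pdivrMr ?normc_gt0// -normcV -normcM => h.
  apply: le_lt_trans (_ : e / 2 < e); last lra.
  by move: h; rewrite (mulrBl _ (f b - f a)) (mulfK ba0).
move=> b; case: eqVneq => [->|ba]; first by rewrite !subrr mulr0.
by rewrite divfK// subr_eq0.
Qed.

Lemma holoC_derivable f a : holoC f a <-> derivable f a 1.
Proof. by split=> [/holoC_is_dC/derivableC|/derivableC/holoC_is_dC]. Qed.

Lemma holoC_cont f a : holoC f a -> contC f a.
Proof.
move=> [q qc fq].
have : contC (fun b => f a + q b * (b - a)) a.
  apply: contCD; first exact: contC_cst.
  by apply: contCM => //; apply: contCB; [exact: contC_id|exact: contC_cst].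
by apply: (@contC_near_eq _ _ _ 1) => // b _; rewrite -fq addrC subrK.
Qed.

Lemma holoC_cst k a : holoC (fun=> k) a.
Proof. by exists (fun=> 0); [exact: contC_cst|move=> b; rewrite subrr mul0r]. Qed.

Lemma holoC_id a : holoC id a.
Proof. by exists (fun=> 1); [exact: contC_cst|move=> b; rewrite mul1r]. Qed.

Lemma holoCD f g a : holoC f a -> holoC g a -> holoC (fun z => f z + g z) a.
Proof.
move=> [p pc fp] [q qc gq]; exists (fun z => p z + q z); first exact: contCD.
by move=> b; rewrite mulrDl -fp -gq; ring.
Qed.

Lemma holoCM f g a : holoC f a -> holoC g a -> holoC (fun z => f z * g z) a.
Proof.
move=> fh gh; have gc := holoC_cont gh; case: fh gh => [p pc fp] [q qc gq].
exists (fun z => p z * g z + f a * q z).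
  by apply: contCD; apply: contCM => //; exact: contC_cst.
move=> b; rewrite mulrDl -(mulrA (f a)) -gq (mulrAC (p b)) -fp; ring.
Qed.

Lemma holoCN f a : holoC f a -> holoC (fun z => - f z) a.
Proof.
move=> [p pc fp]; exists (fun z => - p z); first exact: contCN.
by move=> b; rewrite mulNr -fp; ring.
Qed.

Lemma holoCB f g a : holoC f a -> holoC g a -> holoC (fun z => f z - g z) a.
Proof. by move=> fh gh; apply: holoCD => //; exact: holoCN. Qed.

Lemma holoCX f a n : holoC f a -> holoC (fun z => f z ^+ n) a.
Proof.
move=> fc; elim: n => [|n IH]; first exact: holoC_cst.
rewrite (_ : (fun z => _) = (fun z => f z * f z ^+ n)); first exact: holoCM.
by apply/funext => z; rewrite exprS.
Qed.

Lemma holoC_near_eq f g a (r : R) : 0 < r ->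
  (forall b, normc (b - a) < r -> f b = g b) -> holoC f a -> holoC g a.
Proof.
move=> r0 fg /holoC_is_dC[l Hl]; apply/holoC_is_dC; exists l => e e0.
have [d d0 H] := Hl e e0.
exists (Num.min r d); first by rewrite lt_min r0.
move=> b; rewrite lt_min => /andP[br /H].
by rewrite -!fg// subrr normc0.
Qed.

Lemma holoC_inv f a : f a != 0 -> holoC f a -> holoC (fun z => (f z)^-1) a.
Proof.
move=> fa0 fh; have fc := holoC_cont fh; case: fh => p pc fp.
have [|r r0 Hr] := fc (normc (f a)); first by rewrite normc_gt0.
have f0 b : normc (b - a) < r -> f b != 0.
  by move=> /Hr; apply: contraTneq => ->; rewrite sub0r normcN ltxx.
(* The slope identity must hold at every [b], also far from [a] where [f b = 0] and the inverse is 0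
   by convention; there the bare difference quotient is taken. *)
exists (fun b => if f b == 0 then ((f b)^-1 - (f a)^-1) / (b - a)
                 else - p b / (f b * f a)).
  apply: (@contC_near_eq (fun b => - p b / (f b * f a)) _ _ r) => //.
    by move=> b /f0 /negPf ->.
  apply: contCM; first exact: contCN.
  by apply: contCV; [rewrite mulf_neq0|apply: contCM => //; exact: contC_cst].
move=> b; case: eqVneq => [fb0|fb0]; last first.
  by rewrite mulrAC mulNr -fp; field; rewrite fa0 fb0.
have [ba|ba] := eqVneq b a; first by rewrite -ba fb0 eqxx in fa0.
by rewrite divfK// subr_eq0.
Qed.

Lemma holoC_div f g a : g a != 0 -> holoC f a -> holoC g a ->
  holoC (fun z => f z / g z) a.
Proof. by move=> g0 fh gh; apply: holoCM => //; exact: holoC_inv. Qed.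

Lemma holoC_comp f g a : holoC g a -> holoC f (g a) -> holoC (fun z => f (g z)) a.
Proof.
move=> gh; have gc := holoC_cont gh; case: gh => [q qc gq] [p pc fp].
exists (fun z => p (g z) * q z); first by apply: contCM => //; exact: contC_comp.
by move=> b; rewrite fp gq mulrA.
Qed.

End complex_derivative.

(** * Bisection of rectangles, the form of compactness used throughout *)

Section bisection.
Context {R : realType}.

(** Bad rectangles, quartered again and again, shrink to a point where the local hypothesis rules
    them out. [P] takes the four coordinates rather than a set, so that bounds depending on the side
    lengths can be glued too. *)
Lemma rect_bisect (P : R -> R -> R -> R -> Prop) (x1 x2 y1 y2 : R) :
  x1 <= x2 -> y1 <= y2 ->
  (forall a b c d, x1 <= a -> a <= b -> b <= x2 -> y1 <= c -> c <= d -> d <= y2 ->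
    P a ((a + b) / 2) c ((c + d) / 2) -> P ((a + b) / 2) b c ((c + d) / 2) ->
    P a ((a + b) / 2) ((c + d) / 2) d -> P ((a + b) / 2) b ((c + d) / 2) d ->
    P a b c d) ->
  (forall u v, x1 <= u <= x2 -> y1 <= v <= y2 -> exists2 e, 0 < e &
    forall a b c d, x1 <= a -> b <= x2 -> y1 <= c -> d <= y2 ->
      a <= u <= b -> c <= v <= d -> b - a < e -> d - c < e -> P a b c d) ->
  P x1 x2 y1 y2.
Proof.
move=> x12 y12 glue loc; apply: contrapT => NP.
pose bad (q : R * R * (R * R)) := [/\ x1 <= q.1.1, q.1.1 <= q.1.2 & q.1.2 <= x2] /\
  [/\ y1 <= q.2.1, q.2.1 <= q.2.2, q.2.2 <= y2 & ~ P q.1.1 q.1.2 q.2.1 q.2.2].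
pose sub (p q : R * R * (R * R)) :=
  [/\ q.1.1 <= p.1.1, p.1.2 <= q.1.2 & p.1.2 - p.1.1 = (q.1.2 - q.1.1) / 2] /\
  [/\ q.2.1 <= p.2.1, p.2.2 <= q.2.2 & p.2.2 - p.2.1 = (q.2.2 - q.2.1) / 2].
have step q : bad q -> exists p, bad p /\ sub p q.
  case: q => -[a b] [c d] [] [/= xa ab bx] [/= yc cd dy NPq].
  set m := (a + b) / 2; set n := (c + d) / 2.
  have [[am mb] [cn nd]] := (midf_le ab, midf_le cd).
  apply: contrapT => /forallNP H.
  have K (p : R * R * (R * R)) : sub p (a, b, (c, d)) -> p.1.1 <= p.1.2 ->
      p.2.1 <= p.2.2 -> P p.1.1 p.1.2 p.2.1 p.2.2.
    move=> sp p1 p2; apply: contrapT => NPp; apply: (H p); split=> //.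
    case: sp => -[/= q1 q2 _] [/= q3 q4 _]; split; split=> //.
    - exact: le_trans q1.
    - exact: le_trans bx.
    - exact: le_trans q3.
    - exact: le_trans dy.
  by apply/NPq/glue => //; [apply: (K (a, m, (c, n)))|apply: (K (m, b, (c, n)))
    |apply: (K (a, m, (n, d)))|apply: (K (m, b, (n, d)))];
    rewrite /sub//=; split; split; rewrite // /m /n; clear; field.
have /boolp.choice[s sP] : forall q, exists p, bad q -> bad p /\ sub p q.
  move=> q; have [/step[p ?]|?] := pselect (bad q); first by exists p.
  by exists q.
pose u n := iter n s (x1, x2, (y1, y2)).
have ubad n : bad (u n).
  by elim: n => [|n /sP[]]//; split; split => /=.
have usub n : sub (u n.+1) (u n) by have [] := sP _ (ubad n).
have umono (n k : nat) : [/\ (u n).1.1 <= (u (n + k)%N).1.1,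
    (u (n + k)%N).1.2 <= (u n).1.2, (u n).2.1 <= (u (n + k)%N).2.1 &
    (u (n + k)%N).2.2 <= (u n).2.2].
  elim: k => [|k [h1 h2 h3 h4]]; first by rewrite addn0.
  rewrite addnS; case: (usub (n + k)%N) => -[? ? _] [? ? _].
  by split; [exact: le_trans h1 _|exact: le_trans _ h2|exact: le_trans h3 _|exact: le_trans _ h4].
have ulen n : (u n).1.2 - (u n).1.1 = (x2 - x1) / 2 ^+ n /\
    (u n).2.2 - (u n).2.1 = (y2 - y1) / 2 ^+ n.
  elim: n => [|n [IH1 IH2]]; first by rewrite expr0 !divr1.
  case: (usub n) => -[_ _ ->] [_ _ ->]; rewrite IH1 IH2 exprS.
  by rewrite invfM; split; ring.
(* Every left end lies below every right end, so the supremum of the left ends belongs to all the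
   nested intervals. *)
have cross1 n m : (u n).1.1 <= (u m).1.2.
  have [h1 _ _ _] := umono n m; have [_ h2 _ _] := umono m n.
  rewrite addnC in h2; have [[_ h3 _] _] := ubad (n + m)%N.
  exact: le_trans h1 (le_trans h3 h2).
have cross2 n m : (u n).2.1 <= (u m).2.2.
  have [_ _ h1 _] := umono n m; have [_ _ _ h2] := umono m n.
  rewrite addnC in h2; have [_ [_ h3 _ _]] := ubad (n + m)%N.
  exact: le_trans h1 (le_trans h3 h2).
pose p1 := sup [set (u n).1.1 | n in setT].
pose p2 := sup [set (u n).2.1 | n in setT].
have p1P n : (u n).1.1 <= p1 <= (u n).1.2.
  apply/andP; split.
    apply: ub_le_sup; last by exists n.
    by exists (u 0).1.2 => _ [k _ <-].
  apply: ge_sup; first by exists (u 0).1.1; exists 0%N.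
  by move=> _ [k _ <-].
have p2P n : (u n).2.1 <= p2 <= (u n).2.2.
  apply/andP; split.
    apply: ub_le_sup; last by exists n.
    by exists (u 0).2.2 => _ [k _ <-].
  apply: ge_sup; first by exists (u 0).2.1; exists 0%N.
  by move=> _ [k _ <-].
have [e e0 He] := loc p1 p2 (p1P 0%N) (p2P 0%N).
pose M := x2 - x1 + (y2 - y1) + 1.
have M0 : 0 < M by rewrite /M; lra.
have [n Hn] : exists n : nat, M / 2 ^+ n < e.
  exists (Num.truncn (M / e)).+1; rewrite ltr_pdivrMr ?exprn_gt0//.
  rewrite mulrC -ltr_pdivrMr//.
  have /lt_trans : M / e < (Num.truncn (M / e)).+1%:R by exact: truncnS_gt.
  by apply; rewrite -natrX ltr_nat ltn_expl.
have n0 : 0 < (2 ^+ n)^-1 :> R by rewrite invr_gt0 exprn_gt0.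
have [[xa ab bx] [yc cd dy NPn]] := ubad n.
apply: NPn; apply: He => //.
  have [-> _] := ulen n; apply: le_lt_trans Hn.
  by rewrite ler_wpM2r// ?ltW// /M; lra.
have [_ ->] := ulen n; apply: le_lt_trans Hn.
by rewrite ler_wpM2r// ?ltW// /M; lra.
Qed.

End bisection.

(** * Integrals of complex-valued functions over real intervals *)

Section complex_integral.
Context {R : realType}.
Implicit Types (f g : R -> R[i]) (a b c : R) (k : R[i]).
Notation mu := (@lebesgue_measure R).

Definition cont_itv f a b := forall x, a <= x <= b -> forall e : R, 0 < e ->
  exists2 d : R, 0 < d & forall y, a <= y <= b -> `|y - x| < d ->
    normc (f y - f x) < e.

Definition cint f a b : R[i] :=
  ((\int[mu]_(t in `[a, b]) Re (f t)) +i* (\int[mu]_(t in `[a, b]) Im (f t)))%C.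

Lemma cont_itv_cst k a b : cont_itv (fun=> k) a b.
Proof. by move=> x _ e e0; exists 1 => // y _ _; rewrite subrr normc0. Qed.

Lemma cont_itv_id a b : cont_itv (fun t => t%:C%C) a b.
Proof.
move=> x _ e e0; exists e => // y _.
by rewrite -(rmorphB (real_complex R)) normc_real.
Qed.

Lemma cont_itvZ f k a b : cont_itv f a b -> cont_itv (fun t => k * f t) a b.
Proof.
move=> fc x xab e e0.
have k0 : 0 < normc k + 1 by have := normc_ge0 k; lra.
have ek : 0 < e / (normc k + 1) by rewrite divr_gt0.
have [d d0 H] := fc x xab _ ek; exists d => // y yab yx.
rewrite -mulrBr normcM; have := H y yab yx; rewrite ltr_pdivlMr// mulrC.
apply: le_lt_trans; rewrite ler_wpM2r ?normc_ge0//; lra.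
Qed.

Lemma cont_itv_integrable f a b : cont_itv f a b ->
  mu.-integrable `[a, b] (EFin \o (fun t => Re (f t))) /\
  mu.-integrable `[a, b] (EFin \o (fun t => Im (f t))).
Proof.
move=> fc; split; apply: continuous_compact_integrable;
    (try exact: segment_compact); apply/subspace_continuousP => x /=;
    rewrite in_itv/= => xab; apply/cvgrPdist_lt => e e0;
    have [d d0 Hd] := fc x xab e e0;
    rewrite /within/=; apply/nbhs_ballP; exists d => //= y;
    rewrite /ball/= distrC => yd; rewrite in_itv/= => yab;
    apply: le_lt_trans (Hd y yab yd); rewrite distrC.
- by rewrite -cReN -cReD ler_Re_normc.
- by rewrite -cImN -cImD ler_Im_normc.
Qed.

Lemma eq_cint f g a b : (forall t, a <= t <= b -> f t = g t) ->
  cint f a b = cint g a b.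
Proof.
move=> fg; rewrite /cint; congr Complex; apply: eq_Rintegral => t;
  by rewrite inE/= in_itv/= => /fg ->.
Qed.

Lemma cintD f g a b : cont_itv f a b -> cont_itv g a b ->
  cint (fun t => f t + g t) a b = cint f a b + cint g a b.
Proof.
move=> /cont_itv_integrable[f1 f2] /cont_itv_integrable[g1 g2].
apply: complex_eqP; rewrite ?cReD ?cImD /cint/= -RintegralD//.
- by apply: eq_Rintegral => t _; rewrite cReD.
- by apply: eq_Rintegral => t _; rewrite cImD.
Qed.

Lemma cintZ f k a b : cont_itv f a b ->
  cint (fun t => k * f t) a b = k * cint f a b.
Proof.
move=> /cont_itv_integrable[f1 f2].
have m (r : R) (h : R -> R) : mu.-integrable `[a, b] (EFin \o h) ->
    mu.-integrable `[a, b] (EFin \o (fun t => r * h t)).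
  by move=> ih; apply: (integrableZl _ r ih).
apply: complex_eqP; rewrite ?cReM ?cImM /cint/= -!RintegralZl//.
- rewrite -RintegralB//; try exact: m.
  by apply: eq_Rintegral => t _; rewrite cReM.
- rewrite -RintegralD//; try exact: m.
  by apply: eq_Rintegral => t _; rewrite cImM.
Qed.

Lemma Rintegral_cst_itv (r : R) a b : a <= b ->
  \int[mu]_(_ in `[a, b]) r = r * (b - a).
Proof.
move=> ab; rewrite Rintegral_cst//= lebesgue_measure_itv/= lte_fin.
by move: ab; rewrite le_eqVlt => /predU1P[->|->]//=; rewrite ltxx subrr.
Qed.

Lemma cint_cst k a b : a <= b -> cint (fun=> k) a b = k * (b - a)%:C%C.
Proof.
move=> ab; rewrite /cint !Rintegral_cst_itv//.
by apply: complex_eqP; rewrite ?cReM ?cImM/=; ring.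
Qed.

Lemma cint_id a b : a <= b ->
  cint (fun t => t%:C%C) a b = ((b ^+ 2 - a ^+ 2) / 2)%:C%C.
Proof.
move=> ab; apply: complex_eqP; rewrite /cint/=; last first.
  by rewrite Rintegral_cst_itv// mul0r.
move: ab; rewrite le_eqVlt => /predU1P[<-|ab].
  by rewrite set_itv1 Rintegral_set1 subrr mul0r.
have H (x : R) : is_derive x 1 (fun t : R => t ^+ 2 / 2) x.
  have -> : (fun t : R => t ^+ 2 / 2) = (2^-1 : R) *: (@GRing.exp R ^~ 2).
    by apply/funext => t; rewrite mulrC.
  by apply: is_derive_eq; rewrite /GRing.scale/=; lra.
rewrite /Rintegral (@continuous_FTC2 _ _ (fun t => t ^+ 2 / 2)%R)//.
- by rewrite /= mulrBl.
- by apply: continuous_subspaceT => x; exact: cvg_id.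
- have cF (x : R) : (t ^+ 2 / 2) @[t --> x] --> (x ^+ 2 / 2).
    by apply: (@differentiable_continuous _ _ _ x (fun t : R => t ^+ 2 / 2));
      apply/derivable1_diffP; exact: ex_derive.
  split=> [x _| |]; first exact: ex_derive.
  + exact: cvg_at_right_filter.
  + exact: cvg_at_left_filter.
- by move=> x _; rewrite derive1E derive_val.
Qed.

Lemma cint_split f a c b : a <= c <= b -> cont_itv f a b ->
  cint f a b = cint f a c + cint f c b.
Proof.
move=> /andP[ac cb] fc; have [i1 i2] := cont_itv_integrable fc.
have sp (h : R -> R) : mu.-integrable `[a, b] (EFin \o h) ->
    \int[mu]_(t in `[a, b]) h t =
    \int[mu]_(t in `[a, c]) h t + \int[mu]_(t in `[c, b]) h t.
  move=> ih; apply/eqP; rewrite addrC -subr_eq; apply/eqP.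
  rewrite Rintegral_itvB ?bnd_simp// Rintegral_itv_obnd_cbnd//.
  apply: integrableS ih => //; apply: subset_itvr.
  by rewrite bnd_simp.
by apply: complex_eqP; rewrite ?cReD ?cImD /cint/= sp.
Qed.

Lemma le_normr_Rintegral_cst (h : R -> R) (M a b : R) : a <= b ->
  mu.-integrable `[a, b] (EFin \o h) ->
  (forall t, a <= t <= b -> `|h t| <= M) ->
  `|\int[mu]_(t in `[a, b]) h t| <= M * (b - a).
Proof.
move=> ab ih hM.
apply: (le_trans (le_normr_Rintegral _ ih)) => //.
rewrite -(Rintegral_cst_itv M ab); apply: le_Rintegral => //.
- exact: (integrable_norm ih).
- apply/continuous_compact_integrable; first exact: segment_compact.
  by apply: continuous_subspaceT => x; exact: cvg_cst.
Qed.

(** The real and imaginary parts are bounded separately, whence the factor 2; the later uses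
    tolerate any fixed constant. *)
Lemma normc_cint f (M a b : R) : a <= b -> cont_itv f a b ->
  (forall t, a <= t <= b -> normc (f t) <= M) ->
  normc (cint f a b) <= 2 * M * (b - a).
Proof.
move=> ab /cont_itv_integrable[i1 i2] fM.
apply: (le_trans (normc_le_ReIm _)); rewrite /cint/=.
have := le_normr_Rintegral_cst ab i1 (fun t tab =>
  le_trans (ler_Re_normc _) (fM t tab)).
have := le_normr_Rintegral_cst ab i2 (fun t tab =>
  le_trans (ler_Im_normc _) (fM t tab)).
lra.
Qed.

Lemma Re_cint_ge f (m a b : R) : a <= b -> cont_itv f a b ->
  (forall t, a <= t <= b -> m <= Re (f t)) -> m * (b - a) <= Re (cint f a b).
Proof.
move=> ab /cont_itv_integrable[i1 i2] fm; rewrite /cint/= -Rintegral_cst_itv//.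
apply: le_Rintegral => //.
apply/continuous_compact_integrable; first exact: segment_compact.
by apply: continuous_subspaceT => x; exact: cvg_cst.
Qed.

End complex_integral.

(** * Integrals along the boundary of a rectangle and Goursat's theorem *)

Section rectangle_integral.
Context {R : realType}.
Implicit Types (f g : R[i] -> R[i]) (k z w : R[i]).

Definition in_rect (x1 x2 y1 y2 : R) z := x1 <= Re z <= x2 /\ y1 <= Im z <= y2.

Definition on_bd (x1 x2 y1 y2 : R) z := in_rect x1 x2 y1 y2 z /\
  [\/ Re z = x1, Re z = x2, Im z = y1 | Im z = y2].

Definition cont_bd f x1 x2 y1 y2 :=
  forall z, on_bd x1 x2 y1 y2 z -> contC f z.

(** Contour integral, counterclockwise; the factor ['i%C] is the derivative of the vertical
    parametrisation. *)
Definition rint f (x1 x2 y1 y2 : R) : R[i] :=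
  cint (fun t => f (t +i* y1)%C) x1 x2 + 'i%C * cint (fun t => f (x2 +i* t)%C) y1 y2
  - cint (fun t => f (t +i* y2)%C) x1 x2 - 'i%C * cint (fun t => f (x1 +i* t)%C) y1 y2.

Lemma cont_hedge f (a b y : R) :
  (forall t, a <= t <= b -> contC f (t +i* y)%C) ->
  cont_itv (fun t => f (t +i* y)%C) a b.
Proof.
move=> fc t tab e e0; have [d d0 Hd] := fc t tab e e0.
exists d => // s sab st; apply: Hd.
rewrite (_ : (_ - _)%R = ((s - t)%:C)%C) ?normc_real//.
by apply: complex_eqP; rewrite ?(cReD, cImD, cReN, cImN)/= ?subrr.
Qed.

Lemma cont_vedge f (a b x : R) :
  (forall t, a <= t <= b -> contC f (x +i* t)%C) ->
  cont_itv (fun t => f (x +i* t)%C) a b.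
Proof.
move=> fc t tab e e0; have [d d0 Hd] := fc t tab e e0.
exists d => // s sab st; apply: Hd.
rewrite (_ : (_ - _)%R = 'i%C * ((s - t)%:C)%C) ?normcM ?normc_real ?normc_i ?mul1r//.
by apply: complex_eqP; rewrite ?(cReD, cImD, cReN, cImN, cReM, cImM)/=; ring.
Qed.

Lemma cont_bd_edges f x1 x2 y1 y2 : x1 <= x2 -> y1 <= y2 ->
  cont_bd f x1 x2 y1 y2 ->
  [/\ cont_itv (fun t => f (t +i* y1)%C) x1 x2,
      cont_itv (fun t => f (x2 +i* t)%C) y1 y2,
      cont_itv (fun t => f (t +i* y2)%C) x1 x2 &
      cont_itv (fun t => f (x1 +i* t)%C) y1 y2].
Proof.
move=> x12 y12 fc; split; (apply: cont_hedge || apply: cont_vedge) => t tab;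
  apply: fc; split; rewrite /in_rect/= ?lexx ?x12 ?y12 ?tab//.
- by constructor 3.
- by constructor 2.
- by constructor 4.
- by constructor 1.
Qed.

Lemma eq_rint f g x1 x2 y1 y2 : x1 <= x2 -> y1 <= y2 ->
  (forall z, on_bd x1 x2 y1 y2 z -> f z = g z) ->
  rint f x1 x2 y1 y2 = rint g x1 x2 y1 y2.
Proof.
move=> x12 y12 fg; rewrite /rint; congr (_ + 'i%C * _ - _ - 'i%C * _);
  apply: eq_cint => t tab; apply: fg; split;
  rewrite /in_rect/= ?lexx ?x12 ?y12 ?tab//.
- by constructor 3.
- by constructor 2.
- by constructor 4.
- by constructor 1.
Qed.

Lemma rintD f g x1 x2 y1 y2 : x1 <= x2 -> y1 <= y2 ->
  cont_bd f x1 x2 y1 y2 -> cont_bd g x1 x2 y1 y2 ->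
  rint (fun z => f z + g z) x1 x2 y1 y2 = rint f x1 x2 y1 y2 + rint g x1 x2 y1 y2.
Proof.
move=> x12 y12 /(cont_bd_edges x12 y12)[? ? ? ?] /(cont_bd_edges x12 y12)[? ? ? ?].
by rewrite /rint !cintD//; ring.
Qed.

Lemma rintZ f k x1 x2 y1 y2 : x1 <= x2 -> y1 <= y2 ->
  cont_bd f x1 x2 y1 y2 ->
  rint (fun z => k * f z) x1 x2 y1 y2 = k * rint f x1 x2 y1 y2.
Proof.
move=> x12 y12 /(cont_bd_edges x12 y12)[? ? ? ?].
by rewrite /rint !cintZ//; ring.
Qed.

Lemma cont_bdZ f k x1 x2 y1 y2 : cont_bd f x1 x2 y1 y2 ->
  cont_bd (fun z => k * f z) x1 x2 y1 y2.
Proof. by move=> fc z /fc ?; apply: contCM => //; exact: contC_cst. Qed.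

Lemma rintB f g x1 x2 y1 y2 : x1 <= x2 -> y1 <= y2 ->
  cont_bd f x1 x2 y1 y2 -> cont_bd g x1 x2 y1 y2 ->
  rint (fun z => f z - g z) x1 x2 y1 y2 = rint f x1 x2 y1 y2 - rint g x1 x2 y1 y2.
Proof.
move=> x12 y12 fc gc; rewrite -[X in _ - X]mul1r -mulNr -rintZ// -rintD//.
  by apply: eq_rint => // z _; rewrite mulN1r.
exact: cont_bdZ.
Qed.

(** Affine functions are the tangents that Goursat's argument subtracts; explicit primitives of [1]
    and [t] on the edges are all that this requires. *)
Lemma rint_affine (k l : R[i]) x1 x2 y1 y2 : x1 <= x2 -> y1 <= y2 ->
  rint (fun z => k + l * z) x1 x2 y1 y2 = 0.
Proof.
move=> x12 y12; rewrite /rint.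
have E (c d : R[i]) a b : a <= b -> cint (fun t : R => c + d * t%:C%C) a b =
    c * (b - a)%:C%C + d * ((b ^+ 2 - a ^+ 2) / 2)%:C%C.
  move=> ab; rewrite cintD ?cint_cst ?cintZ ?cint_id//.
  - exact: cont_itv_id.
  - exact: cont_itv_cst.
  - by apply: cont_itvZ; exact: cont_itv_id.
have h (a b y : R) : a <= b -> cint (fun t : R => k + l * (t +i* y)%C) a b =
    (k + l * ('i%C * y%:C%C)) * (b - a)%:C%C + l * ((b ^+ 2 - a ^+ 2) / 2)%:C%C.
  move=> ab; rewrite -E//; apply: eq_cint => t _.
  rewrite (_ : (t +i* y)%C = t%:C%C + 'i%C * y%:C%C); first by ring.
  by apply: complex_eqP; rewrite ?(cReD, cImD, cReM, cImM)/=; ring.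
have v (a b x : R) : a <= b -> cint (fun t : R => k + l * (x +i* t)%C) a b =
    (k + l * x%:C%C) * (b - a)%:C%C + (l * 'i%C) * ((b ^+ 2 - a ^+ 2) / 2)%:C%C.
  move=> ab; rewrite -E//; apply: eq_cint => t _.
  rewrite (_ : (x +i* t)%C = x%:C%C + 'i%C * t%:C%C); first by ring.
  by apply: complex_eqP; rewrite ?(cReD, cImD, cReM, cImM)/=; ring.
rewrite !h// !v//.
have sub (a b : R) : (a - b)%:C%C = a%:C%C - b%:C%C.
  by apply: complex_eqP; rewrite ?(cReD, cImD, cReN, cImN)/= ?subrr.
rewrite (sub x2) (sub y2); clear; set X := (_ / 2)%:C%C; set Y := (_ / 2)%:C%C.
by clearbody X Y; ring.
Qed.

Lemma normc_rint f (M : R) x1 x2 y1 y2 : x1 <= x2 -> y1 <= y2 ->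
  cont_bd f x1 x2 y1 y2 -> (forall z, on_bd x1 x2 y1 y2 z -> normc (f z) <= M) ->
  normc (rint f x1 x2 y1 y2) <= 4 * M * (x2 - x1 + (y2 - y1)).
Proof.
move=> x12 y12 /(cont_bd_edges x12 y12)[c1 c2 c3 c4] fM.
have b1 := normc_cint x12 c1 (fun t tab => fM (t +i* y1)%C
  (conj (conj tab (introT andP (conj (lexx y1) y12))) (Or43 _ _ _ erefl))).
have b2 := normc_cint y12 c2 (fun t tab => fM (x2 +i* t)%C
  (conj (conj (introT andP (conj x12 (lexx x2))) tab) (Or42 _ _ _ erefl))).
have b3 := normc_cint x12 c3 (fun t tab => fM (t +i* y2)%C
  (conj (conj tab (introT andP (conj y12 (lexx y2)))) (Or44 _ _ _ erefl))).
have b4 := normc_cint y12 c4 (fun t tab => fM (x1 +i* t)%C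
  (conj (conj (introT andP (conj (lexx x1) x12)) tab) (Or41 _ _ _ erefl))).
rewrite /rint; apply: (le_trans (ler_normcB _ _)).
rewrite [X in _ + X]normcM normc_i mul1r.
have := ler_normcB (cint (fun t => f (t +i* y1)%C) x1 x2 +
  'i%C * cint (fun t => f (x2 +i* t)%C) y1 y2) (cint (fun t => f (t +i* y2)%C) x1 x2).
have := ler_normcD (cint (fun t => f (t +i* y1)%C) x1 x2)
  ('i%C * cint (fun t => f (x2 +i* t)%C) y1 y2).
rewrite [X in _ <= _ + X -> _]normcM normc_i mul1r.
lra.
Qed.

Lemma rint_splitx f c x1 x2 y1 y2 : x1 <= c <= x2 -> y1 <= y2 ->
  (forall z, in_rect x1 x2 y1 y2 z -> contC f z) ->
  rint f x1 x2 y1 y2 = rint f x1 c y1 y2 + rint f c x2 y1 y2.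
Proof.
move=> x1c y12 fc; rewrite /rint.
rewrite (cint_split x1c (f := fun t => f (t +i* y1)%C)).
  rewrite (cint_split x1c (f := fun t => f (t +i* y2)%C)); first by ring.
  by apply: cont_hedge => t tx; apply: fc; rewrite /in_rect/= tx y12 lexx.
by apply: cont_hedge => t tx; apply: fc; rewrite /in_rect/= tx y12 lexx.
Qed.

Lemma rint_splity f c x1 x2 y1 y2 : x1 <= x2 -> y1 <= c <= y2 ->
  (forall z, in_rect x1 x2 y1 y2 z -> contC f z) ->
  rint f x1 x2 y1 y2 = rint f x1 x2 y1 c + rint f x1 x2 c y2.
Proof.
move=> x12 y1c fc; rewrite /rint.
rewrite (cint_split y1c (f := fun t => f (x2 +i* t)%C)).
  rewrite (cint_split y1c (f := fun t => f (x1 +i* t)%C)); first by ring.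
  by apply: cont_vedge => t tx; apply: fc; rewrite /in_rect/= tx x12 lexx.
by apply: cont_vedge => t tx; apply: fc; rewrite /in_rect/= tx x12 lexx.
Qed.

Lemma cint_set1 (h : R -> R[i]) (a : R) : cint h a a = 0.
Proof. by rewrite /cint !set_itv1 !Rintegral_set1. Qed.

Lemma rint_degx f x y1 y2 : rint f x x y1 y2 = 0.
Proof. by rewrite /rint !cint_set1; ring. Qed.

Lemma rint_degy f x1 x2 y : rint f x1 x2 y y = 0.
Proof. by rewrite /rint !cint_set1; ring. Qed.

Lemma in_rectS x1 x2 y1 y2 a b c d z : x1 <= a -> b <= x2 -> y1 <= c -> d <= y2 ->
  in_rect a b c d z -> in_rect x1 x2 y1 y2 z.
Proof. by move=> ? ? ? ? [/andP[? ?] /andP[? ?]]; split; apply/andP; split; lra. Qed.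

Lemma in_rect_cont_bd f x1 x2 y1 y2 :
  (forall z, in_rect x1 x2 y1 y2 z -> contC f z) ->
  cont_bd f x1 x2 y1 y2.
Proof. by move=> fc z [/fc]. Qed.

Lemma normc_in_rect x1 x2 y1 y2 z w : in_rect x1 x2 y1 y2 z ->
  in_rect x1 x2 y1 y2 w -> normc (z - w) <= x2 - x1 + (y2 - y1).
Proof.
move=> [/andP[a b] /andP[c d]] [/andP[a' b'] /andP[c' d']].
apply: (le_trans (normc_le_ReIm _)); rewrite cReD cReN cImD cImN.
by apply: lerD; rewrite ler_norml; apply/andP; split; lra.
Qed.

Lemma goursat f x1 x2 y1 y2 : x1 <= x2 -> y1 <= y2 ->
  (forall z, in_rect x1 x2 y1 y2 z -> holoC f z) ->
  rint f x1 x2 y1 y2 = 0.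
Proof.
move=> x12 y12 fd.
have fc z : in_rect x1 x2 y1 y2 z -> contC f z.
  by move=> /fd/holoC_cont.
suff H : forall e : R, 0 < e ->
    normc (rint f x1 x2 y1 y2) <= e * (x2 - x1 + (y2 - y1)) ^+ 2.
  apply: eq0_normc; apply/eqP; rewrite eq_le normc_ge0 andbT.
  apply/ler_addgt0Pr => e e0; rewrite add0r.
  set s := x2 - x1 + (y2 - y1) in H.
  have s0 : 0 <= s by rewrite /s; lra.
  have s1 : 0 < s ^+ 2 + 1 by nra.
  have es : 0 < e / (s ^+ 2 + 1) by rewrite divr_gt0.
  apply: (le_trans (H _ es)).
  by rewrite -mulrA ger_pMr// ler_pdivrMl// mulr1; lra.
(* The bound is quadratic in the half-perimeter: halving both sides quarters it, so the bounds of
   the four pieces add up exactly to that of the whole. *)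
move=> e e0; apply: (@rect_bisect _ (fun a b c d =>
  normc (rint f a b c d) <= e * (b - a + (d - c)) ^+ 2)) => //.
  move=> a b c d xa ab bx yc cd dy h1 h2 h3 h4.
  have fcS z : in_rect a b c d z -> contC f z.
    by move=> /(in_rectS xa bx yc dy)/fc.
  have [[am mb] [cn nd]] := (midf_le ab, midf_le cd).
  rewrite (@rint_splitx _ ((a + b) / 2))//; last by rewrite am mb.
  rewrite (@rint_splity _ ((c + d) / 2) a)//; last 2 first.
  - by rewrite cn nd.
  - by move=> z zz; apply: fcS; apply: in_rectS zz.
  rewrite (@rint_splity _ ((c + d) / 2) ((a + b) / 2))//; last 2 first.
  - by rewrite cn nd.
  - by move=> z zz; apply: fcS; apply: in_rectS zz.
  apply: (le_trans (ler_normcD _ _)).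
  apply: (le_trans (lerD (ler_normcD _ _) (ler_normcD _ _))).
  apply: (le_trans (lerD (lerD h1 h3) (lerD h2 h4))).
  by rewrite [leLHS](_ : _ = e * (b - a + (d - c)) ^+ 2) //; field.
move=> u v ux vy.
have /fd/holoC_is_dC[l Hl] : in_rect x1 x2 y1 y2 (u +i* v)%C by [].
have e4 : 0 < e / 4 by lra.
have [r r0 Hr] := Hl _ e4.
exists (r / 2); first lra.
move=> a b c d xa bx yc dy aub cvd ba dc.
have [ab cd] : a <= b /\ c <= d.
  by move: aub cvd => /andP[? ?] /andP[? ?]; split; lra.
set p := (u +i* v)%C in Hr.
have fcS : cont_bd f a b c d.
  by apply: in_rect_cont_bd => z /(in_rectS xa bx yc dy)/fc.
have gc : cont_bd (fun z => (f p - l * p) + l * z) a b c d.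
  move=> z _; apply: contCD; first exact: contC_cst.
  by apply: contCM; [exact: contC_cst|exact: contC_id].
(* Subtracting the tangent at [p] leaves an integrand of size at most [e / 4 * s]; the 4 cancels the
   one in [normc_rint]. *)
have -> : rint f a b c d = rint (fun z => f z - ((f p - l * p) + l * z)) a b c d.
  by rewrite rintB// rint_affine// subr0.
have pr : in_rect a b c d p by [].
set s := b - a + (d - c).
have s0 : 0 <= s by rewrite /s; lra.
rewrite (_ : e * s ^+ 2 = 4 * (e / 4 * s) * s); last by field.
apply: normc_rint => //.
  by move=> z zb; apply: contCB; [exact: fcS|exact: gc].
move=> z [zr _]; have zs := normc_in_rect zr pr.
rewrite (_ : _ - _ = f z - f p - l * (z - p)); last by ring.
apply: (le_trans (Hr z _)); first by apply: (le_lt_trans zs); lra.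
by rewrite ler_wpM2l// ltW.
Qed.

(** A window around [a], cut off at the ends of the interval. The last two clauses ensure that
    whatever remains outside the window stays away from [a]. *)
Lemma clip (x1 x2 a h : R) : 0 < h -> x1 <= a -> a <= x2 -> exists b1 b2 : R,
  [/\ [/\ x1 <= b1, b1 <= a, a <= b2, b2 <= x2 & b2 - b1 <= 2 * h],
      x1 < b1 -> b1 < a & b2 < x2 -> a < b2].
Proof.
move=> h0 xa ax; exists (Num.max x1 (a - h)), (Num.min x2 (a + h)).
by case: (leP x1 (a - h)) => H1; case: (leP x2 (a + h)) => H2;
  (split; [split|..]); lra.
Qed.

(** Each exceptional point is enclosed in a window so small that continuity alone makes its contour
    integral negligible; the four pieces around the window avoid the point and fall under the
    induction. Exceptions make room for slopes, which are only known to be continuous at their base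
    point. *)
Lemma goursat_except (s : seq R[i]) f x1 x2 y1 y2 : x1 <= x2 -> y1 <= y2 ->
  (forall z, in_rect x1 x2 y1 y2 z -> contC f z) ->
  (forall z, in_rect x1 x2 y1 y2 z -> z \notin s -> holoC f z) ->
  rint f x1 x2 y1 y2 = 0.
Proof.
elim: s x1 x2 y1 y2 => [|a s IH] x1 x2 y1 y2 x12 y12 fc fd.
  by apply: goursat => // z /fd; exact.
have sub b1 b2 c1 c2 : x1 <= b1 -> b1 <= b2 -> b2 <= x2 -> y1 <= c1 -> c1 <= c2 ->
    c2 <= y2 -> ~ in_rect b1 b2 c1 c2 a -> rint f b1 b2 c1 c2 = 0.
  move=> ? ? ? ? ? ? na; apply: IH => //.
  - by move=> z zr; apply: fc; apply: in_rectS zr.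
  - move=> z zr zs; apply: fd; first by apply: in_rectS zr.
    by rewrite inE negb_or zs andbT; apply/eqP => za; apply: na; rewrite -za.
have [ar|] := pselect (in_rect x1 x2 y1 y2 a); last by exact: sub.
apply: eq0_normc; apply/eqP; rewrite eq_le normc_ge0 andbT.
apply/ler_addgt0Pr => e e0; rewrite add0r.
have [r r0 Hr] := fc _ ar 1 ltr01.
pose M := normc (f a) + 1.
have M0 : 0 < M by rewrite /M; have := normc_ge0 (f a); lra.
(* The window has half-perimeter at most [4 * h < r], so [normc (f z) <= M] on it, and its integral
   is at most [4 * M * (4 * h) <= e]. *)
pose h := Num.min (r / 5) (e / (16 * M)).
have h0 : 0 < h by rewrite lt_min; rewrite !divr_gt0// mulr_gt0.
have [hr he] : h <= r / 5 /\ h <= e / (16 * M).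
  by split; rewrite /h ge_min lexx ?orbT.
have he' : 16 * M * h <= e by rewrite ler_pdivlMr ?mulr_gt0// mulrC in he.
clear he.
have [/andP[xa ax] /andP[ya ay]] := ar.
have [b1 [b2 [[B1 B2 B3 B4 B5] B6 B7]]] := clip h0 xa ax.
have [c1 [c2 [[C1 C2 C3 C4 C5] C6 C7]]] := clip h0 ya ay.
have [b12 c12] : b1 <= b2 /\ c1 <= c2 by split; [exact: le_trans B3|exact: le_trans C3].
have [b1x c1y] : b1 <= x2 /\ c1 <= y2 by split; [exact: le_trans B4|exact: le_trans C4].
have [x1b y1c] : x1 <= b2 /\ y1 <= c2 by split; [exact: le_trans b12|exact: le_trans c12].
rewrite (@rint_splitx _ b1)//; last by rewrite B1 b1x.
have -> : rint f x1 b1 y1 y2 = 0.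
  move: (B1); rewrite le_eqVlt => /predU1P[<-|/B6 ba]; first exact: rint_degx.
  by apply: sub => // -[/andP[_ +] _]; apply/negP; rewrite -ltNge.
rewrite add0r (@rint_splitx _ b2)//; last 2 first.
- by rewrite b12 B4.
- by move=> z zr; apply: fc; apply: in_rectS zr.
have -> : rint f b2 x2 y1 y2 = 0.
  move: (B4); rewrite le_eqVlt => /predU1P[->|/B7 ab]; first exact: rint_degx.
  by apply: sub => // -[/andP[+ _] _]; apply/negP; rewrite -ltNge.
have fcS z : in_rect b1 b2 y1 y2 z -> contC f z.
  by move=> zr; apply: fc; apply: in_rectS zr.
rewrite addr0 (@rint_splity _ c1)//; last by rewrite C1 c1y.
have -> : rint f b1 b2 y1 c1 = 0.
  move: (C1); rewrite le_eqVlt => /predU1P[<-|/C6 ca]; first exact: rint_degy.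
  by apply: sub => // -[_ /andP[_ +]]; apply/negP; rewrite -ltNge.
rewrite add0r (@rint_splity _ c2)//; last 2 first.
- by rewrite c12 C4.
- by move=> z zr; apply: fcS; apply: in_rectS zr.
have -> : rint f b1 b2 c2 y2 = 0.
  move: (C4); rewrite le_eqVlt => /predU1P[->|/C7 ac]; first exact: rint_degy.
  by apply: sub => // -[_ /andP[+ _]]; apply/negP; rewrite -ltNge.
rewrite addr0.
have ar' : in_rect b1 b2 c1 c2 a by split; apply/andP; split.
apply: (le_trans (normc_rint (M := M) b12 c12 _ _)).
- by move=> z [zr _]; apply: fcS; apply: in_rectS zr => //.
- move=> z [zr _]; have zs := normc_in_rect zr ar'.
  have /ltW H : normc (f z - f a) < 1.
    by apply: Hr; apply: (le_lt_trans zs); move: B5 C5 hr r0; clear; lra.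
  rewrite -(subrK (f a) (f z)) (le_trans (ler_normcD _ _))// /M; move: H; clear; lra.
- apply: (@le_trans _ _ (4 * M * (4 * h))); last by move: he'; clear; lra.
  by rewrite ler_wpM2l//; [move: M0|move: B5 C5]; clear; lra.
Qed.

End rectangle_integral.

(** * Cauchy's formula, Weierstrass' theorem and the maximum principle *)

Section cauchy_formula.
Context {R : realType}.
Implicit Types (f g : R[i] -> R[i]) (z w : R[i]).

Definition in_int (x1 x2 y1 y2 : R) z := x1 < Re z < x2 /\ y1 < Im z < y2.

Lemma in_int_le x1 x2 y1 y2 w : in_int x1 x2 y1 y2 w -> x1 <= x2 /\ y1 <= y2.
Proof. by move=> [/andP[? ?] /andP[? ?]]; split; lra. Qed.

Lemma in_int_rect x1 x2 y1 y2 w : in_int x1 x2 y1 y2 w -> in_rect x1 x2 y1 y2 w.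
Proof. by move=> [/andP[? ?] /andP[? ?]]; split; apply/andP; split; lra. Qed.

Lemma bd_dist x1 x2 y1 y2 w : in_int x1 x2 y1 y2 w ->
  exists2 r : R, 0 < r & forall z, on_bd x1 x2 y1 y2 z -> r <= normc (z - w).
Proof.
move=> [/andP[xw wx] /andP[yw wy]].
exists (Num.min (Num.min (Re w - x1) (x2 - Re w)) (Num.min (Im w - y1) (y2 - Im w))).
  by rewrite !lt_min !subr_gt0 xw wx yw.
move=> z [_ H].
have n1 := ler_Re_normc (z - w); have n2 := ler_Im_normc (z - w).
move: n1 n2; rewrite cReD cReN cImD cImN !ler_norml => /andP[a b] /andP[c d].
rewrite !ge_min; case: H => e; apply/orP.
- by left; apply/orP; left; lra.
- by left; apply/orP; right; lra.
- by right; apply/orP; left; lra.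
- by right; apply/orP; right; lra.
Qed.

Lemma in_int_open x1 x2 y1 y2 w : in_int x1 x2 y1 y2 w ->
  exists2 d : R, 0 < d & forall b, normc (b - w) < d -> in_int x1 x2 y1 y2 b.
Proof.
move=> [/andP[xw wx] /andP[yw wy]].
exists (Num.min (Num.min (Re w - x1) (x2 - Re w)) (Num.min (Im w - y1) (y2 - Im w))).
  by rewrite !lt_min !subr_gt0 xw wx yw.
move=> b bi; have := ler_Re_normc (b - w); have := ler_Im_normc (b - w).
rewrite cReD cReN cImD cImN !ler_norml => /andP[a1 a2] /andP[a3 a4].
move: bi; rewrite !lt_min => /andP[/andP[? ?] /andP[? ?]].
by split; apply/andP; split; lra.
Qed.

Lemma on_bd_neq x1 x2 y1 y2 w z : in_int x1 x2 y1 y2 w -> on_bd x1 x2 y1 y2 z ->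
  z - w != 0.
Proof. by move=> /bd_dist[r r0 H] /H h; rewrite -normc_gt0; lra. Qed.

Lemma contC_sub_inv w z : z - w != 0 -> contC (fun z => (z - w)^-1) z.
Proof.
move=> zw; apply: contCV => //.
by apply: contCB; [exact: contC_id|exact: contC_cst].
Qed.

Lemma cont_bd_kernel f x1 x2 y1 y2 w : in_int x1 x2 y1 y2 w ->
  cont_bd f x1 x2 y1 y2 -> cont_bd (fun z => f z / (z - w)) x1 x2 y1 y2.
Proof.
move=> wi fc z zb; apply: contCM; first exact: fc.
by apply: contC_sub_inv; apply: on_bd_neq wi zb.
Qed.

Lemma Re_cint_ge0 (k : R[i]) (f : R -> R[i]) (a b : R) : a <= b -> cont_itv f a b ->
  (forall t, a <= t <= b -> 0 <= Re (k * f t)) -> 0 <= Re (k * cint f a b).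
Proof.
move=> ab fc H; rewrite -cintZ//.
have := Re_cint_ge ab (cont_itvZ k fc) H; by rewrite mul0r.
Qed.

Lemma Re_inv z : Re z^-1 = Re z / normc z ^+ 2.
Proof. by case: z => a b /=; rewrite sqr_sqrtr// addr_ge0 ?sqr_ge0. Qed.

Lemma Im_inv z : Im z^-1 = - Im z / normc z ^+ 2.
Proof. by case: z => a b /=; rewrite sqr_sqrtr ?addr_ge0 ?sqr_ge0// mulNr. Qed.

(** Takes the place of the value [2 i pi]. The argument of [z - w] grows along every edge traversed
    counterclockwise, so no edge contributes negatively, and the bottom edge contributes a definite
    amount. *)
Lemma Im_cauchy_kernel_gt0 x1 x2 y1 y2 w : in_int x1 x2 y1 y2 w ->
  0 < Im (rint (fun z => (z - w)^-1) x1 x2 y1 y2).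
Proof.
move=> wi; have [x12 y12] := in_int_le wi; have wr := in_int_rect wi.
have kc : cont_bd (fun z => (z - w)^-1) x1 x2 y1 y2.
  by move=> z zb; apply: contC_sub_inv; apply: on_bd_neq wi zb.
have [c1 c2 c3 c4] := cont_bd_edges x12 y12 kc.
have [/andP[xw wx] /andP[yw wy]] := wi.
set D := x2 - x1 + (y2 - y1).
have D0 : 0 < D by rewrite /D; lra.
have p2 : 0 <= Re (1 * cint (fun t => ((x2 +i* t)%C - w)^-1) y1 y2).
  apply: Re_cint_ge0 => // t _.
  rewrite mul1r Re_inv mulr_ge0// ?invr_ge0 ?sqr_ge0// cReD cReN/=; lra.
have p3 : 0 <= Re ('i%C * cint (fun t => ((t +i* y2)%C - w)^-1) x1 x2).
  apply: Re_cint_ge0 => // t _.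
  rewrite cReM/= mul0r sub0r mul1r Im_inv mulNr opprK mulr_ge0//
    ?invr_ge0 ?sqr_ge0// cImD cImN/=; lra.
have p4 : 0 <= Re (-1 * cint (fun t => ((x1 +i* t)%C - w)^-1) y1 y2).
  apply: Re_cint_ge0 => // t _.
  rewrite mulN1r cReN Re_inv -mulNr mulr_ge0// ?invr_ge0 ?sqr_ge0// cReD cReN/=; lra.
have p1 : 0 < Re (- 'i%C * cint (fun t => ((t +i* y1)%C - w)^-1) x1 x2).
  rewrite -cintZ//.
  apply: (@lt_le_trans _ _ ((Im w - y1) / D ^+ 2 * (x2 - x1))).
    by rewrite mulr_gt0 ?divr_gt0 ?exprn_gt0//; lra.
  apply: Re_cint_ge => //; first exact: cont_itvZ.
  move=> t tx; rewrite cReM/= oppr0 mul0r sub0r mulN1r opprK Im_inv cImD cImN/=.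
  rewrite opprB.
  have zb : on_bd x1 x2 y1 y2 (t +i* y1)%C.
    by split; [split => //=; rewrite lexx|constructor 3].
  have z0 := on_bd_neq wi zb; rewrite -normc_gt0 in z0.
  rewrite ler_wpM2l ?subr_ge0 ?(ltW yw)// lef_pV2 ?posrE ?exprn_gt0//.
  rewrite ler_pXn2r ?nnegrE ?(ltW z0) ?(ltW D0)//.
  by apply: normc_in_rect => //; case: zb.
move: p1 p2 p3 p4; rewrite /rint.
by rewrite !(cReM, cReN, cImD, cImN, cImM)/=; clear; lra.
Qed.

Lemma cauchy_kernel_neq0 x1 x2 y1 y2 w : in_int x1 x2 y1 y2 w ->
  rint (fun z => (z - w)^-1) x1 x2 y1 y2 != 0.
Proof.
by move=> /Im_cauchy_kernel_gt0 h; apply: contraTneq h => ->; rewrite ltxx.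
Qed.

(** The difference of the two sides is the integral of the slope of [f] at [w], which is continuous
    on the rectangle and differentiable off [w :: s]. *)
Lemma cauchy_formula (s : seq R[i]) f x1 x2 y1 y2 w : in_int x1 x2 y1 y2 w ->
  (forall z, in_rect x1 x2 y1 y2 z -> contC f z) ->
  (forall z, in_rect x1 x2 y1 y2 z -> z \notin s -> holoC f z) -> w \notin s ->
  rint (fun z => f z / (z - w)) x1 x2 y1 y2 =
  f w * rint (fun z => (z - w)^-1) x1 x2 y1 y2.
Proof.
move=> wi fc fh ws; have [x12 y12] := in_int_le wi; have wr := in_int_rect wi.
have fb := in_rect_cont_bd fc.
have [q qc fq] := fh _ wr ws.
have kc : cont_bd (fun z => (z - w)^-1) x1 x2 y1 y2.
  by move=> z zb; apply: contC_sub_inv; apply: on_bd_neq wi zb.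
apply/eqP; rewrite -subr_eq0 -rintZ// -rintB//; last 2 first.
- exact: cont_bd_kernel.
- exact: cont_bdZ.
rewrite (@eq_rint _ _ q)//; last first.
  by move=> z zb; rewrite -mulrBl fq mulfK// (on_bd_neq wi zb).
have qf z : z != w -> exists2 r : R, 0 < r & forall b, normc (b - z) < r ->
    (f b - f w) / (b - w) = q b.
  move=> zw; exists (normc (z - w)); first by rewrite normc_gt0 subr_eq0.
  move=> b bz; rewrite fq mulfK// subr_eq0.
  by apply: contraTneq bz => ->; rewrite normcBC ltxx.
apply/eqP; apply: (@goursat_except _ (w :: s)) => //.
  move=> z zr; have [-> //|zw] := eqVneq z w.
  have [r r0 Hr] := qf _ zw; apply: (contC_near_eq r0 Hr).
  apply: contCM; first by apply: contCB; [exact: fc|exact: contC_cst].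
  by apply: contC_sub_inv; rewrite subr_eq0.
move=> z zr; rewrite inE negb_or => /andP[zw zs].
have [r r0 Hr] := qf _ zw; apply: (holoC_near_eq r0 Hr).
apply: holoC_div; rewrite ?subr_eq0//.
  by apply: holoCB; [exact: fh|exact: holoC_cst].
by apply: holoCB; [exact: holoC_id|exact: holoC_cst].
Qed.

Lemma rect_bounded f x1 x2 y1 y2 : x1 <= x2 -> y1 <= y2 ->
  (forall z, in_rect x1 x2 y1 y2 z -> contC f z) ->
  exists2 M : R, 0 < M & forall z, in_rect x1 x2 y1 y2 z -> normc (f z) <= M.
Proof.
move=> x12 y12 fc; apply: (@rect_bisect _ (fun a b c d => exists2 M : R, 0 < M &
  forall z, in_rect a b c d z -> normc (f z) <= M)) => //.
  move=> a b c d _ _ _ _ _ _ [M1 p1 H1] [M2 p2 H2] [M3 p3 H3] [M4 p4 H4].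
  exists (M1 + M2 + M3 + M4); first lra.
  move=> z [/andP[za zb] /andP[zc zd]].
  have [h|h] := leP (Re z) ((a + b) / 2); have [h'|h'] := leP (Im z) ((c + d) / 2).
  - have := H1 z; move=> /(_ _)/le_trans; apply; last lra.
    by split; apply/andP; split; lra.
  - have := H3 z; move=> /(_ _)/le_trans; apply; last lra.
    by split; apply/andP; split; lra.
  - have := H2 z; move=> /(_ _)/le_trans; apply; last lra.
    by split; apply/andP; split; lra.
  - have := H4 z; move=> /(_ _)/le_trans; apply; last lra.
    by split; apply/andP; split; lra.
move=> u v ux vy; have [r r0 Hr] := contC_near (fc (u +i* v)%C (conj ux vy)).
exists (r / 2); first lra.
move=> a b c d _ _ _ _ ua vc ab cd.
exists (normc (f (u +i* v)%C) + 1).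
  by have := normc_ge0 (f (u +i* v)%C); lra.
move=> z zr; apply/ltW/Hr.
have uv : in_rect a b c d (u +i* v)%C by split.
by have := normc_in_rect zr uv; lra.
Qed.

Lemma holo_cauchy_integral f x1 x2 y1 y2 w : in_int x1 x2 y1 y2 w ->
  (forall z, in_rect x1 x2 y1 y2 z -> contC f z) ->
  holoC (fun w => rint (fun z => f z / (z - w)) x1 x2 y1 y2) w.
Proof.
move=> wi fc; have [x12 y12] := in_int_le wi.
have fb := in_rect_cont_bd fc.
have [M M0 HM] := rect_bounded x12 y12 fc.
have [r r0 Hr] := bd_dist wi.
apply/holoC_is_dC; exists (rint (fun z => f z / (z - w) / (z - w)) x1 x2 y1 y2).
move=> e e0.
set D := x2 - x1 + (y2 - y1).
have D0 : 0 < D by case: wi => /andP[? ?] /andP[? ?]; rewrite /D; lra.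
(* The remainder of the first-order expansion is [(b - w) ^+ 2] times an integral. On the boundary
   [normc (z - w) >= r] and, for [b] within [r / 2] of [w], [normc (z - b) >= r / 2], so that
   integral is at most [K]. *)
pose K := 4 * (M * 2 / r ^+ 3) * D.
have K0 : 0 < K by rewrite !mulr_gt0// ?invr_gt0 ?exprn_gt0.
have [d d0 dI] := in_int_open wi.
exists (Num.min d (Num.min (r / 2) (e / K))).
  by rewrite !lt_min d0 !divr_gt0.
move=> b; rewrite !lt_min => /and3P[/dI bI br be].
have kb := cont_bd_kernel bI fb; have kw := cont_bd_kernel wi fb.
have kww := cont_bd_kernel wi kw.
rewrite -rintB//; rewrite [X in _ - X]mulrC -rintZ// -rintB//; last 2 first.
- by move=> z zb; apply: contCB; [exact: kb|exact: kw].
- exact: cont_bdZ.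
rewrite (@eq_rint _ _ (fun z => (b - w) ^+ 2 * (f z / (z - w) / (z - w) / (z - b))))//;
    last first.
  by move=> z zb; field; rewrite (on_bd_neq wi zb) (on_bd_neq bI zb).
rewrite rintZ//; last exact: cont_bd_kernel.
rewrite normcM normcX expr2 mulrAC ler_wpM2r ?normc_ge0//.
have H : normc (rint (fun z => f z / (z - w) / (z - w) / (z - b)) x1 x2 y1 y2) <= K.
  apply: normc_rint => //; first exact: cont_bd_kernel.
  move=> z zb; have zr := Hr _ zb; have zM := HM z (proj1 zb).
  have zb2 : r / 2 <= normc (z - b).
    have := lerB_normcB (z - w) (b - w).
    by rewrite (_ : z - w - (b - w) = z - b); [lra|ring].
  rewrite !normcM !normcV.
  rewrite (_ : M * 2 / r ^+ 3 = M / r / r / (r / 2)); last by field; rewrite gt_eqF.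
  have pr : 0 < normc (z - w) by lra.
  have pb : 0 < normc (z - b) by lra.
  have iv1 : (normc (z - w))^-1 <= r^-1 by rewrite lef_pV2 ?posrE.
  have iv2 : (normc (z - b))^-1 <= (r / 2)^-1.
    by rewrite lef_pV2 ?posrE//; lra.
  by rewrite !ler_pM// ?mulr_ge0 ?invr_ge0 ?normc_ge0.
apply: (@le_trans _ _ (normc (b - w) * K)).
  by rewrite ler_wpM2l// normc_ge0.
by rewrite -ler_pdivlMr// ltW.
Qed.

(* Weierstrass' theorem, with approximability in place of a sequence. *)
Lemma weierstrass f x1 x2 y1 y2 w : in_int x1 x2 y1 y2 w ->
  (forall e : R, 0 < e -> exists2 g,
     forall z, in_rect x1 x2 y1 y2 z -> holoC g z &
     forall z, in_rect x1 x2 y1 y2 z -> normc (f z - g z) <= e) ->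
  (forall z, in_rect x1 x2 y1 y2 z -> contC f z) ->
  holoC f w.
Proof.
move=> wi fg fc; have [x12 y12] := in_int_le wi.
(* Cauchy's formula survives uniform approximation, because the boundary stays at a distance [r]
   from [v]. *)
have cf v : in_int x1 x2 y1 y2 v -> f v = rint (fun z => f z / (z - v)) x1 x2 y1 y2 /
    rint (fun z => (z - v)^-1) x1 x2 y1 y2.
  move=> vi; have c0 := cauchy_kernel_neq0 vi.
  apply/esym/eqP; rewrite -subr_eq0; apply/eqP/eq0_normc/eqP.
  rewrite eq_le normc_ge0 andbT.
  have [r r0 Hr] := bd_dist vi.
  set c := rint _ _ _ _ _ in c0 *; have nc0 : 0 < normc c by rewrite normc_gt0.
  set D := x2 - x1 + (y2 - y1).
  have D0 : 0 < D by case: wi => /andP[? ?] /andP[? ?]; rewrite /D; lra.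
  pose K := 4 * r^-1 * D / normc c + 1.
  have K0 : 0 < K by rewrite addr_gt0// !mulr_gt0 ?invr_gt0.
  apply/ler_addgt0Pr => e e0; rewrite add0r.
  have eK : 0 < e / K by rewrite divr_gt0.
  have [g gh gf] := fg _ eK.
  have gc z : in_rect x1 x2 y1 y2 z -> contC g z by move=> /gh/holoC_cont.
  have := @cauchy_formula [::] g _ _ _ _ _ vi gc (fun z zr _ => gh z zr) isT.
  rewrite -/c => gE.
  have fb := in_rect_cont_bd fc; have gb := in_rect_cont_bd gc.
  have -> : rint (fun z => f z / (z - v)) x1 x2 y1 y2 / c - f v =
      rint (fun z => (f z - g z) / (z - v)) x1 x2 y1 y2 / c + (g v - f v).
    rewrite (@eq_rint _ (fun z => (f z - g z) / (z - v)) (fun z => f z / (z - v) - g z / (z - v)))//; last first.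
      by move=> z _; rewrite mulrBl.
    rewrite rintB//; [|exact: cont_bd_kernel|exact: cont_bd_kernel].
    by rewrite gE; field.
  apply: (le_trans (ler_normcD _ _)).
  rewrite [X in _ <= X](_ : _ = 4 * (e / K * r^-1) * D / normc c + e / K); last first.
    rewrite (_ : _ + _ = e / K * K); last by rewrite /K; ring.
    by rewrite divfK// gt_eqF.
  apply: lerD; last first.
    by rewrite normcBC; apply: gf; exact: in_int_rect.
  rewrite normcM normcV ler_wpM2r ?invr_ge0 ?normc_ge0//.
  apply: normc_rint => //.
    by apply: cont_bd_kernel => // z zb; apply: contCB; [exact: fb|exact: gb].
  move=> z zb; have zr := Hr _ zb; rewrite normcM normcV.
  rewrite ler_pM ?invr_ge0 ?normc_ge0//; first by apply: gf; case: zb.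
  by rewrite lef_pV2 ?posrE//; lra.
have [r r0 Hr] := bd_dist wi.
have [d d0 dI] := in_int_open wi.
(* The kernel integral is not known to be independent of [v]; it is treated as the Cauchy integral
   of the constant 1, hence holomorphic as well. *)
apply: (@holoC_near_eq _ (fun v => rint (fun z => f z / (z - v)) x1 x2 y1 y2 /
    rint (fun z => 1 / (z - v)) x1 x2 y1 y2) _ _ _ d0).
  move=> b /dI bi; rewrite cf//.
  by congr (_ / _); apply: eq_rint => // z _; rewrite mul1r.
apply: holoC_div.
- rewrite (@eq_rint _ _ (fun z => (z - w)^-1))//; last by move=> z _; rewrite mul1r.
  exact: cauchy_kernel_neq0.
- exact: holo_cauchy_integral.
- by apply: holo_cauchy_integral => // z _; exact: contC_cst.
Qed.

(* Applying the Cauchy formula to the powers of [f] removes the constant. *)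
Lemma rect_maximum (s : seq R[i]) f x1 x2 y1 y2 w (M : R) : in_int x1 x2 y1 y2 w ->
  (forall z, in_rect x1 x2 y1 y2 z -> contC f z) ->
  (forall z, in_rect x1 x2 y1 y2 z -> z \notin s -> holoC f z) -> w \notin s ->
  (forall z, on_bd x1 x2 y1 y2 z -> normc (f z) <= M) -> normc (f w) <= M.
Proof.
move=> wi fc fh ws fM; have [x12 y12] := in_int_le wi.
have c0 := cauchy_kernel_neq0 wi.
set c := rint _ _ _ _ _ in c0; have nc0 : 0 < normc c by rewrite normc_gt0.
have [r r0 Hr] := bd_dist wi.
set D := x2 - x1 + (y2 - y1).
have D0 : 0 < D by case: wi => /andP[? ?] /andP[? ?]; rewrite /D; lra.
pose K := 4 * r^-1 * D / normc c.
have K0 : 0 < K by rewrite !mulr_gt0 ?invr_gt0.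
have M0 : 0 <= M.
  apply: (le_trans (normc_ge0 _)); apply: (fM (x1 +i* y1)%C).
  by split; [split => /=; rewrite lexx|constructor 1].
have B n : normc (f w) ^+ n <= K * M ^+ n.
  have fnc z : in_rect x1 x2 y1 y2 z -> contC (fun z => f z ^+ n) z.
    by move=> /fc; exact: contCX.
  have := @cauchy_formula s (fun z => f z ^+ n) _ _ _ _ _ wi fnc
    (fun z zr zs => holoCX n (fh z zr zs)) ws.
  rewrite -/c => E; rewrite -normcX.
  have -> : f w ^+ n = rint (fun z => f z ^+ n / (z - w)) x1 x2 y1 y2 / c.
    by rewrite E mulfK.
  rewrite normcM normcV /K mulrAC ler_wpM2r ?invr_ge0 ?normc_ge0//.
  rewrite (_ : _ * M ^+ n = 4 * (M ^+ n * r^-1) * D); last by ring.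
  apply: normc_rint => //.
    by apply: cont_bd_kernel => //; exact: in_rect_cont_bd.
  move=> z zb; have zr := Hr _ zb; rewrite normcM normcV normcX.
  rewrite ler_pM ?invr_ge0 ?exprn_ge0 ?normc_ge0//.
    by rewrite lerXn2r ?nnegrE ?normc_ge0//; exact: fM.
  by rewrite lef_pV2 ?posrE//; lra.
rewrite leNgt; apply/negP => Mf.
have f0 : 0 < normc (f w) by lra.
move: M0; rewrite le_eqVlt => /predU1P[M0|M0].
  by have := B 1; rewrite !expr1 -M0 mulr0; lra.
(* If [normc (f w) = (1 + h) * M] with [h > 0], Bernoulli's inequality makes [(1 + h) ^+ n] exceed
   [K] as soon as [n > K / h]. *)
pose h := normc (f w) / M - 1.
have h0 : 0 < h by rewrite subr_gt0 ltr_pdivlMr// mul1r.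
have := B (Num.truncn (K / h)).+1; set n := (Num.truncn _).+1.
rewrite -ler_pdivrMr ?exprn_gt0// -expr_div_n.
have -> : normc (f w) / M = 1 + h by rewrite /h; ring.
apply/negP; rewrite -ltNge.
have nK : K < n%:R * h by rewrite -ltr_pdivrMr//; exact: truncnS_gt.
apply: (lt_le_trans nK).
have bern (m : nat) : m%:R * h <= (1 + h) ^+ m - 1.
  elim: m => [|m IH]; first by rewrite expr0 mul0r subrr.
  rewrite exprS -natr1; have : 0 <= (m%:R : R) * h by rewrite mulr_ge0// ltW.
  by nra.
by apply: (le_trans (bern n)); rewrite gerBl.
Qed.

End cauchy_formula.

(** * Schwarz-Pick in the half-plane and the automorphisms fixing infinity *)

Section half_plane.
Context {R : realType}.
Implicit Types (z w a : R[i]).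

Lemma Re_conjc z : Re (conjc z) = Re z. Proof. by case: z. Qed.
Lemma Im_conjc z : Im (conjc z) = - Im z. Proof. by case: z. Qed.

(** The pseudo-hyperbolic distance of the half-plane is [normc (z - w) / normc (z + conjc w)]; this
    identity computes one minus its square. *)
Lemma normcD_conj_sqr z w :
  normc (z + conjc w) ^+ 2 = normc (z - w) ^+ 2 + 4 * Re z * Re w.
Proof. by rewrite !normc_sqr !(cReD, cReN, cImD, cImN) Re_conjc Im_conjc; ring. Qed.

Lemma normcD_conj_gt0 z w : 0 < Re z -> 0 < Re w -> 0 < normc (z + conjc w).
Proof.
move=> z0 w0; rewrite normc_gt0; apply: contraTneq (addr_gt0 z0 w0) => e.
by rewrite -(Re_conjc w) -cReD e ltxx.
Qed.

(** For [z = x + i y] on the boundary of a large rectangle and [a = u + i v], one minus the squared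
    pseudo-hyperbolic distance is at most a constant over [m]. In the constant, [4 / u] serves the
    left edge and [16 * u] the other three. *)
Lemma boundary_estimate (x y u v m : R) : 0 < x -> 0 < u -> 0 < m -> x <= m ->
  [\/ x = m^-1, x = m | m / 2 <= `|y - v|] ->
  4 * x * u * m <= (4 / u + 16 * u) * ((x + u) ^+ 2 + (y - v) ^+ 2).
Proof.
move=> x0 u0 m0 xm H.
have u1 : u^-1 * u ^+ 2 = u by rewrite expr2 mulrA mulVf ?mul1r// gt_eqF.
have iu : 0 < u^-1 by rewrite invr_gt0.
set X := (x + u) ^+ 2; set Y := (y - v) ^+ 2.
have Y0 : 0 <= Y by rewrite sqr_ge0.
have X1 : u ^+ 2 <= X by rewrite /X; nra.
have X2 : x ^+ 2 <= X by rewrite /X; nra.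
have iX : u <= u^-1 * X by rewrite -{1}u1 ler_pM2l.
have uX : 0 <= u * X by rewrite mulr_ge0 ?sqr_ge0// ltW.
have uY : 0 <= u * Y by rewrite mulr_ge0 ?sqr_ge0// ltW.
have iY : 0 <= u^-1 * Y by rewrite mulr_ge0 ?sqr_ge0// ltW.
rewrite (_ : (_ + _) * _ = 4 * (u^-1 * X) + 16 * (u * X) + (4 * (u^-1 * Y) + 16 * (u * Y)));
  last by ring.
case: H => [xe|xe|h].
- rewrite (_ : 4 * x * u * m = 4 * u); last by rewrite xe; field; rewrite gt_eqF.
  lra.
- have : u * x ^+ 2 <= u * X by rewrite ler_pM2l.
  rewrite -xe; lra.
- have : m ^+ 2 / 4 <= Y.
    rewrite /Y -(real_normK (num_real (y - v))).
    rewrite (_ : m ^+ 2 / 4 = (m / 2) ^+ 2); last by field.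
    by rewrite ler_pXn2r ?nnegrE//; lra.
  move=> hY; have : u * (m ^+ 2 / 4) <= u * Y by rewrite ler_pM2l.
  have : x * u * m <= m * u * m by rewrite !ler_pM2r.
  lra.
Qed.

(* Large rectangles exhaust the half-plane in such a way that the
   pseudo-hyperbolic distance to [a] tends to 1 on their boundaries. *)
Lemma schwarz_pick_quotient a q : 0 < Re a ->
  (forall z, 0 < Re z -> contC q z) ->
  (forall z, 0 < Re z -> z != a -> holoC q z) ->
  (forall z, 0 < Re z -> normc (q z) ^+ 2 * normc (z - a) ^+ 2 <=
    normc (z + conjc a) ^+ 2) ->
  forall w, 0 < Re w -> w != a -> normc (q w) <= 1.
Proof.
move=> a0 qc qh qle w w0 wa.
rewrite -(ler_pXn2r (n:=2)) ?nnegrE ?normc_ge0// expr1n.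
apply/ler_addgt0Pr => e e0.
pose C := 4 / Re a + 16 * Re a; pose N := normc (q w) ^+ 2.
have C0 : 0 < C by rewrite addr_gt0// ?mulr_gt0 ?invr_gt0.
have N0 : 0 <= N by rewrite sqr_ge0.
(* The summands put [a] and [w] inside the rectangle, keep its horizontal edges [m / 2] away from
   [Im a], and give [C / m <= 1 / 2] and [C * N / m < e]. *)
pose m := 1 + (Re a)^-1 + (Re w)^-1 + Re a + Re w + `|Im w| + 2 * `|Im a| + 2 * C + C * N / e.
have ia : 0 < (Re a)^-1 by rewrite invr_gt0.
have iw : 0 < (Re w)^-1 by rewrite invr_gt0.
have CNe : 0 <= C * N / e by apply: divr_ge0; [apply: mulr_ge0 => //; exact: ltW|exact: ltW].
have mw : 0 <= `|Im w| by []. have ma : 0 <= `|Im a| by [].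
have [m1 m2 m3 m4 m5] : [/\ 1 < m, (Re a)^-1 < m, (Re w)^-1 < m, Re a < m & Re w < m].
  by split; rewrite /m; lra.
have [m6 m7 m8 m9] : [/\ `|Im w| < m, 2 * `|Im a| < m, 2 * C < m & C * N / e < m].
  by split; rewrite /m; lra.
clearbody m.
have m0 : 0 < m by lra.
have Cm : C / m <= 1 / 2 by rewrite ler_pdivrMr//; lra.
have iwm : m^-1 < Re w by rewrite -(invrK (Re w)) ltf_pV2 ?posrE.
have iam : m^-1 < Re a by rewrite -(invrK (Re a)) ltf_pV2 ?posrE.
have im0 : 0 < m^-1 by rewrite invr_gt0.
have rH z : in_rect m^-1 m (- m) m z -> 0 < Re z.
  by move=> [/andP[+ _] _]; exact: lt_le_trans.
have wi : in_int m^-1 m (- m) m w.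
  by split; rewrite ?iwm ?m5//; move: m6; rewrite ltr_norml.
(* [q] is squared to match the hypothesis [qle], and [a] is exceptional because [q] is only
   continuous there. *)
have := @rect_maximum _ [:: a] (fun z => q z ^+ 2) _ _ _ _ w (1 - C / m)^-1 wi.
rewrite inE => /(_ _ _ wa) H.
suff : normc (q w ^+ 2) <= (1 - C / m)^-1.
  rewrite normcX -/N -[X in _ <= X]mul1r ler_pdivlMr; last lra.
  rewrite mulrBr mulr1 lerBlDr => /le_trans; apply; rewrite lerD2l.
  by rewrite mulrA ler_pdivrMr//; move: m9; rewrite ltr_pdivrMr//; lra.
apply: H.
- by move=> z /rH z0; apply: contCX; exact: qc.
- by move=> z /rH z0; rewrite inE => za; apply: holoCX; exact: qh.
move=> z [zr zb]; have z0 := rH _ zr.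
rewrite normcX.
have P0 := normcD_conj_gt0 z0 a0.
have key : 4 * Re z * Re a * m <= C * normc (z + conjc a) ^+ 2.
  have zm : Re z <= m by case: zr => /andP[].
  rewrite normc_sqr cReD cImD Re_conjc Im_conjc.
  apply: boundary_estimate => //; case: zb => h.
  - by constructor 1.
  - by constructor 2.
  - constructor 3; rewrite h ler_normr; apply/orP; right.
    have := ler_norm (- Im a); rewrite normrN; lra.
  - constructor 3; rewrite h ler_normr; apply/orP; left.
    have := ler_norm (Im a); lra.
have key2 : 4 * Re z * Re a <= C / m * normc (z + conjc a) ^+ 2.
  by rewrite (mulrAC C) ler_pdivlMr.
have := qle _ z0; set Q := normc (q z) ^+ 2.
set P := normc (z + conjc a) ^+ 2 in key2 *.
have Q0 : 0 <= Q by rewrite sqr_ge0.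
have P1 : 0 < P by rewrite exprn_gt0.
have -> : normc (z - a) ^+ 2 = P - 4 * Re z * Re a.
  by rewrite /P normcD_conj_sqr addrK.
move=> h; rewrite -[X in _ <= X]mul1r ler_pdivlMr; last lra.
rewrite -(ler_pM2r P1) mul1r -mulrA; apply: le_trans h.
by rewrite ler_wpM2l// mulrBl mul1r lerB.
Qed.

(** The function [g] maps into the disk and vanishes at [a]. Divided by [(z - a) / (z + conjc a)] it
    becomes [p z * (z + conjc a)], with [p] the slope of [g] at [a], to which
    [schwarz_pick_quotient] applies. Denominators are cleared so that [w = a] is included. *)
Lemma schwarz_pick (Phi : R[i] -> R[i]) :
  (forall z, 0 < Re z -> holoC Phi z) -> (forall z, 0 < Re z -> 0 < Re (Phi z)) ->
  forall w a, 0 < Re w -> 0 < Re a ->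
  normc (Phi w - Phi a) ^+ 2 * normc (w + conjc a) ^+ 2 <=
  normc (w - a) ^+ 2 * normc (Phi w + conjc (Phi a)) ^+ 2.
Proof.
move=> Ph Pp w a w0 a0.
have [->|wa] := eqVneq w a; first by rewrite !subrr normc0 expr0n !mul0r.
have den z : 0 < Re z -> Phi z + conjc (Phi a) != 0.
  by move=> z0; rewrite -normc_gt0 normcD_conj_gt0// Pp.
pose g z := (Phi z - Phi a) / (Phi z + conjc (Phi a)).
have gh z : 0 < Re z -> holoC g z.
  move=> z0; apply: holoC_div; first exact: den.
    by apply: holoCB; [exact: Ph|exact: holoC_cst].
  by apply: holoCD; [exact: Ph|exact: holoC_cst].
have ga : g a = 0 by rewrite /g subrr mul0r.
have [p pc gp] := gh _ a0.
have gpz z : g z = p z * (z - a) by rewrite -gp ga subr0.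
have linh b : holoC (fun z => z + conjc a) b.
  by apply: holoCD; [exact: holoC_id|exact: holoC_cst].
have near z : 0 < Re z -> z != a -> exists2 r : R, 0 < r &
    forall b, normc (b - z) < r -> g b / (b - a) = p b.
  move=> z0 za; exists (normc (z - a)); first by rewrite normc_gt0 subr_eq0.
  move=> b bz; rewrite gpz mulfK// subr_eq0.
  by apply: contraTneq bz => ->; rewrite normcBC ltxx.
have ph z : 0 < Re z -> z != a -> holoC p z.
  move=> z0 za; have [r r0 Hr] := near _ z0 za; apply: (holoC_near_eq r0 Hr).
  apply: holoC_div; rewrite ?subr_eq0//; first exact: gh.
  by apply: holoCB; [exact: holoC_id|exact: holoC_cst].
have H := @schwarz_pick_quotient a (fun z => p z * (z + conjc a)) a0.
have : normc (p w * (w + conjc a)) <= 1.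
  apply: H => //.
  - move=> z z0; apply: contCM; last exact: holoC_cont.
    by have [->//|za] := eqVneq z a; apply/holoC_cont/ph.
  - by move=> z z0 za; apply: holoCM => //; exact: ph.
  - move=> z z0; rewrite normcM exprMn mulrAC -exprMn -normcM -gpz.
    rewrite -[X in _ <= X]mul1r ler_wpM2r ?sqr_ge0// /g normcM normcV.
    rewrite -[X in _ <= X](expr1n _ 2) ler_pXn2r ?nnegrE ?mulr_ge0
      ?invr_ge0 ?normc_ge0//.
    rewrite ler_pdivrMr ?normc_gt0 ?den// mul1r.
    rewrite -(ler_pXn2r (n:=2)) ?nnegrE ?normc_ge0// normcD_conj_sqr.
    by rewrite lerDl !mulr_ge0// ltW// Pp.
move=> h.
have e : normc (p w * (w - a)) * normc (w + conjc a) <= normc (w - a).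
  rewrite normcM mulrAC -normcM -[X in _ <= X]mul1r.
  by rewrite ler_wpM2r ?normc_ge0.
move: e; rewrite -gpz /g normcM normcV mulrAC ler_pdivrMr ?normc_gt0 ?den//.
by rewrite -!exprMn ler_pXn2r ?nnegrE ?mulr_ge0 ?normc_ge0.
Qed.

(** Schwarz-Pick for [Phi] and for its left inverse [Psi] are opposite inequalities;
    [normcD_conj_sqr] turns the resulting equality of distances into one where real parts appear as
    factors. *)
Lemma pseudo_hyperbolic_isometry (Phi Psi : R[i] -> R[i]) :
  (forall z, 0 < Re z -> holoC Phi z) -> (forall z, 0 < Re z -> 0 < Re (Phi z)) ->
  (forall z, 0 < Re z -> holoC Psi z) -> (forall z, 0 < Re z -> 0 < Re (Psi z)) ->
  (forall z, 0 < Re z -> Psi (Phi z) = z) ->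
  forall w a, 0 < Re w -> 0 < Re a ->
  Re (Phi w) * Re (Phi a) * normc (w + conjc a) ^+ 2 =
  Re w * Re a * normc (Phi w + conjc (Phi a)) ^+ 2.
Proof.
move=> Ph Pp Sh Sp PS w a w0 a0.
have h1 := schwarz_pick Ph Pp w0 a0.
have := schwarz_pick Sh Sp (Pp _ w0) (Pp _ a0); rewrite !PS// => h2.
rewrite !normcD_conj_sqr in h1 h2 *; nra.
Qed.

Definition aff (s t : R) z : R[i] := ((s * Re z) +i* (s * Im z + t))%C.

Lemma normc_ratio (c d : R[i]) (e : R) : 0 < e -> exists K : R, forall x,
  K <= normc x -> normc (x + c) <= (1 + e) * normc (x + d).
Proof.
move=> e0; exists (normc d + normc (c - d) / e) => x h.
have : normc (c - d) / e <= normc (x + d).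
  by have := lerB_normcD x d; lra.
rewrite ler_pdivrMr// => h2.
have -> : x + c = (x + d) + (c - d) by ring.
apply: (le_trans (ler_normcD _ _)); rewrite mulrDl mul1r lerD2l mulrC; lra.
Qed.

(* The real part of [Phi] is found by letting one of the two points of the
   isometry equation tend to infinity, as for Busemann functions. *)
Lemma half_plane_Re_scaling (Phi : R[i] -> R[i]) :
  (forall z, 0 < Re z -> 0 < Re (Phi z)) ->
  (forall w a, 0 < Re w -> 0 < Re a ->
    Re (Phi w) * Re (Phi a) * normc (w + conjc a) ^+ 2 =
    Re w * Re a * normc (Phi w + conjc (Phi a)) ^+ 2) ->
  (forall K : R, exists r0 : R, forall r, r0 <= r -> K <= normc (Phi r%:C%C)) ->
  forall a, 0 < Re a -> Re (Phi a) = Re (Phi 1) * Re a.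
Proof.
move=> Pp iso Pinf a a0.
have r1 : 0 < Re (1 : R[i]) by exact: ltr01.
have Pa := Pp _ a0; have P1 := Pp _ r1.
set A := Re (Phi a) in Pa *; set B := Re (Phi 1) * Re a.
have B0 : 0 < B by rewrite mulr_gt0.
have main (e : R) : 0 < e -> A <= (1 + e) ^+ 4 * B /\ B <= (1 + e) ^+ 4 * A.
  move=> e0.
  have [K1 H1] := normc_ratio (conjc a) 1 e0.
  have [K2 H2] := normc_ratio 1 (conjc a) e0.
  have [K3 H3] := normc_ratio (conjc (Phi a)) (conjc (Phi 1)) e0.
  have [K4 H4] := normc_ratio (conjc (Phi 1)) (conjc (Phi a)) e0.
  have [r0 Hr] := Pinf (`|K3| + `|K4|).
  pose r := 1 + `|K1| + `|K2| + `|r0|.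
  have rr : r0 <= r by rewrite /r; have := ler_norm r0; have := normr_ge0 K1; have := normr_ge0 K2; lra.
  have rp : 1 <= r by rewrite /r; have := normr_ge0 r0; have := normr_ge0 K1; have := normr_ge0 K2; lra.
  have rK1 : K1 <= normc r%:C%C.
    rewrite normc_real ger0_norm; last lra.
    rewrite /r; have := normr_ge0 r0; have := ler_norm K1; have := normr_ge0 K2; lra.
  have rK2 : K2 <= normc r%:C%C.
    rewrite normc_real ger0_norm; last lra.
    rewrite /r; have := normr_ge0 r0; have := ler_norm K2; have := normr_ge0 K1; lra.
  have rK3 : K3 <= normc (Phi r%:C%C).
    by apply: le_trans (Hr _ rr); have := ler_norm K3; have := normr_ge0 K4; lra.
  have rK4 : K4 <= normc (Phi r%:C%C).
    by apply: le_trans (Hr _ rr); have := ler_norm K4; have := normr_ge0 K3; lra.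
  have {}H1 := H1 _ rK1; have {}H2 := H2 _ rK2; have {}H3 := H3 _ rK3; have {}H4 := H4 _ rK4.
  have r0' : 0 < Re (r%:C%C : R[i]) by rewrite /=; lra.
  have i1 := iso _ _ r0' a0; have i2 := iso _ _ r0' r1.
  have Pr := Pp _ r0'.
  rewrite conjc1 in i2.
  set X := Phi r%:C%C in H3 H4 i1 i2 Pr *.
  have n1 := normcD_conj_gt0 r0' a0.
  have n2 := normcD_conj_gt0 r0' r1; rewrite conjc1 in n2.
  have n3 := normcD_conj_gt0 Pr Pa.
  have n4 := normcD_conj_gt0 Pr P1.
  set p1 := normc (_ + conjc a) in H1 H2 i1 n1 *.
  set p2 := normc (_ + 1) in H1 H2 i2 n2 *.
  set q1 := normc (X + conjc (Phi a)) in H3 H4 i1 n3 *.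
  set q2 := normc (X + conjc (Phi 1)) in H3 H4 i2 n4 *.
  rewrite /= mulr1 in i2; rewrite /= -/A in i1.
  (* Quotient of the isometry equations for the pairs [(r, a)] and [(r, 1)]; for large [r] both
     [p1 / p2] and [q1 / q2] are close to 1, so [A] and [B] must agree. *)
  have E : A * (p1 * q2) ^+ 2 = B * (p2 * q1) ^+ 2.
    have n0 : Re X * r != 0 by rewrite mulf_neq0// gt_eqF//; lra.
    apply: (mulfI n0); rewrite /B.
    transitivity ((Re X * A * p1 ^+ 2) * (r * q2 ^+ 2)); first by ring.
    by rewrite i1 -i2; ring.
  have U1 : (p1 * q2) <= (1 + e) ^+ 2 * (p2 * q1).
    rewrite expr2 mulrACA; apply: ler_pM => //; exact: ltW.
  have U2 : (p2 * q1) <= (1 + e) ^+ 2 * (p1 * q2).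
    rewrite expr2 mulrACA; apply: ler_pM => //; exact: ltW.
  have e2 : 0 <= 1 + e by lra.
  have g1 : 0 < (p1 * q2) ^+ 2 by rewrite exprn_gt0// mulr_gt0.
  have g2 : 0 < (p2 * q1) ^+ 2 by rewrite exprn_gt0// mulr_gt0.
  have {}U1 : (p1 * q2) ^+ 2 <= (1 + e) ^+ 4 * (p2 * q1) ^+ 2.
    rewrite (exprM _ 2 2) -exprMn ler_pXn2r ?nnegrE ?mulr_ge0 ?exprn_ge0// ltW//.
  have {}U2 : (p2 * q1) ^+ 2 <= (1 + e) ^+ 4 * (p1 * q2) ^+ 2.
    rewrite (exprM _ 2 2) -exprMn ler_pXn2r ?nnegrE ?mulr_ge0 ?exprn_ge0// ltW//.
  split.
    rewrite -(ler_pM2r g1) E; apply: (le_trans (ler_wpM2l (ltW B0) U2)).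
    by rewrite mulrA (mulrC B).
  rewrite -(ler_pM2r g2) -E; apply: (le_trans (ler_wpM2l (ltW Pa) U1)).
  by rewrite mulrA (mulrC A).
(* The slope 15 is that of the chord of [(1 + x) ^+ 4] over [[0, 1]]. *)
have lin (x : R) : 0 <= x -> x <= 1 -> (1 + x) ^+ 4 <= 1 + 15 * x.
  move=> x0 x1; have xx : x * x <= x by rewrite -[leRHS]mulr1 ler_wpM2l.
  have h : (1 + x) ^+ 2 <= 1 + 3 * x by rewrite expr2; lra.
  rewrite (exprM _ 2 2); apply: (@le_trans _ _ ((1 + 3 * x) ^+ 2)).
    by rewrite ler_pXn2r ?nnegrE ?sqr_ge0//; lra.
  rewrite expr2; lra.
have lim (U V : R) : 0 < V ->
    (forall e : R, 0 < e -> U <= (1 + e) ^+ 4 * V) -> U <= V.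
  move=> V0 H; apply/ler_addgt0Pr => e e0.
  pose d := Num.min 1 (e / (15 * V)).
  have d0 : 0 < d by rewrite lt_min ltr01 divr_gt0// mulr_gt0.
  have d1 : d <= 1 by rewrite ge_min lexx.
  have : d <= e / (15 * V) by rewrite ge_min lexx orbT.
  rewrite ler_pdivlMr ?mulr_gt0// => d2.
  have := H d d0; have := lin d (ltW d0) d1 => h1 /le_trans; apply.
  have : (1 + d) ^+ 4 * V <= (1 + 15 * d) * V by rewrite ler_pM2r.
  lra.
apply/eqP; rewrite eq_le; apply/andP; split; apply: lim => // e e0; by have [] := main e e0.
Qed.

(** Once the real parts are known, the isometry equation gives [Im (Phi w) - Im (Phi a)] up to sign.
    A single negative sign forces negative signs everywhere, and [Phi] would be a reflected affine
    map, which is not differentiable at 1. *)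
Lemma half_plane_aut_affine (Phi Psi : R[i] -> R[i]) :
  (forall z, 0 < Re z -> holoC Phi z) -> (forall z, 0 < Re z -> 0 < Re (Phi z)) ->
  (forall z, 0 < Re z -> holoC Psi z) -> (forall z, 0 < Re z -> 0 < Re (Psi z)) ->
  (forall z, 0 < Re z -> Psi (Phi z) = z) ->
  (forall K : R, exists r0 : R, forall r, r0 <= r -> K <= normc (Phi r%:C%C)) ->
  exists s t : R, 0 < s /\ forall z, 0 < Re z -> Phi z = aff s t z.
Proof.
move=> Ph Pp Sh Sp PS Pinf.
have iso := pseudo_hyperbolic_isometry Ph Pp Sh Sp PS.
have PRe := half_plane_Re_scaling Pp iso Pinf.
have r1 : 0 < Re (1 : R[i]) by exact: ltr01.
have s0 := Pp _ r1; set s := Re (Phi 1) in s0 PRe; pose t := Im (Phi 1).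
exists s, t; split=> //.
have PIm w a : 0 < Re w -> 0 < Re a ->
    (Im (Phi w) - Im (Phi a)) ^+ 2 = s ^+ 2 * (Im w - Im a) ^+ 2.
  move=> w0 a0; have := iso w a w0 a0; rewrite !PRe// => E.
  have : s ^+ 2 * normc (w + conjc a) ^+ 2 = normc (Phi w + conjc (Phi a)) ^+ 2.
    have n0 : Re w * Re a != 0 by rewrite mulf_neq0// gt_eqF.
    by apply: (mulfI n0); rewrite -E; ring.
  rewrite !normc_sqr !(cReD, cImD) !Re_conjc !Im_conjc !PRe//; nra.
have [H|H] := pselect (forall z, 0 < Re z -> Im (Phi z) = s * Im z + t).
  by move=> z z0; apply: complex_eqP; rewrite /aff/= ?PRe ?H.
move/existsNP: H => [w0 /not_implyP[w00 Hw]].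
have E0 : Im (Phi w0) = t - s * Im w0.
  have /eqP := PIm _ _ w00 r1; rewrite /= subr0 -exprMn eqf_sqr => /orP[]/eqP e.
    by case: Hw; rewrite /t; lra.
  by rewrite /t; lra.
have y0 : Im w0 != 0.
  by apply/eqP => e; apply: Hw; rewrite E0 e; ring.
(* Subtracting the squared relations of [z] to 1 and to [w0] leaves an equation linear in
   [Im (Phi z)], solvable because [Im w0 != 0]. *)
have E z : 0 < Re z -> Im (Phi z) = t - s * Im z.
  move=> z0; have e1 := PIm _ _ z0 r1; have e2 := PIm _ _ z0 w00.
  rewrite E0 in e2; rewrite -/t /= subr0 in e1.
  have n0 : 2 * s * Im w0 != 0 by rewrite !mulf_neq0// gt_eqF.
  apply: (mulfI n0).
  have -> : 2 * s * Im w0 * Im (Phi z) = ((Im (Phi z) - (t - s * Im w0)) ^+ 2 -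
    (Im (Phi z) - t) ^+ 2) + 2 * s * Im w0 * t - (s * Im w0) ^+ 2 by ring.
  by rewrite e1 e2; ring.
(* The difference quotients at 1 along [1] and ['i%C] are [s] and [- s]; both would lie within
   [s / 2] of [l], although they are [2 * s] apart. *)
have /holoC_is_dC[l /(_ (s / 2))] := Ph _ r1.
case; first lra.
move=> d d0 Hd.
pose h := Num.min (d / 2) (1 / 2).
have h0 : 0 < h by rewrite lt_min !divr_gt0.
have hd : h < d by rewrite gt_min; apply/orP; left; lra.
have hi : normc ('i%C * h%:C%C : R[i]) = h.
  by rewrite normcM normc_i normc_real mul1r gtr0_norm.
have hr : normc (h%:C%C : R[i]) = h by rewrite normc_real gtr0_norm.
have h1 := Hd (1 + h%:C%C); have h2 := Hd (1 + 'i%C * h%:C%C).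
rewrite (addrC 1) addrK hr in h1; rewrite (addrC 1) addrK hi in h2.
have {}h1 := h1 hd; have {}h2 := h2 hd.
have e1 : Phi (h%:C%C + 1) - Phi 1 = s%:C%C * h%:C%C.
  have p : 0 < Re (h%:C%C + 1 : R[i]) by rewrite cReD/=; lra.
  apply: complex_eqP; rewrite ?(cReD, cReN, cImD, cImN) ?PRe ?E//.
    by rewrite -/s cReD cReM/=; ring.
  by rewrite -/t cImD cImM/=; ring.
have e2 : Phi ('i%C * h%:C%C + 1) - Phi 1 = - s%:C%C * ('i%C * h%:C%C).
  have p : 0 < Re ('i%C * h%:C%C + 1 : R[i]) by rewrite cReD cReM/=; lra.
  apply: complex_eqP; rewrite ?(cReD, cReN, cImD, cImN) ?PRe ?E//.
    by rewrite -/s !(cReD, cReM, cReN, cImN, cImM)/=; ring.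
  by rewrite -/t !(cImD, cImM, cReM, cReN, cImN)/=; ring.
rewrite e1 -mulrBl normcM hr ler_pM2r// in h1.
rewrite e2 -mulrBl normcM hi ler_pM2r// in h2.
have : normc ((s%:C%C - l) - (- s%:C%C - l) : R[i]) <= s / 2 + s / 2.
  by apply: (le_trans (ler_normcB _ _)); exact: lerD.
rewrite (_ : s%:C%C - l - (- s%:C%C - l) = (s + s)%:C%C); last first.
  by apply: complex_eqP; rewrite !(cReD, cReN, cImD, cImN)/=; ring.
rewrite normc_real ger0_norm; lra.
Qed.

End half_plane.

(** * The Cayley transform with pole [omega] *)

Section cayley.
Context {R : realType}.
Implicit Types (z w : R[i]) (omega eta : R[i]).

Definition cay omega z : R[i] := (omega + z) / (omega - z).
Definition icay omega w : R[i] := omega * ((w - 1) / (w + 1)).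

Lemma Dp1_neq0 w : 0 <= Re w -> w + 1 != 0.
Proof.
move=> w0; apply: contraTneq (ltr_wpDl w0 (@ltr01 R)) => e.
by rewrite -[1]/(Re (1 : R[i])) -cReD e ltxx.
Qed.

Lemma cayK omega z : omega != 0 -> z != omega -> icay omega (cay omega z) = z.
Proof.
move=> o0 zo; have d0 : omega - z != 0 by rewrite subr_eq0 eq_sym.
have e : cay omega z + 1 = 2 * omega / (omega - z) by rewrite /cay; field.
have e' : cay omega z - 1 = 2 * z / (omega - z) by rewrite /cay; field.
by rewrite /icay e e'; field; rewrite o0 d0.
Qed.

Lemma icayK omega w : omega != 0 -> w + 1 != 0 -> cay omega (icay omega w) = w.
Proof.
move=> o0 w0; have e : omega - icay omega w = 2 * omega / (w + 1).
  by rewrite /icay; field.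
have e' : omega + icay omega w = 2 * omega * w / (w + 1).
  by rewrite /icay; field.
by rewrite /cay e e'; field; rewrite o0 w0.
Qed.

Lemma icay_sub omega w : w + 1 != 0 -> icay omega w - omega = - (2 * omega / (w + 1)).
Proof. by move=> w0; rewrite /icay; field. Qed.

Lemma normc2 : normc (2 : R[i]) = 2.
Proof. by rewrite -[2]/((2 : R[i])) -(rmorph_nat (real_complex R)) normc_real normr_nat. Qed.

(** Translates closeness to [omega] into largeness of [w + 1]: limits at [omega] become limits at
    infinity. *)
Lemma normc_icay_sub omega w : normc omega = 1 -> w + 1 != 0 ->
  normc (icay omega w - omega) = 2 / normc (w + 1).
Proof.
by move=> o1 w0; rewrite icay_sub// normcN !normcM normcV o1 mulr1 normc2.
Qed.

Lemma cayD1 omega z : z != omega -> cay omega z + 1 = 2 * omega / (omega - z).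
Proof. by move=> zo; rewrite /cay; field; rewrite subr_eq0 eq_sym. Qed.

Lemma normc_cayD1 omega z : normc omega = 1 -> z != omega ->
  normc (cay omega z + 1) = 2 / normc (z - omega).
Proof.
by move=> o1 zo; rewrite cayD1// !normcM normcV o1 mulr1 normc2 normcBC.
Qed.

Lemma normc1_neq0 omega : normc omega = 1 -> omega != 0.
Proof. by move=> o1; rewrite -normc_gt0 o1. Qed.

Lemma Re_cay omega z : normc omega = 1 -> z != omega ->
  Re (cay omega z) = (1 - normc z ^+ 2) / normc (omega - z) ^+ 2.
Proof.
move=> o1 zo; rewrite /cay cReM Re_inv Im_inv.
have -> : 1 = Re omega ^+ 2 + Im omega ^+ 2 by rewrite -normc_sqr o1 expr1n.
rewrite (normc_sqr z) !(cReD, cReN, cImD, cImN); ring.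
Qed.

Lemma normc_icay_sqr omega w : normc omega = 1 -> w + 1 != 0 ->
  normc (icay omega w) ^+ 2 = 1 - 4 * Re w / normc (w + 1) ^+ 2.
Proof.
move=> o1 w0; have n0 : normc (w + 1) ^+ 2 != 0 by rewrite expf_neq0// normc_eq0.
rewrite /icay !normcM o1 mul1r normcV exprMn exprVn.
have := normcD_conj_sqr w 1; rewrite conjc1 mulr1 => e.
have -> : normc (w - 1) ^+ 2 = normc (w + 1) ^+ 2 - 4 * Re w by rewrite e addrK.
by rewrite mulrBl divff.
Qed.

Lemma disk_neq omega z : normc omega = 1 -> normc z < 1 -> z != omega.
Proof. by move=> o1; apply: contraTneq => ->; rewrite o1 ltxx. Qed.

Lemma Re_cay_gt0 omega z : normc omega = 1 -> normc z < 1 -> 0 < Re (cay omega z).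
Proof.
move=> o1 z1; have zo := disk_neq o1 z1; rewrite Re_cay// divr_gt0 ?exprn_gt0//.
  by rewrite subr_gt0 expr_lt1 ?normc_ge0.
by rewrite normc_gt0 subr_eq0 eq_sym.
Qed.

Lemma Re_cay_ge0 omega z : normc omega = 1 -> z != omega -> normc z <= 1 ->
  0 <= Re (cay omega z).
Proof.
move=> o1 zo z1; rewrite Re_cay// divr_ge0 ?sqr_ge0//.
by rewrite subr_ge0 expr_le1 ?normc_ge0.
Qed.

Lemma normc_icay_lt1 omega w : normc omega = 1 -> 0 < Re w -> normc (icay omega w) < 1.
Proof.
move=> o1 w0; have w1 := Dp1_neq0 (ltW w0).
rewrite -(expr_lt1 (n:=2)) ?normc_ge0// normc_icay_sqr// gtrBl.
apply: divr_gt0; first by rewrite mulr_gt0.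
by rewrite exprn_gt0// normc_gt0.
Qed.

Lemma holoC_icay omega w : w + 1 != 0 -> holoC (icay omega) w.
Proof.
move=> w0; apply: holoCM; first exact: holoC_cst.
apply: holoC_div => //.
  by apply: holoCB; [exact: holoC_id|exact: holoC_cst].
by apply: holoCD; [exact: holoC_id|exact: holoC_cst].
Qed.

Lemma holoC_cay omega z : z != omega -> holoC (cay omega) z.
Proof.
move=> zo; apply: holoC_div; first by rewrite subr_eq0 eq_sym.
  by apply: holoCD; [exact: holoC_cst|exact: holoC_id].
by apply: holoCB; [exact: holoC_cst|exact: holoC_id].
Qed.

Lemma affE (s t : R) w : aff s t w = s%:C%C * w + 'i%C * t%:C%C.
Proof.
by apply: complex_eqP; rewrite !(cReD, cReM, cImD, cImM)/=; ring.
Qed.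

Lemma holoC_aff (s t : R) w : holoC (aff s t) w.
Proof.
rewrite (_ : aff s t = fun w => s%:C%C * w + 'i%C * t%:C%C); last first.
  by apply/funext => z; exact: affE.
apply: holoCD; last exact: holoC_cst.
by apply: holoCM; [exact: holoC_cst|exact: holoC_id].
Qed.

Lemma aff_comp (s t s' t' : R) w :
  aff s t (aff s' t' w) = aff (s * s') (s * t' + t) w.
Proof. by apply: complex_eqP; rewrite /aff/=; ring. Qed.

End cayley.

(** * Holomorphy and fixed points on the disk, with real bounds *)

Section disk_functions.
Context {R : realType}.
Implicit Types (z w : R[i]) (phi psi : disk_aut R).

Lemma unit_diskE z : unit_disk R z <-> normc z < 1.
Proof. by rewrite /unit_disk /= normcE -[1]/((1 : R)%:C%C) ltcR. Qed.

Lemma unit_circleE z : unit_circle R z <-> normc z = 1.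
Proof.
rewrite /unit_circle /= normcE -[1]/((1 : R)%:C%C); split=> [/complexI//|->//].
Qed.

Lemma closed_unit_diskE z : closed_unit_disk R z <-> normc z <= 1.
Proof. by rewrite /closed_unit_disk /= normcE -[1]/((1 : R)%:C%C) lecR. Qed.

Definition mkD z (z1 : normc z < 1) : unit_disk R :=
  exist _ z (mem_set ((unit_diskE z).2 z1)).

Lemma disk_normc (z : unit_disk R) : normc (set_val z) < 1.
Proof. exact/unit_diskE/set_valP. Qed.

Lemma val_mkD z (z1 : normc z < 1) : set_val (mkD z1) = z. Proof. by []. Qed.

Lemma valL_mkD (f : unit_disk R -> R[i]) z (z1 : normc z < 1) :
  'valL_0 f z = f (mkD z1).
Proof. by rewrite -{1}(val_mkD z1) valL_disk. Qed.

Lemma holomorphicP (f : unit_disk R -> R[i]) (G : R[i] -> R[i]) :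
  (forall z : unit_disk R, f z = G (set_val z)) ->
  holomorphic f <-> (forall z, normc z < 1 -> holoC G z).
Proof.
move=> fG.
have near z : normc z < 1 -> exists2 r : R, 0 < r & forall b, normc (b - z) < r ->
    'valL_0 f b = G b.
  move=> z1; exists (1 - normc z); first by rewrite subr_gt0.
  move=> b bz; have b1 : normc b < 1.
    by have := lerB_normcB b z; lra.
  by rewrite (valL_mkD _ b1) fG.
split=> [fh z z1|Gh z /unit_diskE z1].
  have [r r0 Hr] := near z z1; apply: (holoC_near_eq r0 Hr).
  by apply/holoC_derivable; apply: fh; apply/unit_diskE.
have [r r0 Hr] := near z z1; apply/holoC_derivable.
apply: (@holoC_near_eq _ G _ _ r) => //; last exact: Gh.
by move=> b /Hr ->.
Qed.

Lemma holomorphic_holoC (f : unit_disk R -> R[i]) :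
  holomorphic f -> forall z, normc z < 1 -> holoC ('valL_0 f) z.
Proof.
have [z|H _ fh] := @holomorphicP f ('valL_0 f); first by rewrite valL_disk.
exact: H.
Qed.

Lemma fixed_pointP phi eta : fixed_point phi eta <-> normc eta <= 1 /\
  forall e : R, 0 < e -> exists2 d : R, 0 < d & forall z : unit_disk R,
    normc (set_val z - eta) < d -> normc (set_val (phi z) - eta) < e.
Proof.
split=> -[/closed_unit_diskE e1 H]; split=> //; try exact/closed_unit_diskE.
  move=> e e0; have : nbhs eta [set w | normc (w - eta) < e].
    by apply/nbhs_normcP; exists e.
  move=> /H h; have {h} : nbhs eta (fun w => unit_disk R w ->
      normc ('valL_0 (fun z : unit_disk R => set_val (phi z)) w - eta) < e) by exact: h.
  move=> /nbhs_normcP[d d0 Hd]; exists d => // z /Hd/(_ (set_valP z)).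
  by rewrite valL_disk.
move=> A /nbhs_normcP[e e0 eA]; have [d d0 Hd] := H e e0.
suff : nbhs eta (fun w => unit_disk R w ->
  A ('valL_0 (fun z : unit_disk R => set_val (phi z)) w)) by [].
apply/nbhs_normcP; exists d => // b bd /unit_diskE b1.
by rewrite (valL_mkD _ b1); apply: eA; apply: Hd.
Qed.

End disk_functions.

(** * Affine form of the automorphisms attracted by [omega] *)

Section classification.
Context {R : realType}.
Implicit Types (z w : R[i]) (omega eta : R[i]) (phi : disk_aut R).

Definition half_map omega (phi : unit_disk R -> unit_disk R) w : R[i] :=
  cay omega ('valL_0 (fun z : unit_disk R => set_val (phi z)) (icay omega w)).

Lemma half_mapE omega (phi : unit_disk R -> unit_disk R) w
    (w1 : normc (icay omega w) < 1) :
  half_map omega phi w = cay omega (set_val (phi (mkD w1))).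
Proof. by rewrite /half_map (valL_mkD _ w1). Qed.

Lemma half_map_holo omega (phi : unit_disk R -> unit_disk R) : normc omega = 1 ->
  holomorphic_map phi -> forall w, 0 < Re w -> holoC (half_map omega phi) w.
Proof.
move=> o1 ph w w0; have w1 := normc_icay_lt1 o1 w0.
apply: (@holoC_comp _ (cay omega)
    (fun w => 'valL_0 (fun z : unit_disk R => set_val (phi z)) (icay omega w))).
  apply: (@holoC_comp _ ('valL_0 (fun z : unit_disk R => set_val (phi z)))).
    by apply: holoC_icay; apply: Dp1_neq0; exact: ltW.
  exact: holomorphic_holoC.
rewrite (valL_mkD _ w1); apply: holoC_cay; apply: disk_neq o1 _.
exact: disk_normc.
Qed.

Lemma half_map_gt0 omega (phi : unit_disk R -> unit_disk R) w : normc omega = 1 ->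
  0 < Re w -> 0 < Re (half_map omega phi w).
Proof.
move=> o1 w0; rewrite (half_mapE _ (normc_icay_lt1 o1 w0)).
by apply: Re_cay_gt0 => //; exact: disk_normc.
Qed.

Definition is_aff omega (phi : unit_disk R -> unit_disk R) (s t : R) :=
  forall z : unit_disk R, set_val (phi z) = icay omega (aff s t (cay omega (set_val z))).

Lemma aut_affine omega phi : normc omega = 1 -> fixed_point phi omega ->
  exists s t : R, 0 < s /\ is_aff omega phi s t.
Proof.
move=> o1 /fixed_pointP[_ fp]; have o0 := normc1_neq0 o1.
have [psi [psih phiK psiK]] := disk_aut_biholo phi.
have phih := @disk_aut_holo _ phi.
have [| |s [t [s0 H]]] := @half_plane_aut_affine R (half_map omega phi)
  (half_map omega psi) (half_map_holo o1 phih)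
  (fun w => @half_map_gt0 omega phi w o1) (half_map_holo o1 psih)
  (fun w => @half_map_gt0 omega psi w o1).
  move=> w w0; have w1 := normc_icay_lt1 o1 w0.
  have p0 := half_map_gt0 phi o1 w0.
  rewrite (half_mapE _ (normc_icay_lt1 o1 p0)).
  have e : mkD (normc_icay_lt1 o1 p0) = phi (mkD w1).
    apply: val_inj; transitivity (icay omega (half_map omega phi w)) => //.
    rewrite (half_mapE _ w1) cayK//.
    by apply: disk_neq => //; exact: disk_normc.
  rewrite e phiK val_mkD icayK//; apply: Dp1_neq0; exact: ltW.
  (* The fixed point enters here: [r] tending to infinity is a radial approach to [omega], along
     which [phi] tends to [omega], so [half_map omega phi] tends to infinity. *)
  move=> K; have K1 : 0 < `|K| + 1 by have := normr_ge0 K; lra.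
  have [|d d0 Hd] := fp (2 / (`|K| + 1)); first by rewrite divr_gt0.
  exists (2 / d + 1) => r rd.
  have d2 : 0 < 2 / d by rewrite divr_gt0.
  have r0 : 0 < r by lra.
  have w0 : 0 < Re (r%:C%C : R[i]) by [].
  have w1 := normc_icay_lt1 o1 w0.
  have := Hd (mkD w1); rewrite val_mkD normc_icay_sub//; last first.
    by apply: Dp1_neq0; exact: ltW.
  have -> : normc (r%:C%C + 1 : R[i]) = r + 1.
    rewrite -[1](rmorph1 (real_complex R)) -(rmorphD (real_complex R)) normc_real.
    by rewrite ger0_norm//; lra.
  have r1 : 2 / (r + 1) < d.
    rewrite ltr_pdivrMr; last lra.
    rewrite mulrC -ltr_pdivrMr//; lra.
  move=> /(_ r1) h.
  have pd := disk_normc (phi (mkD w1)).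
  have po := disk_neq o1 pd.
  have := normc_cayD1 o1 po; rewrite -half_mapE => e.
  have := ler_normcD (half_map omega phi r%:C%C) 1; rewrite normc1 e => h2.
  have n0 : 0 < normc (set_val (phi (mkD w1)) - omega).
    by rewrite normc_gt0 subr_eq0.
  have : `|K| + 1 < 2 / normc (set_val (phi (mkD w1)) - omega).
    by rewrite ltr_pdivlMr// mulrC -ltr_pdivlMr.
  have := ler_norm K; lra.
exists s, t; split=> // z; have z1 := disk_normc z.
have c0 := Re_cay_gt0 o1 z1.
rewrite -H// (half_mapE _ (normc_icay_lt1 o1 c0)) cayK//.
  by congr (set_val (phi _)); apply: val_inj; rewrite /= cayK//; exact: disk_neq.
apply: disk_neq => //; exact: disk_normc.
Qed.

Lemma is_aff_fixed_omega omega phi (s t : R) : normc omega = 1 -> 0 < s ->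
  is_aff omega phi s t -> fixed_point phi omega.
Proof.
move=> o1 s0 phiE; apply/fixed_pointP; split; first by rewrite o1.
move=> e e0; have b0 : 0 <= `|1 - s| + `|t| by rewrite addr_ge0.
have c0 : 0 < `|1 - s| + `|t| + 2 / e by rewrite ltr_wpDl// divr_gt0.
(* As [normc (w + 1) = 2 / normc (z - omega)], this radius makes [s * normc (w + 1)] exceed the
   correction [|1 - s| + |t|] by more than [2 / e]. *)
exists (2 * s / (`|1 - s| + `|t| + 2 / e)); first by rewrite !divr_gt0// mulr_gt0.
move=> z; have z1 := disk_normc z; have zo := disk_neq o1 z1.
have w0 := Re_cay_gt0 o1 z1; set w := cay omega (set_val z) in w0.
have zn : 0 < normc (set_val z - omega) by rewrite normc_gt0 subr_eq0.
rewrite ltr_pdivlMr// => h.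
have a0 : 0 < Re (aff s t w) by rewrite /= mulr_gt0.
have a1 := Dp1_neq0 (ltW a0).
rewrite phiE normc_icay_sub// -/w ltr_pdivrMr ?normc_gt0//.
rewrite mulrC -ltr_pdivrMr//.
have wz := normc_cayD1 o1 zo; rewrite -/w in wz.
have -> : aff s t w + 1 = s%:C%C * (w + 1) - ((s - 1)%:C%C - 'i%C * t%:C%C).
  by apply: complex_eqP; rewrite /aff !(cReD, cReM, cReN, cImD, cImM, cImN)/=; ring.
apply: lt_le_trans (lerB_normcB _ _).
rewrite normcM normc_real gtr0_norm// wz.
have : normc ((s - 1)%:C%C - 'i%C * t%:C%C : R[i]) <= `|1 - s| + `|t|.
  apply: (le_trans (ler_normcB _ _)).
  by rewrite normcM normc_i mul1r !normc_real distrC.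
have : `|1 - s| + `|t| + 2 / e < s * (2 / normc (set_val z - omega)).
  by rewrite mulrA ltr_pdivlMr// mulrC (mulrC s).
lra.
Qed.

Lemma is_aff_fixed_other omega phi (s t : R) eta : normc omega = 1 -> 0 < s ->
  is_aff omega phi s t -> eta != omega ->
  fixed_point phi eta <-> normc eta <= 1 /\ aff s t (cay omega eta) = cay omega eta.
Proof.
move=> o1 s0 phiE eo; have o0 := normc1_neq0 o1.
pose F z := icay omega (aff s t (cay omega z)).
have [e1|e1] := leP (normc eta) 1; last first.
  by split=> [/fixed_pointP[]|[//]]; rewrite leNgt e1.
have v0 := Re_cay_ge0 o1 eo e1; set v := cay omega eta in v0 *.
have a0 : 0 <= Re (aff s t v) by rewrite /= mulr_ge0// ltW.
have a1 := Dp1_neq0 a0.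
have Fc : contC F eta.
  apply: holoC_cont; apply: (@holoC_comp _ (icay omega)
      (fun z => aff s t (cay omega z))); last exact: holoC_icay.
  by apply: (@holoC_comp _ (aff s t)); [exact: holoC_cay|exact: holoC_aff].
have -> : aff s t v = v <-> F eta = eta.
  split=> [e|e]; first by rewrite /F -/v e cayK.
  by rewrite -[LHS](icayK o0 a1) -/(F eta) e.
split.
  move=> /fixed_pointP[_ H]; split=> //.
  apply/eqP; rewrite -subr_eq0 -normc_eq0 eq_le normc_ge0 andbT.
  apply/ler_addgt0Pr => e e0; rewrite add0r.
  have e20 : 0 < e / 2 by lra.
  have [d1 d10 H1] := Fc _ e20; have [d2 d20 H2] := H _ e20.
  pose d := Num.min (1 / 2) (Num.min d1 d2 / 2).
  have d0 : 0 < d by rewrite lt_min !divr_gt0// lt_min d10.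
  have [dh dd1 dd2] : [/\ d <= 1 / 2, d < d1 & d < d2].
    rewrite /d; split; first by rewrite ge_min lexx.
      rewrite gt_min; apply/orP; right.
      have : Num.min d1 d2 <= d1 by rewrite ge_min lexx.
      lra.
    rewrite gt_min; apply/orP; right.
    have : Num.min d1 d2 <= d2 by rewrite ge_min lexx orbT.
    lra.
  (* A point of the open disk near [eta], which may lie on the circle: only at such points are [phi]
     and its extension [F] known to agree. *)
  pose b := (1 - d)%:C%C * eta.
  have bE : normc (b - eta) <= d.
    rewrite (_ : b - eta = - (d%:C%C * eta)); last first.
      by apply: complex_eqP; rewrite /b !(cReD, cReM, cReN, cImD, cImM, cImN)/=; ring.
    by rewrite normcN normcM normc_real gtr0_norm// ler_piMr// ltW.
  have b1 : normc b < 1.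
    rewrite /b normcM normc_real ger0_norm; last lra.
    by apply: (@le_lt_trans _ _ (1 - d)); [rewrite ler_piMr//; lra|lra].
  have := H1 b (le_lt_trans bE dd1); have := H2 (mkD b1) (le_lt_trans bE dd2).
  rewrite phiE val_mkD -/(F b) => h2 h1.
  have -> : F eta - eta = (F b - eta) - (F b - F eta) by ring.
  by apply: (le_trans (ler_normcB _ _)); lra.
move=> [_ Fe]; apply/fixed_pointP; split=> // e e0.
have [d d0 Hd] := Fc e e0; exists d => // z /Hd.
by rewrite Fe phiE.
Qed.

Lemma iter_aff omega phi (s t : R) n (z : unit_disk R) : normc omega = 1 -> 0 < s ->
  is_aff omega phi s t -> set_val (iter n phi z) =
  icay omega (iter n (aff s t) (cay omega (set_val z))) /\
  0 < Re (iter n (aff s t) (cay omega (set_val z))).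
Proof.
move=> o1 s0 phiE; have o0 := normc1_neq0 o1; have z1 := disk_normc z.
elim: n => [|n [IH IH0]] /=.
  by rewrite cayK ?Re_cay_gt0// disk_neq.
rewrite phiE IH icayK//; last by apply: Dp1_neq0; exact: ltW.
by split => //=; rewrite mulr_gt0.
Qed.

Lemma Re_iter_aff (s t : R) n w : Re (iter n (aff s t) w) = s ^+ n * Re w.
Proof. by elim: n => [|n IH]; rewrite ?expr0 ?mul1r//= IH exprS mulrA. Qed.

(** The finite fixed point of [w |-> s w + i t] lies on the imaginary axis, the boundary of the
    half-plane, and so comes from a point of the circle. *)
Definition other_fixed (omega : R[i]) (s t : R) : R[i] :=
  icay omega ('i%C * (t / (1 - s))%:C%C).

Lemma other_fixedP omega (s t : R) : normc omega = 1 -> s != 1 ->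
  [/\ normc (other_fixed omega s t) = 1, other_fixed omega s t != omega &
   aff s t (cay omega (other_fixed omega s t)) = cay omega (other_fixed omega s t)].
Proof.
move=> o1 s1; have o0 := normc1_neq0 o1.
set v := 'i%C * (t / (1 - s))%:C%C.
have v0 : Re v = 0 by rewrite /v cReM/=; ring.
have v1 : v + 1 != 0 by apply: Dp1_neq0; rewrite v0.
have s10 : 1 - s != 0 by rewrite subr_eq0 eq_sym.
split.
- apply: sqr_normc_inj; rewrite ?normc_ge0//.
  by rewrite /other_fixed normc_icay_sqr// v0 mulr0 mul0r subr0 expr1n.
- rewrite -subr_eq0 -normc_eq0 normc_icay_sub//.
  by rewrite mulf_neq0// invr_neq0// normc_eq0.
- rewrite icayK//; apply: complex_eqP; rewrite /aff /v !(cReM, cImM)/=; first by ring.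
  by field.
Qed.

(** A multiplier [s != 1] produces the second fixed point [other_fixed], so the parabolic case is
    [s = 1] with [t != 0]; among the hyperbolic maps, [s < 1] is excluded because infinity then
    repels. *)
Lemma attractive_affine omega phi : normc omega = 1 ->
  attractive_fixed_point phi omega <->
  exists s t : R, [/\ 1 <= s, s != 1 \/ t != 0 & is_aff omega phi s t].
Proof.
move=> o1; have o0 := normc1_neq0 o1; split.
  move=> [fo H]; have [s [t [s0 phiE]]] := aut_affine o1 fo.
  have id_other (s1 : s = 1) (t0 : t = 0) eta : eta != omega ->
      normc eta <= 1 -> fixed_point phi eta.
    move=> eo e1; apply/(is_aff_fixed_other o1 s0 phiE eo); split=> //.
    by apply: complex_eqP; rewrite /aff s1 t0 /=; ring.
  exists s, t; case: H => [[a _ fa]|[hyp H]].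
    have ao : a = omega.
      by have : fixed_point phi omega by []; rewrite fa => ->.
    have [s1|s1] := eqVneq s 1; last first.
      have [e1 eo ee] := other_fixedP t o1 s1.
      have : fixed_point phi (other_fixed omega s t).
        by apply/(is_aff_fixed_other o1 s0 phiE eo); rewrite e1.
      by rewrite fa ao => /eqP; rewrite (negPf eo).
    split=> //; first by rewrite s1.
    right; apply/eqP => t0.
    have : fixed_point phi 0 by apply: id_other; rewrite ?normc0 1?eq_sym.
    by rewrite fa ao => /esym/eqP; rewrite (negPf o0).
  suff [s1 st] : 1 <= s /\ (s != 1 \/ t != 0) by [].
  apply: contrapT => NS.
  (* A bounded orbit of [1 = cay omega 0] contradicts attraction: the iterates of [phi] at 0 would
     stay at a distance at least [2 / (c + 1)] from [omega]. For [s < 1], the ball of radius [c] is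
     mapped into itself since [s * c + |t| <= c]. *)
  have [c c0 Hc] : exists2 c : R, 0 < c &
      forall n, normc (iter n (aff s t) (1 : R[i])) <= c.
    have [s1|s1] := ltP s 1.
      pose c := 1 + `|t| / (1 - s).
      have ts : `|t| / (1 - s) * (1 - s) = `|t|.
        by rewrite divfK// subr_eq0 gt_eqF.
      have q0 : 0 <= `|t| / (1 - s) by rewrite divr_ge0//; lra.
      have c0 : 0 < c by rewrite /c; lra.
      exists c => //; elim=> [|n IH]; first by rewrite -[iter _ _ _]/(1 : R[i]) normc1 /c; lra.
      rewrite iterS affE; apply: (le_trans (ler_normcD _ _)).
      rewrite !normcM normc_i mul1r !normc_real gtr0_norm//.
      have : s * normc (iter n (aff s t) 1) <= s * c by rewrite ler_pM2l.
      have : s * c + `|t| <= c by rewrite /c; lra.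
      lra.
    have [s11|s11] := eqVneq s 1; last by case: NS; split=> //; left.
    have [t0|t0] := eqVneq t 0; last by case: NS; split=> //; right.
    exists 1 => // n; suff -> : iter n (aff s t) (1 : R[i]) = 1 by rewrite normc1.
    elim: n => // n; rewrite iterS => ->.
    by apply: complex_eqP; rewrite /aff s11 t0/=; ring.
  have z1 : normc (0 : R[i]) < 1 by rewrite normc0.
  have e0 : 0 < 2 / (c + 1) by rewrite divr_gt0//; lra.
  have : nbhs omega [set w | normc (w - omega) < 2 / (c + 1)].
    by apply/nbhs_normcP; exists (2 / (c + 1)).
  move=> /(H (mkD z1))[n _ /(_ n (leqnn n))]/=.
  have [-> p0] := iter_aff n (mkD z1) o1 s0 phiE.
  rewrite normc_icay_sub//; last by apply: Dp1_neq0; exact: ltW.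
  rewrite val_mkD.
  have -> : cay omega 0 = 1 by rewrite /cay addr0 subr0 divff.
  apply/negP; rewrite -leNgt ler_pM2l// lef_pV2 ?posrE//; last 2 first.
  - lra.
  - rewrite normc_gt0; apply: Dp1_neq0; apply/ltW.
    by move: p0; rewrite val_mkD /cay addr0 subr0 divff.
  by apply: (le_trans (ler_normcD _ _)); rewrite normc1 lerD2r.
move=> [s [t [s1 st phiE]]].
have s0 : 0 < s by lra.
have fo := is_aff_fixed_omega o1 s0 phiE.
split=> //; have [es|es] := eqVneq s 1.
  left; exists omega; first exact/unit_circleE.
  apply/seteqP; split=> [eta fe|eta ->//] /=.
  apply: contrapT => /eqP eo; move: fe => /(is_aff_fixed_other o1 s0 phiE eo)[_].
  rewrite /aff es => /(congr1 (@complex.Im R))/=; rewrite mul1r.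
  case: st => [|/eqP t0]; first by rewrite es eqxx.
  by move=> h; apply: t0; lra.
right; have [e1 eo ee] := other_fixedP t o1 es; split.
  exists omega, (other_fixed omega s t); split; try exact/unit_circleE.
    by move=> /esym/eqP; rewrite (negPf eo).
  apply/seteqP; split=> [eta fe|eta [->//|->]] /=; last first.
    by apply/(is_aff_fixed_other o1 s0 phiE eo); rewrite e1.
  have [|eto] := eqVneq eta omega; [by left|right].
  move: fe => /(is_aff_fixed_other o1 s0 phiE eto)[_ fe].
  rewrite -(cayK o0 eto); congr (icay _ _).
  have s10 : 1 - s != 0 by rewrite subr_eq0 eq_sym.
  have := congr1 (@complex.Re R) fe; have := congr1 (@complex.Im R) fe.
  rewrite /aff/=; move: (cay omega eta) => v hi hr.
  apply: complex_eqP; rewrite !(cReM, cImM)/=.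
    rewrite mul0r mulr0 subr0.
    have : (1 - s) * Re v = 0 by lra.
    by move=> /eqP; rewrite mulf_eq0 (negPf s10)/= => /eqP.
  rewrite mul0r mul1r add0r; apply: (mulfI s10).
  rewrite [RHS]mulrC divfK//; lra.
move=> z A /nbhs_normcP[e e0 eA].
have w0 := Re_cay_gt0 o1 (disk_normc z); set w := cay omega (set_val z) in w0.
have se : 0 < s - 1 by rewrite lt_neqAle eq_sym subr_eq0 es/= subr_ge0.
have K0 : 0 < 2 / (e * Re w * (s - 1)) by rewrite !divr_gt0// !mulr_gt0.
exists (Num.truncn (2 / (e * Re w * (s - 1)))).+1 => // n /= nN.
apply: eA; have [-> p0] := iter_aff n z o1 s0 phiE; rewrite -/w in p0 *.
have p1 := Dp1_neq0 (ltW p0).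
rewrite normc_icay_sub// ltr_pdivrMr ?normc_gt0//.
have h1 : Re (iter n (aff s t) w) <= normc (iter n (aff s t) w + 1).
  apply: le_trans (ler_Re_normc _); apply: le_trans (ler_norm _).
  by rewrite cReD/= lerDl.
rewrite Re_iter_aff in h1.
have bern (m : nat) : m%:R * (s - 1) <= s ^+ m.
  elim: m => [|m IH]; first by rewrite expr0 mul0r.
  rewrite exprS -natr1; have : 1 <= s ^+ m by rewrite exprn_ege1.
  nra.
have h2 : 2 < e * (n%:R * (s - 1) * Re w).
  have : 2 / (e * Re w * (s - 1)) < n%:R.
    apply: lt_le_trans (truncnS_gt _) _; by rewrite ler_nat.
  by rewrite ltr_pdivrMr ?mulr_gt0//; lra.
apply: (lt_le_trans h2); rewrite ler_pM2l//; apply: le_trans h1.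
by rewrite ler_pM2r.
Qed.

End classification.

(** * Compact subsets of the disk *)

Section disk_topology.
Context {R : realType} {omega : R[i]} (o1 : normc omega = 1).

Lemma disk_nbhsP (z : unit_disk R) (S : set (unit_disk R)) : nbhs z S <->
  exists2 d : R, 0 < d &
    forall z', normc (set_val z' - set_val z) < d -> S z'.
Proof.
split.
  move=> [_ [[B oB <-] Bz BS]].
  have /nbhs_normcP[d d0 Hd] : nbhs (set_val z) B by apply: open_nbhs_nbhs.
  by exists d => // z' /Hd; exact: BS.
move=> [d d0 Hd].
have H : nbhs (set_val z) [set w | normc (w - set_val z) < d].
  by apply/nbhs_normcP; exists d.
have h : nbhs z (set_val @^-1` [set w | normc (w - set_val z) < d]).
  exact: (@initial_continuous (unit_disk R) _ set_val z _ H).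
by apply: filterS h => z'; exact: Hd.
Qed.

(** Compactness in its covering form, along [r] tending to 1 from the left: near each point of [K],
    the modulus stays below all [r] close enough to 1. *)
Lemma compact_disk_bounded (K : set (unit_disk R)) : compact K ->
  exists2 r : R, 0 <= r < 1 & forall z, K z -> normc (set_val z) <= r.
Proof.
move=> /compact_near_coveringP/(_ R (1^'-)
  (fun r (z : unit_disk R) => normc (set_val z) < r) _) H.
have [r [[Kr r0] r1]] : exists r : R, (K `<=` (fun z => normc (set_val z) < r) /\
    0 < r) /\ r < 1.
  apply: (@filter_ex _ (1^'-)); apply: filterI; last exact: nbhs_left_lt.
  apply: filterI; last exact: nbhs_left_gt.
  apply: H => z Kz; have z1 := disk_normc z.
  pose p := (1 + normc (set_val z)) / 2.
  have [p1 p2] : normc (set_val z) < p /\ p < 1 by rewrite /p; split; lra.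
  exists ([set z' | normc (set_val z') < p], [set i | p < i]).
    split=> /=; last exact: nbhs_left_gt.
    apply/disk_nbhsP; exists (p - normc (set_val z)); first by rewrite subr_gt0.
    by move=> z' h /=; have := lerB_normcB (set_val z') (set_val z); lra.
  by move=> [z' i] /= [h1 h2]; exact: lt_trans h2.
by exists r; [rewrite r1 (ltW r0)|move=> z /Kr/ltW].
Qed.

(** Bisection yields the covering form of compactness directly. With [compact_disk_bounded] and
    [cay_rect], these rectangles are cofinal among the compact subsets of the disk. *)
Lemma compact_cay_rect (m : R) : 1 <= m ->
  compact [set z : unit_disk R | in_rect m^-1 m (- m) m (cay omega (set_val z))].
Proof.
move=> m1; apply/compact_near_coveringP => I F P FF H.
have o0 := normc1_neq0 o1.
have im0 : 0 < m^-1 by rewrite invr_gt0; lra.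
have im1 : m^-1 <= m by apply: (@le_trans _ _ 1) => //; rewrite invf_le1//; lra.
apply: (@rect_bisect _ (fun a b c d => \forall i \near F, forall z : unit_disk R,
  in_rect a b c d (cay omega (set_val z)) -> P i z) m^-1 m (- m) m) => //.
- lra.
- move=> a b c d _ _ _ _ _ _ h1 h2 h3 h4.
  apply: filterS (filterI (filterI h1 h2) (filterI h3 h4)).
  move=> i [[{}h1 {}h2] [{}h3 {}h4]] z [/andP[za zb] /andP[zc zd]].
  have [h|h] := leP (Re (cay omega (set_val z))) ((a + b) / 2);
    have [h'|h'] := leP (Im (cay omega (set_val z))) ((c + d) / 2).
  + by apply: h1; split; apply/andP; split=> //; exact: ltW.
  + by apply: h3; split; apply/andP; split=> //; exact: ltW.
  + by apply: h2; split; apply/andP; split=> //; exact: ltW.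
  + by apply: h4; split; apply/andP; split=> //; exact: ltW.
- move=> u v um vm; pose w := (u +i* v)%C.
  have w0 : 0 < Re w by case/andP: um => h _; exact: lt_le_trans h.
  have w1 := normc_icay_lt1 o1 w0.
  have wn := Dp1_neq0 (ltW w0).
  have [|[S1 S2] /= [/disk_nbhsP[d d0 Hd] FS2] S12] := H (mkD w1).
    by rewrite /= icayK.
  have [e e0 He] := holoC_cont (@holoC_icay _ omega _ wn) d0.
  exists (e / 2); first lra.
  move=> a b c d' _ _ _ _ ua vc ab cd; apply: filterS FS2 => i S2i z zr.
  apply: (S12 (z, i)); split=> //=; apply: Hd.
  have zo := disk_neq o1 (disk_normc z).
  rewrite -(cayK o0 zo); apply: He.
  have wr : in_rect a b c d' w by split.
  by have := normc_in_rect zr wr; lra.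
Qed.

End disk_topology.

(** * The function space in half-plane coordinates *)

Section half_plane_coordinates.
Context {R : realType} {omega : R[i]} (o1 : normc omega = 1).
Implicit Types (z w : R[i]) (f g : holo_space R) (A : set (holo_space R)).

Definition hp (omega : R[i]) f w : R[i] := 'valL_0 (set_val f) (icay omega w).

Lemma hpE f w (w1 : normc (icay omega w) < 1) : hp omega f w = set_val f (mkD w1).
Proof. by rewrite /hp (valL_mkD _ w1). Qed.

Lemma hp_holo f w : 0 < Re w -> holoC (hp omega f) w.
Proof.
move=> w0; apply: (@holoC_comp _ ('valL_0 (set_val f)) (icay omega)).
  by apply: holoC_icay; apply: Dp1_neq0; exact: ltW.
by apply: holomorphic_holoC; [exact: (set_valP f)|exact: normc_icay_lt1].
Qed.

Lemma hp_cay f (z : unit_disk R) : set_val f z = hp omega f (cay omega (set_val z)).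
Proof.
have z1 := disk_normc z; rewrite /hp cayK ?normc1_neq0 ?disk_neq//.
by rewrite valL_disk.
Qed.

Lemma hp_inj f g : (forall w, 0 < Re w -> hp omega f w = hp omega g w) -> f = g.
Proof.
move=> fg; apply: val_inj; apply/funext => z.
rewrite -[LHS]/(set_val f z) -[RHS]/(set_val g z) !hp_cay fg//.
by apply: Re_cay_gt0 => //; exact: disk_normc.
Qed.

Lemma hp_surj (G : R[i] -> R[i]) : (forall w, 0 < Re w -> holoC G w) ->
  exists f, forall w, 0 < Re w -> hp omega f w = G w.
Proof.
move=> Gh; pose F (z : unit_disk R) := G (cay omega (set_val z)).
have Fh : holomorphic F.
  have [//|_ ] := @holomorphicP R F (fun z => G (cay omega z)); apply=> z z1.
  apply: (@holoC_comp _ G); first by apply: holoC_cay; exact: disk_neq.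
  by apply: Gh; exact: Re_cay_gt0.
exists (exist _ (F : {family compact, unit_disk R -> R[i]}) (mem_set Fh)) => w w0.
rewrite (hpE _ (normc_icay_lt1 o1 w0)) -[LHS]/(F _) /F val_mkD icayK//.
  exact: normc1_neq0.
by apply: Dp1_neq0; exact: ltW.
Qed.

Lemma hp_comp (phi : disk_aut R) (s t : R) f w : 0 < s -> is_aff omega phi s t ->
  0 < Re w -> hp omega (comp_op phi f) w = hp omega f (aff s t w).
Proof.
move=> s0 phiE w0; have w1 := normc_icay_lt1 o1 w0.
rewrite (hpE _ w1) -[LHS]/(set_val f (phi (mkD w1))) hp_cay phiE val_mkD.
have e : cay omega (icay omega w) = w.
  by rewrite icayK//; [exact: normc1_neq0|apply: Dp1_neq0; exact: ltW].
rewrite e icayK//; first exact: normc1_neq0.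
by apply: Dp1_neq0; rewrite /aff/= mulr_ge0// ltW.
Qed.

(** On the closed disk of radius [r], the maximum of [normc (cay omega z)] is [(1 + r) / (1 - r)]
    and the minimum of its real part is the inverse of that number. *)
Lemma cay_rect (r : R) : 0 <= r < 1 -> exists2 m : R, 1 <= m &
  forall z, normc z <= r -> in_rect m^-1 m (- m) m (cay omega z).
Proof.
move=> /andP[r0 r1]; pose m := (1 + r) / (1 - r).
have d0 : 0 < 1 - r by lra.
have m1 : 1 <= m by rewrite ler_pdivlMr//; lra.
exists m => // z zr.
have zo : z != omega by apply: contraTneq zr => ->; rewrite o1 -ltNge.
have n1 : normc (omega - z) <= 1 + r.
  by apply: (le_trans (ler_normcB _ _)); rewrite o1 lerD2l.
have n2 : 1 - r <= normc (omega - z).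
  by apply: le_trans (lerB_normcB _ _); rewrite o1 lerB.
have cm : normc (cay omega z) <= m.
  rewrite /cay normcM normcV /m; apply: ler_pM; rewrite ?invr_ge0 ?normc_ge0//.
    by apply: (le_trans (ler_normcD _ _)); rewrite o1 lerD2l.
  by rewrite lef_pV2 ?posrE//; exact: lt_le_trans n2.
split; last by rewrite -ler_norml; exact: le_trans (ler_Im_normc _) cm.
apply/andP; split; last first.
  by apply: le_trans (ler_norm _) _; exact: le_trans (ler_Re_normc _) cm.
rewrite Re_cay// /m invf_div.
have p : 0 < normc (omega - z) by exact: lt_le_trans n2.
rewrite ler_pdivlMr ?exprn_gt0// mulrAC ler_pdivrMr; last lra.
have sq1 : normc (omega - z) ^+ 2 <= (1 + r) ^+ 2.
  by rewrite ler_pXn2r ?nnegrE ?normc_ge0//; lra.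
have sq2 : normc z ^+ 2 <= r ^+ 2 by rewrite ler_pXn2r ?nnegrE ?normc_ge0.
apply: (@le_trans _ _ ((1 - r) * (1 + r) ^+ 2)); first by rewrite ler_pM2l.
rewrite expr2 mulrA; apply: ler_wpM2r; first lra.
rewrite (_ : _ * (1 + r) = 1 - r ^+ 2); first by rewrite lerB.
by rewrite expr2; ring.
Qed.

Lemma holo_space_nbhsP f A : nbhs f A <-> exists m e : R, [/\ 1 <= m, 0 < e &
  forall g, (forall w, in_rect m^-1 m (- m) m w ->
    normc (hp omega g w - hp omega f w) < e) -> A g].
Proof.
split.
  move=> [_ [[B oB <-] Bf BA]].
  (* [F] is the filter generated by the candidate neighbourhoods of [f]; its convergence to [f]
     uniformly on compact sets says that every neighbourhood contains one of them. *)
  pose F : set_system (unit_disk R -> R[i]) := [set S |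
    exists m e : R, [/\ 1 <= m, 0 < e & forall g : unit_disk R -> R[i],
     (forall z : unit_disk R, in_rect m^-1 m (- m) m (cay omega (set_val z)) ->
       normc (g z - set_val f z) < e) -> S g]].
  have FF : Filter F.
    split.
    - by exists 1, 1; split.
    - move=> P Q [m1 [e1 [m11 e10 H1]]] [m2 [e2 [m21 e20 H2]]].
      exists (Num.max m1 m2), (Num.min e1 e2); split.
      + by rewrite le_max m11.
      + by rewrite lt_min e10.
      have M1 : 0 < Num.max m1 m2 by rewrite lt_max; apply/orP; left; lra.
      have im1 : (Num.max m1 m2)^-1 <= m1^-1.
        by rewrite lef_pV2 ?posrE ?le_max ?lexx//; lra.
      have im2 : (Num.max m1 m2)^-1 <= m2^-1.
        by rewrite lef_pV2 ?posrE ?le_max ?lexx ?orbT//; lra.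
      have lm1 : m1 <= Num.max m1 m2 by rewrite le_max lexx.
      have lm2 : m2 <= Num.max m1 m2 by rewrite le_max lexx orbT.
      move=> g Hg; split; [apply: H1|apply: H2] => z zr.
        have := Hg z; rewrite lt_min => /(_ _)/andP[]//.
        by apply: in_rectS zr; rewrite // lerN2.
      have := Hg z; rewrite lt_min => /(_ _)/andP[]//.
      by apply: in_rectS zr; rewrite // lerN2.
    - move=> P Q PQ [m [e [m1 e0 H]]]; exists m, e; split=> // g /H; exact: PQ.
  have cF : {family compact, F --> (set_val f : unit_disk R -> R[i])}.
    apply/fam_cvgP => K cK P /uniform_nbhs[E [entE EP]].
    have [e e0 He] : exists2 e : R, 0 < e & forall a b : R[i],
        normc (a - b) < e -> E (a, b).
      move: entE; rewrite -entourage_ballE => -[[e1 e2]] /=; rewrite ltcE/= => /andP[/eqP e20 e10] H.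
      exists e1 => // a b ab; apply: H; rewrite /ball/=.
      by rewrite normcE ltcE/= e20 eqxx.
    have [r r01 Kr] := compact_disk_bounded cK.
    have [m m1 Hm] := cay_rect r01.
    exists m, e; split=> // g Hg; apply: EP => z Kz; apply: He.
    by rewrite normcBC; apply: Hg; apply: Hm; exact: Kr.
  have /cF[m [e [m1 e0 H]]] : nbhs (set_val f) B by rewrite nbhsE; exists B.
  exists m, e; split=> // g Hg; apply: BA; apply: H => z zr.
  by rewrite !hp_cay; exact: Hg.
move=> [m [e [m1 e0 H]]].
have ee : entourage [set xy : R[i] * R[i] | normc (xy.1 - xy.2) < e].
  rewrite -entourage_ballE; exists (e%:C)%C; first by rewrite /= ltcR.
  by move=> [a b]; rewrite /ball/= normcE ltcR.
have ff := @fam_nbhs _ _ compact _ _ (set_val f) ee (compact_cay_rect o1 m1).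
have h : nbhs f (set_val @^-1` [set g : {family compact, unit_disk R -> R[i]} |
    forall z : unit_disk R, in_rect m^-1 m (- m) m (cay omega (set_val z)) ->
    normc (set_val f z - g z) < e]).
  exact: (@initial_continuous (holo_space R) _ set_val f _ ff).
apply: filterS h => g Hg; apply: H => w wr.
have w0 : 0 < Re w.
  by case: wr => /andP[h _] _; apply: lt_le_trans h; rewrite invr_gt0; lra.
have w1 := normc_icay_lt1 o1 w0.
have := Hg (mkD w1); rewrite normcBC !(hpE _ w1); apply.
rewrite /= icayK//; first exact: normc1_neq0.
by apply: Dp1_neq0; exact: ltW.
Qed.

End half_plane_coordinates.

(** * Completeness, Baire's theorem and a countable base *)

Section complete_and_separable.
Context {R : realType} {omega : R[i]} (o1 : normc omega = 1).
Implicit Types (z w : R[i]) (f g : holo_space R) (A : set (holo_space R)).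

Lemma hrect_gt0 (m : R) w : 1 <= m -> in_rect m^-1 m (- m) m w -> 0 < Re w.
Proof.
by move=> m1 [/andP[h _] _]; apply: lt_le_trans h; rewrite invr_gt0; lra.
Qed.

Lemma hrectS (m m' : R) w : 1 <= m -> m <= m' -> in_rect m^-1 m (- m) m w ->
  in_rect m'^-1 m' (- m') m' w.
Proof.
move=> m1 mm; apply: in_rectS => //; last by rewrite lerN2.
by rewrite lef_pV2 ?posrE//; lra.
Qed.

Lemma hrect_exists w : 0 < Re w -> exists2 m : R, 1 <= m & in_int m^-1 m (- m) m w.
Proof.
move=> w0; pose m := 1 + (Re w)^-1 + Re w + `|Im w|.
have iw : 0 < (Re w)^-1 by rewrite invr_gt0.
have i0 := normr_ge0 (Im w).
have m1 : 1 <= m by rewrite /m; lra.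
exists m => //; split.
  apply/andP; split; last by rewrite /m; lra.
  by rewrite -(invrK (Re w)) ltf_pV2 ?posrE//; rewrite /m; lra.
by rewrite -ltr_norml /m; lra.
Qed.

Lemma cauchy_nested (u : nat -> R[i]) (e : nat -> R) :
  (forall n j, (n <= j)%N -> normc (u j - u n) <= e n) ->
  (forall d : R, 0 < d -> exists n0, forall n, (n0 <= n)%N -> e n < d) ->
  exists l, forall n, normc (l - u n) <= e n.
Proof.
move=> ue e0.
have pair n j : normc (u j - u n) <= e n + e j.
  have en (k : nat) : 0 <= e k.
    by have := ue k k (leqnn k); rewrite subrr normc0.
  have [h|/ltnW h] := leqP n j.
    by apply: (le_trans (ue _ _ h)); rewrite lerDl.
  by rewrite normcBC; apply: (le_trans (ue _ _ h)); rewrite lerDr.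
have real (v : nat -> R) : (forall n j, `|v j - v n| <= e n + e j) ->
    exists l, forall n, `|l - v n| <= e n.
  (* Any two intervals [[v n - e n, v n + e n]] meet, so the supremum of their left ends lies in all
     of them. *)
  move=> H; pose S := [set v n - e n | n in setT]; exists (sup S) => n.
  have ub (k : nat) : ubound S (v k + e k).
    by move=> _ [j _ <-]; have := H k j; rewrite ler_norml => /andP[? ?]; lra.
  have h1 : v n - e n <= sup S.
    by apply: ub_le_sup; [exists (v n + e n)|exists n].
  have h2 : sup S <= v n + e n.
    by apply: ge_sup; [exists (v n - e n); exists n|exact: ub].
  by rewrite ler_norml; apply/andP; split; lra.
have [a Ha] : exists l, forall n, `|l - Re (u n)| <= e n.
  apply: real => n j; apply: le_trans (pair n j); apply: le_trans (ler_Re_normc _).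
  by rewrite cReD cReN.
have [b Hb] : exists l, forall n, `|l - Im (u n)| <= e n.
  apply: real => n j; apply: le_trans (pair n j); apply: le_trans (ler_Im_normc _).
  by rewrite cImD cImN.
have H2 n : normc ((a +i* b)%C - u n) <= e n + e n.
  apply: (le_trans (normc_le_ReIm _)); rewrite cReD cReN cImD cImN/=.
  exact: lerD.
(* Working by coordinates costs a factor 2; passing through a late term [u k] restores the rate
   [e n]. *)
exists (a +i* b)%C => n; apply/ler_addgt0Pr => d d0.
have [|n0 Hn0] := e0 (d / 2); first lra.
pose k := (n + n0)%N.
have := ue n k (leq_addr _ _); have := H2 k; have := Hn0 k (leq_addl _ _).
have -> : (a +i* b)%C - u n = ((a +i* b)%C - u k) + (u k - u n) by ring.
by have := ler_normcD ((a +i* b)%C - u k) (u k - u n); lra.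
Qed.

Lemma holo_limit (G : R[i] -> R[i]) :
  (forall m e : R, 1 <= m -> 0 < e -> exists f, forall w,
     in_rect m^-1 m (- m) m w -> normc (G w - hp omega f w) <= e) ->
  forall w, 0 < Re w -> holoC G w.
Proof.
move=> H.
have Gc w : 0 < Re w -> contC G w.
  move=> /hrect_exists[m m1 wi] e e0.
  have e3 : 0 < e / 4 by lra.
  have [f Hf] := H m (e / 4) m1 e3.
  have wr := in_int_rect wi.
  have [d1 d10 Hd1] := in_int_open wi.
  have [d2 d20 Hd2] := holoC_cont (hp_holo o1 f (hrect_gt0 m1 wr)) e3.
  exists (Num.min d1 d2); first by rewrite lt_min d10.
  move=> b; rewrite lt_min => /andP[/Hd1/in_int_rect/Hf h1 /Hd2 h2].
  have h3 := Hf _ wr.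
  have -> : G b - G w = (G b - hp omega f b) + (hp omega f b - hp omega f w) -
    (G w - hp omega f w) by ring.
  have := ler_normcB (G b - hp omega f b + (hp omega f b - hp omega f w))
    (G w - hp omega f w).
  by have := ler_normcD (G b - hp omega f b) (hp omega f b - hp omega f w); lra.
move=> w /hrect_exists[m m1 wi]; apply: (weierstrass wi) => [e e0|z zr].
  have [f Hf] := H m e m1 e0; exists (hp omega f) => // z zr.
  by apply: hp_holo => //; exact: hrect_gt0 m1 zr.
by apply: Gc; exact: hrect_gt0 m1 zr.
Qed.

Definition hball f (m e : R) : set (holo_space R) := [set g | forall w,
  in_rect m^-1 m (- m) m w -> normc (hp omega g w - hp omega f w) < e].

Definition hcball f (m e : R) : set (holo_space R) := [set g | forall w,
  in_rect m^-1 m (- m) m w -> normc (hp omega g w - hp omega f w) <= e].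

Lemma nbhs_hball f (m e : R) : 1 <= m -> 0 < e -> nbhs f (hball f m e).
Proof. by move=> m1 e0; apply/(holo_space_nbhsP o1); exists m, e. Qed.

(** Nested closed balls as in a complete metric space, where each ball carries its own rectangle and
    radius: a state is a centre with a pair (size of the rectangle, radius). The limit of the
    centres is holomorphic by Weierstrass' theorem. *)
Lemma holo_space_baire (O : nat -> set (holo_space R)) :
  (forall n, open (O n)) -> (forall n, dense (O n)) -> dense (\bigcap_n O n).
Proof.
move=> Oo Od U [f0 Uf0] Uo.
pose T := (holo_space R * (R * R))%type.
pose ok (x : T) := 1 <= x.2.1 /\ 0 < x.2.2.
(* [n%:R <= y.2.1] makes the rectangles exhaust the half-plane; the bound on the radius makes the
   centres Cauchy on each of them. *)
pose next (n : nat) (x y : T) := [/\ ok y, x.2.1 <= y.2.1, n%:R <= y.2.1,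
  y.2.2 <= n.+1%:R^-1 & hcball y.1 y.2.1 y.2.2 `<=`
    O n `&` hcball x.1 x.2.1 x.2.2].
have step n x : ok x -> exists y, next n x y.
  case: x => f [m e] [/= m1 e0].
  have /nbhs_interior := nbhs_hball f m1 e0.
  move=> /nbhs_singleton fI.
  have [g [gI gO]] := Od n _ (ex_intro _ f fI) (@open_interior _ (hball f m e)).
  have /(holo_space_nbhsP o1)[m2 [e2 [m21 e20 H2]]] :
      nbhs g (O n `&` hball f m e).
    apply: filterI; first by apply: open_nbhs_nbhs.
    by move: gI; rewrite /interior.
  pose m' := Num.max (Num.max m m2) n%:R; pose e' := Num.min (e2 / 2) n.+1%:R^-1.
  exists (g, (m', e')); split.
  - split; first by rewrite /= !le_max m1.
    by rewrite /= lt_min divr_gt0//= invr_gt0.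
  - by rewrite /= !le_max lexx.
  - by rewrite /= le_max lexx orbT.
  - by rewrite /= ge_min lexx orbT.
  move=> h hc; have /H2[hO hB] : hball g m2 e2 h.
    move=> w /(@hrectS _ m') wr; apply: (@le_lt_trans _ _ e').
      by apply: hc; apply: wr; rewrite // !le_max lexx orbT.
    by rewrite gt_min; apply/orP; left; lra.
  by split=> // w wr; apply/ltW/hB.
have /(holo_space_nbhsP o1)[m0 [e0 [m01 e00 H0]]] : nbhs f0 U.
  by apply: open_nbhs_nbhs.
have /boolp.choice[s sP] : forall p : nat * T, exists y, ok p.2 -> next p.1 p.2 y.
  move=> [n x]; have [/(step n)[y ?]|?] := pselect (ok x); first by exists y.
  by exists x.
pose x := fix x n := if n is k.+1 then s (k, x k) else (f0, (m0, e0 / 2)).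
have xok n : ok (x n).
  by elim: n => [|n /(sP (n, x n))[]]//; split=> //=; lra.
have xnext n : next n (x n) (x n.+1) := sP (n, x n) (xok n).
have mle n k : (x n).2.1 <= (x (n + k)%N).2.1.
  elim: k => [|k IH]; first by rewrite addn0.
  by rewrite addnS; have [_ h _ _ _] := xnext (n + k)%N; exact: le_trans h.
have nested n k : hcball (x (n + k)%N).1 (x (n + k)%N).2.1 (x (n + k)%N).2.2 `<=`
    hcball (x n).1 (x n).2.1 (x n).2.2.
  elim: k => [|k IH]; first by rewrite addn0.
  rewrite addnS; have [_ _ _ _ h] := xnext (n + k)%N.
  by move=> g /h[_ /IH].
have self n k : hcball (x n).1 (x n).2.1 (x n).2.2 (x (n + k)%N).1.
  apply: (nested n k) => w _; rewrite subrr normc0.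
  by have [_ /ltW] := xok (n + k)%N.
have esmall (d : R) : 0 < d -> exists n0, forall n, (n0 <= n)%N -> (x n).2.2 < d.
  move=> d0; exists (Num.truncn d^-1).+2 => -[//|n] nn.
  have [_ _ _ h _] := xnext n; apply: (le_lt_trans h).
  rewrite -(invrK d) ltf_pV2 ?posrE ?invr_gt0//.
  apply: (lt_le_trans (truncnS_gt _)); by rewrite ler_nat ltnW.
have /boolp.choice[G HG] : forall w, exists l, forall n,
    in_rect (x n).2.1^-1 (x n).2.1 (- (x n).2.1) (x n).2.1 w ->
    normc (l - hp omega (x n).1 w) <= (x n).2.2.
  (* The limit is constrained only at points of some rectangle, that is on the half-plane; elsewhere
     0 is a default value. *)
  move=> w; have [[N Nw]|NN] := pselect (exists n,
    in_rect (x n).2.1^-1 (x n).2.1 (- (x n).2.1) (x n).2.1 w); last first.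
    by exists 0 => n h; case: NN; exists n.
  have up k : in_rect (x (N + k)%N).2.1^-1 (x (N + k)%N).2.1
      (- (x (N + k)%N).2.1) (x (N + k)%N).2.1 w.
    by apply: hrectS Nw => //; case: (xok N).
  have [|d d0|l Hl] := @cauchy_nested (fun k => hp omega (x (N + k)%N).1 w)
    (fun k => (x (N + k)%N).2.2).
  - move=> n j nj; have := self (N + n)%N (j - n)%N w (up n).
    by rewrite -addnA subnKC.
  - have [n0 Hn0] := esmall d d0; exists n0 => n nn; apply: Hn0.
    by rewrite (leq_trans nn)// leq_addl.
  exists l => n nw; apply/ler_addgt0Pr => d d0.
  have [|n0 Hn0] := esmall d; first lra.
  pose k := (n + n0)%N.
  have := self n (N + n0)%N w nw; have := Hl k.
  have := Hn0 (N + k)%N _; rewrite /k => /(_ _)/ltW.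
  have -> : (n0 <= N + (n + n0))%N by rewrite addnA leq_addl.
  move=> /(_ isT); rewrite (addnCA N) => h1 h2 h3.
  rewrite -(subrK (hp omega (x (n + (N + n0))%N).1 w) l) -addrA.
  by apply: (le_trans (ler_normcD _ _)); lra.
have Gh : forall w, 0 < Re w -> holoC G w.
  apply: holo_limit => m e m1 e0'; have [n0 Hn0] := esmall e e0'.
  pose n := (n0 + (Num.truncn m).+1)%N.
  exists (x n.+1).1 => w wr; apply: (@le_trans _ _ (x n.+1).2.2); last first.
    by apply/ltW/Hn0; rewrite /n ltnW// ltnS leq_addr.
  apply: HG; apply: hrectS wr => //; have [_ _ h _ _] := xnext n.
  apply: le_trans h; apply/ltW; apply: (lt_le_trans (truncnS_gt m)).
  by rewrite ler_nat leq_addl.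
have [g gG] := hp_surj o1 Gh.
have gin n : hcball (x n).1 (x n).2.1 (x n).2.2 g.
  move=> w wr; rewrite gG; first exact: HG.
  by apply: hrect_gt0 wr; case: (xok n).
exists g; split.
  apply: H0 => w wr; apply: le_lt_trans (gin 0%N w wr) _ => /=; lra.
move=> n _; have [_ _ _ _ h] := xnext n.
by have [] := h _ (gin n.+1).
Qed.

Definition ratC (K : nat) (a : int * int) : R[i] :=
  (a.1%:~R / K.+1%:R +i* (a.2%:~R / K.+1%:R))%C.

Lemma ratC_approx (K : nat) z : exists a, normc (z - ratC K a) < 2 / K.+1%:R.
Proof.
have k0 : 0 < K.+1%:R :> R by rewrite ltr0n.
have ap (y : R) : exists i : int, `|y - i%:~R / K.+1%:R| < K.+1%:R^-1.
  exists (Num.floor (y * K.+1%:R)).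
  have /andP[h1 h2] := floor_itv (y * K.+1%:R).
  rewrite intrD in h2.
  rewrite ltr_norml; apply/andP; split; rewrite -(ltr_pM2r k0).
    by rewrite mulNr mulVf ?gt_eqF// mulrBl divfK ?gt_eqF//; lra.
  by rewrite mulVf ?gt_eqF// mulrBl divfK ?gt_eqF//; lra.
have [i Hi] := ap (Re z); have [j Hj] := ap (Im z).
exists (i, j); apply: (le_lt_trans (normc_le_ReIm _)).
rewrite cReD cReN cImD cImN; apply: lt_le_trans (ltrD Hi Hj) _.
by rewrite mulr_natl mulr2n.
Qed.

Lemma holo_space_countable_base : exists V : nat -> set (holo_space R),
  (forall i, open (V i)) /\
  forall O f, open O -> O f -> exists2 i, V i f & V i `<=` O.
Proof.
pose code := (nat * nat * seq (nat * ((int * int) * (int * int))))%type.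
(* A code [(M, N, v)] prescribes values up to [1 / (N + 1)] on the rectangle of size [M + 1]: an
   entry [(K, (p, q))] of [v] asks that points within [4 / (K + 1)] of the grid point [p] have
   values near the grid point [q]. *)
pose W (c : code) : set (holo_space R) := [set g | forall x, x \in c.2 ->
  forall w, in_rect c.1.1.+1%:R^-1 c.1.1.+1%:R (- c.1.1.+1%:R) c.1.1.+1%:R w ->
  normc (w - ratC x.1 x.2.1) < 4 / x.1.+1%:R ->
  normc (hp omega g w - ratC x.1 x.2.2) < c.1.2.+1%:R^-1].
exists (fun i => if @unpickle code i is Some c then (W c)° else set0); split.
  by move=> i; case: unpickle => [c|]; [exact: open_interior|exact: open0].
move=> O f oO Of.
have /(holo_space_nbhsP o1)[m [e [m1 e0 H]]] : nbhs f O by apply: open_nbhs_nbhs.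
pose M := Num.truncn m; pose N := Num.truncn (2 / e).
have mM : m <= M.+1%:R by apply/ltW/truncnS_gt.
have M1 : 1 <= M.+1%:R :> R by exact: le_trans mM.
have N0 : 0 < N.+1%:R :> R by rewrite ltr0n.
have Ne : 2 / N.+1%:R < e.
  rewrite ltr_pdivrMr// mulrC -ltr_pdivrMr//; exact: truncnS_gt.
pose r : R := M.+1%:R; rewrite -/r in mM M1; pose t : R := N.+1%:R^-1.
have t0 : 0 < t by rewrite invr_gt0.
have [v [Hv1 Hv2]] : exists v : seq (nat * ((int * int) * (int * int))),
    (forall x, x \in v -> forall w, in_rect r^-1 r (- r) r w ->
      normc (w - ratC x.1 x.2.1) < 4 / x.1.+1%:R ->
      normc (hp omega f w - ratC x.1 x.2.2) <= t / 2) /\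
    (forall w, in_rect r^-1 r (- r) r w -> exists2 x, x \in v &
      normc (w - ratC x.1 x.2.1) < 4 / x.1.+1%:R).
  apply: (@rect_bisect _ (fun a b c d =>
    exists v : seq (nat * ((int * int) * (int * int))),
    (forall x, x \in v -> forall w, in_rect r^-1 r (- r) r w ->
      normc (w - ratC x.1 x.2.1) < 4 / x.1.+1%:R ->
      normc (hp omega f w - ratC x.1 x.2.2) <= t / 2) /\
    (forall w, in_rect a b c d w -> exists2 x, x \in v &
      normc (w - ratC x.1 x.2.1) < 4 / x.1.+1%:R))).
  - by apply: (@le_trans _ _ 1) => //; rewrite invf_le1//; lra.
  - lra.
  - move=> a b c d _ _ _ _ _ _ [v1 [h1 g1]] [v2 [h2 g2]] [v3 [h3 g3]] [v4 [h4 g4]].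
    exists (v1 ++ v2 ++ v3 ++ v4); split.
      by move=> x; rewrite !mem_cat => /or4P[/h1|/h2|/h3|/h4].
    move=> w [/andP[za zb] /andP[zc zd]].
    have [h|h] := leP (Re w) ((a + b) / 2); have [h'|h'] := leP (Im w) ((c + d) / 2).
    + have [|x xv hx] := g1 w; first by split; apply/andP; split=> //; exact: ltW.
      by exists x; rewrite // !mem_cat xv.
    + have [|x xv hx] := g3 w; first by split; apply/andP; split=> //; exact: ltW.
      by exists x; rewrite // !mem_cat xv !orbT.
    + have [|x xv hx] := g2 w; first by split; apply/andP; split=> //; exact: ltW.
      by exists x; rewrite // !mem_cat xv !orbT.
    + have [|x xv hx] := g4 w; first by split; apply/andP; split=> //; exact: ltW.
      by exists x; rewrite // !mem_cat xv !orbT.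
  - move=> u v ur vr; pose w0 := (u +i* v)%C.
    have wr : in_rect r^-1 r (- r) r w0 by split.
    have t4 : 0 < t / 4 by lra.
    have [d d0 Hd] := holoC_cont (hp_holo o1 f (hrect_gt0 M1 wr)) t4.
    pose D := Num.min d t; have D0 : 0 < D by rewrite lt_min d0.
    (* With [k = 1 / (K + 1)], grid points are within [2 k] of [w0] and of its value. Then [6 k < d]
       keeps the disk of radius [4 k] about [p] within [d] of [w0], [t / 4 + 2 k < t / 2] bounds the
       values there, and that disk contains every rectangle through [w0] with sides below [k]. *)
    pose K := Num.truncn (8 / D).
    have K0 : 0 < K.+1%:R :> R by rewrite ltr0n.
    have KD : 8 / K.+1%:R < D.
      rewrite ltr_pdivrMr// mulrC -ltr_pdivrMr//; exact: truncnS_gt.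
    have [Dd Dt] : D <= d /\ D <= t by split; rewrite ge_min lexx ?orbT.
    have iK : 0 < K.+1%:R^-1 :> R by rewrite invr_gt0.
    have [p Hp] := ratC_approx K w0; have [q Hq] := ratC_approx K (hp omega f w0).
    pose k : R := K.+1%:R^-1; rewrite -/k in KD iK Hp Hq.
    exists k => // a b c d' _ _ _ _ ua vc ab cd.
    exists [:: (K, (p, q))]; split.
      move=> x; rewrite inE => /eqP -> /= w _; rewrite -/k => wp.
      have /Hd h : normc (w - w0) < d.
        have -> : w - w0 = (w - ratC K p) - (w0 - ratC K p) by ring.
        by apply: (le_lt_trans (ler_normcB _ _)); lra.
      have -> : hp omega f w - ratC K q = (hp omega f w - hp omega f w0) +
        (hp omega f w0 - ratC K q) by ring.
      by apply: (le_trans (ler_normcD _ _)); lra.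
    move=> w wr'; exists (K, (p, q)); first by rewrite inE.
    have w0r : in_rect a b c d' w0 by split.
    have := normc_in_rect wr' w0r => h /=; rewrite -/k.
    have -> : w - ratC K p = (w - w0) + (w0 - ratC K p) by ring.
    by apply: (le_lt_trans (ler_normcD _ _)); lra.
pose c : code := (M, N, v).
exists (pickle c); rewrite pickleK.
  (* By [Hv1] the function [f] meets the conditions with a margin [t / 2], hence so do its
     neighbours with tolerance [t]. *)
  suff : nbhs f (W c) by [].
  apply/(holo_space_nbhsP o1).
  exists r, (t / 2); split=> //; first lra.
  move=> g Hg x xv w wr wp.
  have := Hv1 x xv w wr wp; have := Hg w wr.
  have -> : hp omega g w - ratC x.1 x.2.2 = (hp omega g w - hp omega f w) +
    (hp omega f w - ratC x.1 x.2.2) by ring.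
  by move=> h1 h2; apply: (le_lt_trans (ler_normcD _ _)); rewrite -/t; lra.
move=> g /interior_subset gW; apply: H => w wr.
have {}wr : in_rect r^-1 r (- r) r w by apply: hrectS wr.
have [x xv wx] := Hv2 _ wr.
have := Hv1 x xv w wr wx; have := gW x xv w wr wx; rewrite -/t => h1 h2.
have -> : hp omega g w - hp omega f w = (hp omega g w - ratC x.1 x.2.2) -
  (hp omega f w - ratC x.1 x.2.2) by ring.
by apply: (le_lt_trans (ler_normcB _ _)); apply: lt_trans Ne; rewrite -/t; lra.
Qed.

End complete_and_separable.

(** * Harmonic sweeps of the parameters at separated times *)

Section covering.
Context {R : realType}.

(** Comparison with the telescoping differences [2 / d - 2 / (d + 1)], each side of [j] contributing
    at most [2 * C]. What matters is that the bound does not depend on [N]. *)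
Lemma sum_inv_sqr_le (F : nat -> R) (C : R) (j N : nat) : 0 <= C ->
  (forall k, k != j -> F k <= C / (k%:R - j%:R) ^+ 2) ->
  \sum_(0 <= k < N | k != j) F k <= 4 * C.
Proof.
move=> C0 FC.
have tel (d : R) : 0 < d -> C / d ^+ 2 <= C * (2 / d) - C * (2 / (d + 1)) \/ d < 1.
  move=> d0; have [d1|d1] := leP 1 d; [left|by right].
  have -> : C * (2 / d) - C * (2 / (d + 1)) = C * (2 / (d * (d + 1))).
    by field; rewrite !gt_eqF//; lra.
  rewrite ler_wpM2l// -[d ^- 2]mul1r ler_pdivrMr ?exprn_gt0//.
  rewrite mulrAC ler_pdivlMr; last by rewrite mulr_gt0//; lra.
  by rewrite expr2; nra.
have H : \sum_(0 <= k < N | k != j) F k <=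
    if (N <= j)%N then C * (2 / (j%:R - N%:R + 1)) else C * 4 - C * (2 / (N%:R - j%:R)).
  elim: N => [|N IH].
    by rewrite big_geq//= mulr_ge0// divr_ge0.
  rewrite big_mkcond big_nat_recr//= -big_mkcond/=.
  have [Nj|jN|Nj] := ltngtP N j.
  - rewrite (ltnW Nj) in IH; have h := FC N; rewrite neq_ltn Nj/= in h.
    have {}h := h isT.
    have d1 : 1 <= j%:R - N%:R :> R by have : N.+1%:R <= j%:R :> R; [rewrite ler_nat|rewrite -[N.+1%:R]natr1; lra].
    have [|t|t] := tel (j%:R - N%:R); [lra| |lra].
    rewrite -[N.+1%:R]natr1 (_ : j%:R - (N%:R + 1) + 1 = j%:R - N%:R :> R); last by ring.
    rewrite -(sqrrN (N%:R - j%:R)) opprB in h.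
    by apply: le_trans (lerD IH (le_trans h t)) _; rewrite addrC subrK.
  - rewrite leqNgt jN/= in IH.
    have h := FC N; rewrite neq_ltn jN orbT/= in h; have {}h := h isT.
    have d1 : 1 <= N%:R - j%:R :> R by have : j.+1%:R <= N%:R :> R; [rewrite ler_nat|rewrite -[j.+1%:R]natr1; lra].
    have [|t|t] := tel (N%:R - j%:R); [lra| |lra].
    rewrite -[N.+1%:R]natr1 (_ : N%:R + 1 - j%:R = N%:R - j%:R + 1 :> R); last by ring.
    by apply: le_trans (lerD IH (le_trans h t)) _; rewrite addrA subrK.
  - rewrite Nj leqnn subrr add0r divr1 in IH.
    rewrite Nj -[j.+1%:R]natr1 (_ : j%:R + 1 - j%:R = 1 :> R); last by ring.
    by rewrite divr1 /= addr0; apply: (le_trans IH); lra.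
apply: (le_trans H); case: (leqP N j) => h.
  rewrite mulrC ler_wpM2r// ler_pdivrMr; last first.
    by rewrite ltr_wpDl// subr_ge0 ler_nat.
  have : 0 <= j%:R - N%:R :> R by rewrite subr_ge0 ler_nat.
  lra.
rewrite (mulrC 4) gerBl mulr_ge0// divr_ge0// subr_ge0 ler_nat ltnW//.
Qed.

(** Each doubling of the number of terms adds at least [M / (2 M) = 1 / 2]. *)
Lemma harmonic_unbounded (K : R) : exists M : nat, K <= \sum_(0 <= k < M) k.+1%:R^-1.
Proof.
have H (p : nat) : exists2 M : nat, (0 < M)%N &
    p%:R / 2 <= \sum_(0 <= k < M) (k.+1%:R^-1 : R).
  elim: p => [|p [M M0 IH]].
    by exists 1%N => //; rewrite mul0r sumr_ge0// => i _; rewrite invr_ge0.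
  exists (M + M)%N; first by rewrite addn_gt0 M0.
  rewrite (@big_cat_nat _ _ _ M)//= ?leq_addr//.
  have : M%:R * (2 * M%:R)^-1 <= \sum_(M <= k < M + M) (k.+1%:R^-1 : R).
    rewrite mulr_natl -[X in _ *+ X](addnK M M) -sumr_const_nat.
    rewrite big_nat_cond [leRHS]big_nat_cond; apply: ler_sum => i /andP[/andP[_ i2] _].
    rewrite lef_pV2 ?posrE ?ltr0n// ?mulr_gt0 ?ltr0n//.
    by rewrite mulr_natl mulr2n -natrD ler_nat.
  rewrite invfM mulrCA divff ?mulr1; last by rewrite pnatr_eq0 -lt0n.
  rewrite -[p.+1%:R]natr1; lra.
have [M _ HM] := H (Num.truncn (2 * K)).+1; exists M; apply: le_trans HM.
rewrite ler_pdivlMr// mulrC; exact/ltW/truncnS_gt.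
Qed.

(** An entry [(n, (l, c))] stands for the [n]-th iterate at the parameter [(l, c)]; its key is the
    time this iterate reaches in the one-parameter group. *)
Definition key (x : nat * (R * R)) : R := x.1%:R * x.2.1.

(* The parameter moves by [e / n] at the [n]-th iterate; since the harmonic
   series diverges finitely many such steps sweep [[a, b]]. *)
Lemma covering1 (a b e D S c : R) : 0 < a -> 0 < e -> exists L : seq (nat * (R * R)),
  [/\ path (fun x y => x + D <= y) S (map key L),
    forall x, x \in L -> [/\ (0 < x.1)%N, a <= x.2.1 & x.2.2 = c] &
    forall l, a <= l <= b -> exists2 x, x \in L & 0 <= x.1%:R * (l - x.2.1) <= e].
Proof.
(* As [N * a >= |S| + |D|], the numbers of iterations [N], [2 N], [3 N], ... at nondecreasing
   parameters above [a] are reached at times at least [D] apart, the first one beyond [S + D]. *)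
move=> a0 e0; pose N := (Num.truncn ((`|S| + `|D|) / a)).+1.
have Na : `|S| + `|D| <= N%:R * a.
  by rewrite -ler_pdivrMr//; apply/ltW/truncnS_gt.
have N0 : 0 < N%:R :> R by rewrite ltr0n.
clearbody N.
(* The step after [l k] is [e / (N * (k + 1))], so that the iterate [N * (k + 1)] moves by [e] in
   time before the next entry takes over. *)
pose l k := a + e / N%:R * \sum_(0 <= i < k) (i.+1%:R^-1 : R).
have lS k : l k.+1 = l k + e / N%:R / k.+1%:R.
  by rewrite /l big_nat_recr//=; ring.
have la k : a <= l k.
  rewrite /l lerDl; apply: mulr_ge0; first by rewrite divr_ge0// ltW.
  by apply: sumr_ge0 => i _; rewrite invr_ge0.
have [M HM] := harmonic_unbounded ((b - a) * N%:R / e).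
pose x k : nat * (R * R) := ((N * k.+1)%N, (l k, c)).
have xgap k : key (x k) + D <= key (x k.+1).
  rewrite /key/= lS !natrM -[k.+2%:R]natr1.
  have k0 : 0 < k.+1%:R :> R by rewrite ltr0n.
  have : 0 <= N%:R * (k.+1%:R + 1) * (e / N%:R / k.+1%:R).
    by rewrite !mulr_ge0 ?invr_ge0 ?ltW//; lra.
  have : N%:R * a <= N%:R * l k by rewrite ler_pM2l.
  move: (e / N%:R / k.+1%:R) (l k) => q lk.
  have := ler_norm D; have := normr_ge0 S; lra.
exists [seq x k | k <- iota 0 M.+1]; split.
- have x0 : S + D <= key (x 0%N).
    rewrite /key/= muln1; have : N%:R * a <= N%:R * l 0%N by rewrite ler_pM2l.
    have := ler_norm D; have := ler_norm S; lra.
  have Hp i : path (fun y z => y + D <= z) (key (x i)) (map key [seq x k | k <- iota i.+1 M]).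
    by elim: (M) i => [//|m IH] i /=; rewrite xgap IH.
  by rewrite /= x0 Hp.
- by move=> y /mapP[k _ ->] /=; rewrite muln_gt0 -(ltr0n R) N0.
- move=> u /andP[au ub].
  have uM : u <= l M.
    apply: (le_trans ub); rewrite /l -lerBlDl; move: HM.
    move: (\sum_(0 <= k < M) _) => q.
    by rewrite ler_pdivrMr// (mulrAC e) ler_pdivlMr// (mulrC e).
  have [k kM /andP[lk kl]] : exists2 k, (k < M.+1)%N & l k <= u <= l k.+1.
    have l0 : l 0%N <= u by rewrite /l big_geq// mulr0 addr0.
    have {uM} : u <= l M.+1.
      apply: (le_trans uM); rewrite lS lerDl.
      by rewrite mulr_ge0// ?divr_ge0 ?invr_ge0 ?ltW.
    elim: (M) => [|m IH] um; first by exists 0%N; rewrite // l0 um.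
    have [/IH[k km ku]|h] := leP u (l m.+1); first by exists k; rewrite // ltnW.
    by exists m.+1; rewrite // (ltW h) um.
  exists (x k); first by apply: map_f; rewrite mem_iota.
  rewrite lS -lerBlDl in kl.
  have k0 : 0 < k.+1%:R :> R by rewrite ltr0n.
  rewrite /= mulr_ge0//= ?subr_ge0// natrM.
  rewrite -[X in _ <= X](_ : N%:R * k.+1%:R * (e / N%:R / k.+1%:R) = e).
    by rewrite ler_pM2l// mulr_gt0.
  by field; rewrite !gt_eqF.
Qed.
End covering.

(** * Approximation by sums of peaked translates *)

Section approximation.
Context {R : realType} {omega : R[i]} (o1 : normc omega = 1).
Implicit Types (z w : R[i]) (f g : holo_space R).

(** One sweep of [[a, b]] for each [c] in the net, each starting after the last time of the previous
    one; hence the free starting time [S] in [covering1]. *)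
Lemma covering_net (a b e D S : R) (cs : seq R) : 0 < a -> 0 < e ->
  exists L : seq (nat * (R * R)),
  [/\ path (fun x y => x + D <= y) S (map key L),
    forall x, x \in L -> [/\ (0 < x.1)%N, a <= x.2.1 & x.2.2 \in cs] &
    forall l c, a <= l <= b -> c \in cs -> exists x,
      [/\ x \in L, x.2.2 = c & 0 <= x.1%:R * (l - x.2.1) <= e]].
Proof.
move=> a0 e0; elim: cs S => [|c cs IH] S; first by exists [::].
have [L1 [p1 h1 c1]] := covering1 b D S c a0 e0.
have [L2 [p2 h2 c2]] := IH (last S (map key L1)).
exists (L1 ++ L2); split.
- by rewrite map_cat cat_path p1.
- move=> x; rewrite mem_cat => /orP[/h1[? ? ->]|/h2[? ? ?]]; split=> //.
    by rewrite inE eqxx.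
  by rewrite inE; apply/orP; right.
- move=> l c' lab; rewrite inE => /predU1P[->|c's].
    have [x xL hx] := c1 _ lab; exists x; split=> //; first by rewrite mem_cat xL.
    by case: (h1 _ xL).
  have [x [xL xc hx]] := c2 _ _ lab c's; exists x; split=> //.
  by rewrite mem_cat xL orbT.
Qed.

Lemma path_gap (D S : R) (s : seq R) : path (fun x y => x + D <= y) S s ->
  forall i k, (i + k <= size s)%N ->
  nth 0 (S :: s) i + k%:R * D <= nth 0 (S :: s) (i + k).
Proof.
move=> /(pathP 0) H i; elim=> [|k IH] h; first by rewrite addn0 mul0r addr0.
rewrite addnS in h *; have := IH (ltnW h); have := H _ h.
rewrite -natr1 mulrDl mul1r /=; lra.
Qed.

Lemma normc_sum (I : Type) (r : seq I) (P : pred I) (F : I -> R[i]) :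
  normc (\sum_(i <- r | P i) F i) <= \sum_(i <- r | P i) normc (F i).
Proof.
elim/big_ind2: _ => [|x1 y1 x2 y2 h1 h2|i _ //]; first by rewrite normc0.
by apply: (le_trans (ler_normcD _ _)); exact: lerD.
Qed.

Lemma holoC_sum (I : Type) (r : seq I) (F : I -> R[i] -> R[i]) w :
  (forall i, holoC (F i) w) -> holoC (fun z => \sum_(i <- r) F i z) w.
Proof.
move=> H; elim: r => [|i r IH].
  rewrite (_ : (fun z => _) = fun=> 0); first exact: holoC_cst.
  by apply/funext => z; rewrite big_nil.
rewrite (_ : (fun z => _) = fun z => F i z + \sum_(j <- r) F j z).
  exact: holoCD.
by apply/funext => z; rewrite big_cons.
Qed.

Definition inv_aff (s t : R) w : R[i] := aff s^-1 (- t / s) w.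

Lemma inv_affK (s t : R) w : s != 0 -> inv_aff s t (aff s t w) = w.
Proof.
by move=> s0; apply: complex_eqP; rewrite /inv_aff /aff/=; field.
Qed.

(** At the place of the [j]-th copy, its own term is [h j * p j], off by at most [B * e]. The gaps
    give [|kap j - kap k| >= D * |j - k|], so all other terms together stay below
    [4 * B * C / D ^+ 2 <= B * e], whatever [N] is. *)
Lemma approx_sum (N : nat) (s t kap : nat -> R) (p h : nat -> R[i] -> R[i])
    (B C D e M : R) :
  0 < B -> 0 <= C -> 0 < D -> 1 <= M -> 4 * (C / D ^+ 2) <= e ->
  (forall k, 0 < s k) ->
  (forall k w, 0 < Re w -> holoC (h k) w /\ normc (h k w) <= B) ->
  (forall k w, 0 < Re w -> holoC (p k) w) ->
  (forall k w, in_rect M^-1 M (- M) M w -> normc (p k w - 1) <= e) ->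
  (forall j k w, (j < N)%N -> (k < N)%N -> kap j != kap k ->
    in_rect M^-1 M (- M) M w ->
    normc (p k (inv_aff (s k) (t k) (aff (s j) (t j) w))) <= C / (kap j - kap k) ^+ 2) ->
  (forall i k, (i + k < N)%N -> kap i + k%:R * D <= kap (i + k)%N) ->
  exists f, forall j w, (j < N)%N -> in_rect M^-1 M (- M) M w ->
    normc (hp omega f (aff (s j) (t j) w) - h j w) <= 2 * B * e.
Proof.
move=> B0 C0 D0 M1 CDe s0 hB ph p1 pC gap.
pose v k w := inv_aff (s k) (t k) w.
have v0 k w : 0 < Re w -> 0 < Re (v k w) by move=> w0; rewrite /= mulr_gt0// invr_gt0.
pose F k w := h k (v k w) * p k (v k w).
have Fh w : 0 < Re w -> holoC (fun w => \sum_(k <- iota 0 N) F k w) w.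
  move=> w0; apply: holoC_sum => k; apply: holoCM.
    apply: (@holoC_comp _ (h k)); first exact: holoC_aff.
    by case: (hB k (v k w) (v0 _ _ w0)).
  by apply: (@holoC_comp _ (p k)); [exact: holoC_aff|exact: ph (v0 _ _ w0)].
have [f Hf] := hp_surj o1 Fh.
exists f => j w jN wr; have w0 := hrect_gt0 M1 wr.
have a0 : 0 < Re (aff (s j) (t j) w) by rewrite /= mulr_gt0.
rewrite Hf// (bigD1_seq j) ?iota_uniq ?mem_iota//=.
rewrite {1}/F /v inv_affK ?gt_eqF//.
have -> : h j w * p j w + \sum_(k <- iota 0 N | k != j) F k (aff (s j) (t j) w) - h j w =
  h j w * (p j w - 1) + \sum_(k <- iota 0 N | k != j) F k (aff (s j) (t j) w) by ring.
apply: (le_trans (ler_normcD _ _)).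
have -> : 2 * B * e = B * e + B * e by ring.
apply: lerD.
  rewrite normcM; apply: ler_pM; rewrite ?normc_ge0//; last exact: p1.
  by case: (hB j w w0).
apply: (le_trans (normc_sum _ _ _)).
(* [sum_inv_sqr_le] asks for a bound at every index, while the decay is known below [N] only; the
   terms beyond are set to 0. *)
pose G k := if (k < N)%N then normc (F k (aff (s j) (t j) w)) else 0.
rewrite (_ : \sum_(k <- _ | _) _ = \sum_(0 <= k < N | k != j) G k); last first.
  rewrite /index_iota subn0 big_seq_cond [RHS]big_seq_cond.
  by apply: eq_bigr => k; rewrite mem_iota/= add0n /G => /andP[-> _].
apply: (@le_trans _ _ (4 * (B * (C / D ^+ 2)))); last first.
  by rewrite mulrCA ler_pM2l.
have BC0 : 0 <= B * (C / D ^+ 2) := mulr_ge0 (ltW B0) (divr_ge0 C0 (sqr_ge0 D)).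
apply: sum_inv_sqr_le => [//|k kj].
have kj0 : 0 < (k%:R - j%:R : R) ^+ 2.
  by rewrite lt0r sqr_ge0 andbT sqrf_eq0 subr_eq0 eqr_nat.
rewrite /G; case: ifP => kN; last first.
  by apply: divr_ge0 => //; exact: ltW.
rewrite normcM -mulrA; apply: ler_pM; rewrite ?normc_ge0//.
  by case: (hB k _ (v0 k _ a0)).
have gsq : (D * (k%:R - j%:R)) ^+ 2 <= (kap j - kap k) ^+ 2.
  have [jk|kj'|e'] := ltngtP j k; last by rewrite e' eqxx in kj.
    have := gap j (k - j)%N; rewrite subnKC ?(ltnW jk)// natrB ?(ltnW jk)// => /(_ kN).
    have : j%:R <= k%:R :> R by rewrite ler_nat ltnW.
    move=> h1 h2; rewrite -(sqrrN (kap j - kap k)) opprB.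
    have h3 : 0 <= D * (k%:R - j%:R) by apply: mulr_ge0; [exact: ltW|rewrite subr_ge0].
    by rewrite ler_pXn2r ?nnegrE//; lra.
  have := gap k (j - k)%N; rewrite subnKC ?(ltnW kj')// natrB ?(ltnW kj')// => /(_ jN).
  have : k%:R <= j%:R :> R by rewrite ler_nat ltnW.
  move=> h1 h2; rewrite -(sqrrN (D * _)) -mulrN opprB.
  have h3 : 0 <= D * (j%:R - k%:R) by apply: mulr_ge0; [exact: ltW|rewrite subr_ge0].
  by rewrite ler_pXn2r ?nnegrE//; lra.
have g0 : 0 < (D * (k%:R - j%:R)) ^+ 2 by rewrite exprMn mulr_gt0// exprn_gt0.
have kk : kap j != kap k.
  apply: contraTneq gsq => ->; rewrite subrr expr0n/= -ltNge//.
apply: (le_trans (pC _ _ _ jN kN kk wr)).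
rewrite -mulrA -invfM -exprMn ler_wpM2l// lef_pV2 ?posrE//.
exact: lt_le_trans gsq.
Qed.

Lemma unif_cont_hrect (G : R[i] -> R[i]) (m e : R) : 1 <= m -> 0 < e ->
  (forall w, 0 < Re w -> contC G w) -> exists2 d : R, 0 < d &
  forall w w', in_rect m^-1 m (- m) m w -> normc (w' - w) < d ->
    normc (G w' - G w) < e.
Proof.
move=> m1 e0 Gc; apply: (@rect_bisect _ (fun a b c d => exists2 r : R, 0 < r &
  forall w w', in_rect a b c d w -> normc (w' - w) < r ->
    normc (G w' - G w) < e) m^-1 m (- m) m).
- by apply: (@le_trans _ _ 1) => //; rewrite invf_le1//; lra.
- lra.
- move=> a b c d _ _ _ _ _ _ [r1 p1 h1] [r2 p2 h2] [r3 p3 h3] [r4 p4 h4].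
  exists (Num.min (Num.min r1 r2) (Num.min r3 r4)); first by rewrite !lt_min p1 p2 p3.
  move=> w w' [/andP[wa wb] /andP[wc wd]].
  rewrite !lt_min => /andP[/andP[n1 n2] /andP[n3 n4]].
  have [h|h] := leP (Re w) ((a + b) / 2); have [h'|h'] := leP (Im w) ((c + d) / 2).
  + by apply: h1 => //; split; apply/andP; split=> //; exact: ltW.
  + by apply: h3 => //; split; apply/andP; split=> //; exact: ltW.
  + by apply: h2 => //; split; apply/andP; split=> //; exact: ltW.
  + by apply: h4 => //; split; apply/andP; split=> //; exact: ltW.
- move=> u v ur vr; pose w0 := (u +i* v)%C.
  have wr : in_rect m^-1 m (- m) m w0 by split.
  have e2 : 0 < e / 2 by lra.
  have [d d0 Hd] := Gc _ (hrect_gt0 m1 wr) _ e2.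
  exists (d / 4); first lra.
  move=> a b c d' _ _ _ _ ua vc ab cd; exists (d / 2); first lra.
  move=> w w' wr' ww'.
  have w0r : in_rect a b c d' w0 by split.
  have h := normc_in_rect wr' w0r.
  have h1 : normc (w - w0) < d by lra.
  have h2 : normc (w' - w0) < d.
    have -> : w' - w0 = (w' - w) + (w - w0) by ring.
    by apply: (le_lt_trans (ler_normcD _ _)); lra.
  have := Hd _ h1; have := Hd _ h2.
  have -> : G w' - G w = (G w' - G w0) - (G w - G w0) by ring.
  by move=> h3 h4; apply: (le_lt_trans (ler_normcB _ _)); lra.
Qed.

(* The Moebius map [w |-> (w + r) / (1 + r w)] sends the half-plane into a
   compact subset of itself and tends to the identity as [r] tends to 0. *)
Lemma bounded_approx f (m e : R) : 1 <= m -> 0 < e -> exists G : R[i] -> R[i],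
  exists2 B : R, 0 < B & (forall w, 0 < Re w -> holoC G w /\ normc (G w) <= B) /\
  forall w, in_rect m^-1 m (- m) m w -> normc (G w - hp omega f w) <= e.
Proof.
move=> m1 e0.
have fc w : 0 < Re w -> contC (hp omega f) w by move=> w0; apply/holoC_cont/hp_holo.
have [d d0 Hd] := unif_cont_hrect m1 e0 fc.
(* From [T w - w = r (1 - w ^ 2) / (1 + r w)] and [normc w <= 2 * m], the displacement on the
   rectangle is at most [d / 2]. *)
pose r := Num.min (1 / 2) (d / (2 * (1 + 4 * m ^+ 2))).
have q0 : 0 < 1 + 4 * m ^+ 2 by have := sqr_ge0 m; lra.
have r0 : 0 < r by rewrite lt_min !divr_gt0// mulr_gt0.
have r1 : r <= 1 / 2 by rewrite ge_min lexx.
have rd : r * (2 * (1 + 4 * m ^+ 2)) <= d.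
  by rewrite -ler_pdivlMr ?mulr_gt0// ge_min lexx orbT.
clearbody r.
pose den w := 1 + r%:C%C * w; pose T w := (w + r%:C%C) / den w.
have den1 w : 0 < Re w -> 1 <= normc (den w).
  move=> w0; apply: le_trans (ler_Re_normc _); apply: le_trans (ler_norm _).
  rewrite cReD cReM/= mul0r subr0 lerDl mulr_ge0// ltW//.
have den0 w : 0 < Re w -> den w != 0.
  by move=> /den1 h; rewrite -normc_gt0; lra.
have Th w : 0 < Re w -> holoC T w.
  move=> w0; apply: holoC_div; first exact: den0.
    by apply: holoCD; [exact: holoC_id|exact: holoC_cst].
  apply: holoCD; first exact: holoC_cst.
  by apply: holoCM; [exact: holoC_cst|exact: holoC_id].
have rr : 0 <= 1 - r ^+ 2 by rewrite subr_ge0 expr_le1//; lra.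
have ReT w : 0 < Re w -> r <= Re (T w).
  move=> w0; rewrite /T cReM Re_inv Im_inv.
  have n0 : 0 < normc (den w) ^+ 2 by rewrite exprn_gt0// normc_gt0 den0.
  rewrite -(ler_pM2r n0).
  have -> : (Re (w + r%:C%C) * (Re (den w) / normc (den w) ^+ 2) -
    Im (w + r%:C%C) * (- Im (den w) / normc (den w) ^+ 2)) * normc (den w) ^+ 2 =
    Re (w + r%:C%C) * Re (den w) + Im (w + r%:C%C) * Im (den w).
    by move: (normc (den w) ^+ 2) n0 => q n0; field; rewrite gt_eqF.
  rewrite normc_sqr /den !(cReD, cImD, cReM, cImM)/=.
  move: (Re w) (Im w) w0 => x y x0.
  have h1 : 0 <= r * (1 - r ^+ 2) * (x ^+ 2 + y ^+ 2) :=
    mulr_ge0 (mulr_ge0 (ltW r0) rr) (addr_ge0 (sqr_ge0 x) (sqr_ge0 y)).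
  have h2 : 0 <= x * (1 - r ^+ 2) := mulr_ge0 (ltW x0) rr.
  rewrite -subr_ge0 (_ : _ - _ = r * (1 - r ^+ 2) * (x ^+ 2 + y ^+ 2) +
    x * (1 - r ^+ 2)); first exact: addr_ge0.
  by ring.
have nT w : 0 < Re w -> normc (T w) <= r^-1.
  move=> w0; rewrite /T normcM normcV ler_pdivrMr ?normc_gt0 ?den0//.
  rewrite -(ler_pM2l r0) mulrA divff ?gt_eqF// mul1r.
  rewrite -{1}(gtr0_norm r0) -normc_real -normcM.
  rewrite -(ler_pXn2r (n:=2)) ?nnegrE ?normc_ge0// !normc_sqr.
  rewrite /den !(cReD, cImD, cReM, cImM)/=.
  move: (Re w) (Im w) w0 => x y x0.
  have h1 : 0 <= (1 - r ^+ 2) * (1 + r ^+ 2) :=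
    mulr_ge0 rr (addr_ge0 ler01 (sqr_ge0 r)).
  have h2 : 0 <= r * x * (1 - r ^+ 2) := mulr_ge0 (mulr_ge0 (ltW r0) (ltW x0)) rr.
  rewrite -subr_ge0 (_ : _ - _ = (1 - r ^+ 2) * (1 + r ^+ 2) +
    (r * x * (1 - r ^+ 2) + r * x * (1 - r ^+ 2))); last by ring.
  by apply: addr_ge0 => //; exact: addr_ge0.
have ir1 : 1 <= r^-1 by rewrite invf_ge1//; lra.
have [| |w wr|B B0 HB] := @rect_bounded _ (hp omega f) r r^-1 (- r^-1) r^-1.
- lra.
- lra.
- by apply: fc; case: wr => /andP[h _] _; exact: lt_le_trans h.
have T0 w : 0 < Re w -> 0 < Re (T w) by move=> /ReT; exact: lt_le_trans.
exists (fun w => hp omega f (T w)); exists B => //; split.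
  move=> w w0; split.
    by apply: (@holoC_comp _ (hp omega f)); [exact: Th|apply: hp_holo => //; exact: T0].
  apply: HB; split.
    rewrite ReT//=; apply: le_trans (nT _ w0); apply: le_trans (ler_Re_normc _).
    exact: ler_norm.
  by rewrite -ler_norml; apply: le_trans (nT _ w0); exact: ler_Im_normc.
move=> w wr; apply/ltW/Hd => //; have w0 := hrect_gt0 m1 wr.
have -> : T w - w = r%:C%C * (1 - w * w) / den w.
  by rewrite /T /den; field; exact: den0.
rewrite !normcM normcV normc_real gtr0_norm//.
have nw : normc w <= 2 * m.
  apply: (le_trans (normc_le_ReIm _)); case: wr => /andP[h1 h2]; rewrite -ler_norml => h3.
  rewrite gtr0_norm//; lra.
have n1 : normc (1 - w * w) <= 1 + 4 * m ^+ 2.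
  apply: (le_trans (ler_normcB _ _)); rewrite normc1 normcM lerD2l.
  have -> : 4 * m ^+ 2 = (2 * m) * (2 * m) by ring.
  by apply: ler_pM; rewrite ?normc_ge0.
have dn := den1 _ w0.
have idn : (normc (den w))^-1 <= 1 by rewrite invf_le1//; lra.
apply: (@le_lt_trans _ _ (r * (1 + 4 * m ^+ 2) * 1)).
  apply: ler_pM => //; rewrite ?invr_ge0 ?mulr_ge0 ?normc_ge0 ?(ltW r0)//.
  by rewrite ler_pM2l.
have : 0 < r * (1 + 4 * m ^+ 2) by rewrite mulr_gt0.
lra.
Qed.

End approximation.

(** * The one-parameter groups and their peak functions *)

Section one_parameter_groups.
Context {R : realType} {omega : R[i]} (o1 : normc omega = 1).
Implicit Types (z w : R[i]) (f g : holo_space R) (hyp : bool).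

(* [w |-> gs * w + i gt] at time [k]: the hyperbolic group of dilations about
   [- i c] if [hyp], the parabolic group of translations by [i c k] otherwise. *)
Definition gs hyp (k : R) : R := if hyp then expR k else 1.
Definition gt hyp (k c : R) : R := if hyp then c * (expR k - 1) else c * k.

Lemma gs_gt0 hyp k : 0 < gs hyp k.
Proof. by case: hyp; rewrite /gs// expR_gt0. Qed.

(** The image of [w] at time [k], seen from the copy placed at time [k']: this is the argument at
    which that copy's function and peak are evaluated. *)
Definition relpos hyp (k c k' c' : R) w : R[i] :=
  inv_aff (gs hyp k') (gt hyp k' c') (aff (gs hyp k) (gt hyp k c) w).

Lemma Re_relpos hyp k c k' c' w : 0 < Re w -> 0 < Re (relpos hyp k c k' c' w).
Proof. by move=> w0; rewrite /= !mulr_gt0 ?invr_gt0 ?gs_gt0. Qed.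

Lemma normc_le_addr z (r : R) : 0 <= Re z -> 0 <= r ->
  [/\ normc z <= normc (z + r%:C%C), r <= normc (z + r%:C%C) &
   Re z <= normc (z + r%:C%C)].
Proof.
move=> z0 r0; split.
- rewrite -(ler_pXn2r (n:=2)) ?nnegrE ?normc_ge0// !normc_sqr cReD cImD/= addr0.
  by rewrite lerD2r ler_pXn2r ?nnegrE ?addr_ge0// lerDl.
- apply: le_trans (ler_Re_normc _); apply: le_trans (ler_norm _).
  by rewrite cReD/= lerDr.
- apply: le_trans (ler_Re_normc _); apply: le_trans (ler_norm _).
  by rewrite cReD/= lerDl.
Qed.

(** Exponential decay is weakened to the quadratic decay of the parabolic peaks, so that one
    summation lemma serves both cases. *)
Lemma expRN_le (d : R) : 0 < d -> expR (- d) <= 4 / d ^+ 2.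
Proof.
move=> d0; rewrite ler_pdivlMr ?exprn_gt0// expRN mulrC ler_pdivrMr ?expR_gt0//.
have -> : expR d = expR (d / 2) * expR (d / 2) by rewrite -expRD -splitr.
have h := expR_ge1Dx (d / 2).
have -> : d ^+ 2 = 4 * ((d / 2) * (d / 2)) by field.
by rewrite ler_pM2l//; apply: ler_pM; lra.
Qed.

(** In the hyperbolic group the relative position tends to the boundary fixed point [- i c] in one
    direction of time and to infinity in the other: the first factor vanishes at the former, the
    second at the latter. In the parabolic group both directions lead to infinity, only linearly,
    whence the square. *)
Definition peak hyp (A r c : R) w : R[i] :=
  if hyp then (w + 'i%C * c%:C%C) / (w + 'i%C * c%:C%C + r%:C%C) * (A%:C%C / (w + A%:C%C))
  else (A%:C%C / (w + A%:C%C)) ^+ 2.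

Lemma Re_addi w (c : R) : Re (w + 'i%C * c%:C%C) = Re w.
Proof. by rewrite cReD cReM/=; ring. Qed.

Lemma addr_neq0C z (r : R) : 0 < Re z -> 0 < r -> z + r%:C%C != 0.
Proof.
by move=> z0 r0; have [_ h _] := normc_le_addr (ltW z0) (ltW r0);
  rewrite -normc_gt0; lra.
Qed.

Lemma holoC_peak hyp (A r c : R) w : 0 < A -> 0 < r -> 0 < Re w ->
  holoC (peak hyp A r c) w.
Proof.
move=> A0 r0 w0; have hA : holoC (fun w => A%:C%C / (w + A%:C%C)) w.
  apply: holoC_div; [exact: addr_neq0C|exact: holoC_cst|].
  by apply: holoCD; [exact: holoC_id|exact: holoC_cst].
case: hyp; last exact: holoCX.
apply: holoCM => //; apply: holoC_div.
- by apply: addr_neq0C => //; rewrite Re_addi.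
- by apply: holoCD; [exact: holoC_id|exact: holoC_cst].
- apply: holoCD; last exact: holoC_cst.
  by apply: holoCD; [exact: holoC_id|exact: holoC_cst].
Qed.

Lemma cap_le1 (A : R) w : 0 < A -> 0 < Re w -> normc (A%:C%C / (w + A%:C%C)) <= 1.
Proof.
move=> A0 w0; rewrite normcM normcV ler_pdivrMr ?normc_gt0 ?addr_neq0C//.
rewrite mul1r normc_real gtr0_norm//.
by have [] := normc_le_addr (ltW w0) (ltW A0).
Qed.

Lemma notch_le1 (r c : R) w : 0 < r -> 0 < Re w ->
  normc ((w + 'i%C * c%:C%C) / (w + 'i%C * c%:C%C + r%:C%C)) <= 1.
Proof.
move=> r0 w0; have z0 : 0 < Re (w + 'i%C * c%:C%C) by rewrite Re_addi.
rewrite normcM normcV ler_pdivrMr ?normc_gt0 ?addr_neq0C// mul1r.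
by have [] := normc_le_addr (ltW z0) (ltW r0).
Qed.

Lemma hrect_normc (m : R) w : 1 <= m -> in_rect m^-1 m (- m) m w -> normc w <= 2 * m.
Proof.
move=> m1 wr; have w0 := hrect_gt0 m1 wr.
apply: (le_trans (normc_le_ReIm _)); case: wr => /andP[h1 h2]; rewrite -ler_norml => h3.
rewrite gtr0_norm//; lra.
Qed.

(** On the rectangle [normc w <= 2 * m] and [Re w >= m^-1]; the values of [A] and [r] put each
    factor within [2 * m / A = r * m = e / 2] of 1. *)
Lemma peak_near1 hyp (A r c e m : R) w : 1 <= m -> 0 < e -> A = 4 * m / e ->
  r = e / (2 * m) -> in_rect m^-1 m (- m) m w -> normc (peak hyp A r c w - 1) <= e.
Proof.
move=> m1 e0 AE rE wr; have w0 := hrect_gt0 m1 wr; have wm := hrect_normc m1 wr.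
have m0 : 0 < m by lra.
have A0 : 0 < A by rewrite AE divr_gt0// mulr_gt0.
have r0 : 0 < r by rewrite rE divr_gt0// mulr_gt0.
have wA : w + A%:C%C != 0 by exact: addr_neq0C.
have capE : normc (A%:C%C / (w + A%:C%C) - 1) <= e / 2.
  have -> : A%:C%C / (w + A%:C%C) - 1 = - (w / (w + A%:C%C)) by field.
  rewrite normcN normcM normcV ler_pdivrMr ?normc_gt0//.
  have [_ h _] := normc_le_addr (ltW w0) (ltW A0).
  apply: (le_trans wm); apply: (@le_trans _ _ (e / 2 * A)).
    by rewrite AE (_ : e / 2 * _ = 2 * m)//; field; rewrite gt_eqF.
  by rewrite ler_pM2l// divr_gt0.
have cap1 := cap_le1 A0 w0.
rewrite /peak; case: hyp; last first.
  set y := A%:C%C / _ in capE cap1 *.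
  have -> : y ^+ 2 - 1 = (y - 1) * y + (y - 1) by ring.
  apply: (le_trans (ler_normcD _ _)); rewrite normcM.
  have : normc (y - 1) * normc y <= e / 2 * 1 by apply: ler_pM; rewrite ?normc_ge0.
  lra.
set y := A%:C%C / _ in capE cap1 *; set z := w + 'i%C * _.
have z0 : 0 < Re z by rewrite Re_addi.
have zr := addr_neq0C z0 r0.
have -> : z / (z + r%:C%C) * y - 1 = - (r%:C%C / (z + r%:C%C)) * y + (y - 1).
  by field.
apply: (le_trans (ler_normcD _ _)).
have : normc (- (r%:C%C / (z + r%:C%C)) * y) <= e / 2 * 1.
  rewrite normcM normcN; apply: ler_pM; rewrite ?normc_ge0//.
  rewrite normcM normcV normc_real gtr0_norm// ler_pdivrMr ?normc_gt0//.
  have [_ _ h] := normc_le_addr (ltW z0) (ltW r0).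
  have h2 : m^-1 <= normc (z + r%:C%C).
    by apply: le_trans h; rewrite Re_addi; case: wr => /andP[].
  apply: (@le_trans _ _ (e / 2 * m^-1)); last by rewrite ler_pM2l// divr_gt0.
  by rewrite rE invfM mulrA.
lra.
Qed.

Lemma peak_far_hyperbolic (A r c k c' k' m : R) w : 1 <= m -> 0 < A -> 0 < r ->
  `|c| <= m -> `|c'| <= m -> 0 <= k -> 0 <= k' -> k != k' ->
  in_rect m^-1 m (- m) m w ->
  normc (peak true A r c' (relpos true k c k' c' w)) <=
    4 * (A * m + 5 * m / r) / (k - k') ^+ 2.
Proof.
move=> m1 A0 r0 cm cm' k0 k0' kk wr.
have w0 := hrect_gt0 m1 wr; have wm := hrect_normc m1 wr.
have m0 : 0 < m by lra.
have v0 := Re_relpos true k c k' c' w0.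
set v := relpos _ _ _ _ _ _ in v0 *.
have Am0 : 0 < A * m by rewrite mulr_gt0.
have rm0 : 0 < 5 * m / r by rewrite divr_gt0// mulr_gt0.
have e1 (x : R) : expR x != 0 by rewrite gt_eqF// expR_gt0.
have aux (X Y D : R) : 0 < D -> X <= Y -> X * (4 / D) <= 4 * Y / D.
  move=> D0 XY; rewrite mulrA (mulrC X) ler_pM2r ?invr_gt0//.
  by rewrite ler_pM2l.
rewrite /peak normcM.
move: kk; rewrite neq_lt => /orP[kk|kk].
  (* Seen from a later copy, the point is near [- i c']: [w + i c] is contracted by [expR (k - k')],
     up to a drift [(c' - c) * expR (- k')] which is as small because [k >= 0]. The constant 5 is
     [3 + 2], from [|w + i c| <= 3 m] and [|c' - c| <= 2 m]. *)
  have d0 : 0 < k' - k by lra.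
  have vE : v + 'i%C * c'%:C%C = (expR (k - k'))%:C%C * (w + 'i%C * c%:C%C) +
      'i%C * ((c' - c) * expR (- k'))%:C%C.
    rewrite expRD expRN; apply: complex_eqP;
      rewrite /v /relpos /inv_aff /aff /gs /gt !(cReD, cReM, cImD, cImM)/=; by field.
  have vn : normc (v + 'i%C * c'%:C%C) <= 5 * m * expR (- (k' - k)).
    rewrite vE; apply: (le_trans (ler_normcD _ _)).
    rewrite !normcM normc_i mul1r !normc_real normrM !(gtr0_norm (expR_gt0 _)).
    have h1 : normc (w + 'i%C * c%:C%C) <= 3 * m.
      apply: (le_trans (ler_normcD _ _)); rewrite normcM normc_i mul1r normc_real; lra.
    have h2 : `|c' - c| <= 2 * m by apply: (le_trans (ler_normB _ _)); lra.
    have h3 : expR (- k') <= expR (- (k' - k)) by rewrite ler_expR; lra.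
    rewrite opprB; rewrite opprB in h3.
    have g1 : expR (k - k') * normc (w + 'i%C * c%:C%C) <= expR (k - k') * (3 * m).
      by rewrite ler_pM2l// expR_gt0.
    have g2 : `|c' - c| * expR (- k') <= 2 * m * expR (k - k').
      by apply: ler_pM => //; exact: expR_ge0.
    lra.
  have z0 : 0 < Re (v + 'i%C * c'%:C%C) by rewrite Re_addi.
  apply: (@le_trans _ _ (5 * m * expR (- (k' - k)) / r * 1)).
    apply: ler_pM; rewrite ?normc_ge0//; last exact: cap_le1.
    rewrite normcM normcV; apply: ler_pM; rewrite ?invr_ge0 ?normc_ge0//.
    have [_ h _] := normc_le_addr (ltW z0) (ltW r0).
    by rewrite lef_pV2 ?posrE//; exact: lt_le_trans h.
  rewrite mulr1 mulrAC; have h := expRN_le d0.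
  have -> : (k - k') ^+ 2 = (k' - k) ^+ 2 by ring.
  apply: (@le_trans _ _ (5 * m / r * (4 / (k' - k) ^+ 2))); first by rewrite ler_pM2l.
  by apply: aux; rewrite ?exprn_gt0// lerDr ltW.
(* Seen from an earlier copy, the real part has grown by the factor [expR (k - k')], which makes the
   second factor of the peak small. *)
have d0 : 0 < k - k' by lra.
apply: (@le_trans _ _ (1 * (A * m * expR (- (k - k'))))).
  apply: ler_pM; rewrite ?normc_ge0//; first exact: notch_le1.
  rewrite normcM normcV normc_real gtr0_norm// -mulrA ler_pM2l//.
  have -> : m * expR (- (k - k')) = (m^-1 * expR (k - k'))^-1.
    by rewrite invfM invrK expRN.
  have [_ _ h] := normc_le_addr (ltW v0) (ltW A0).
  have p0 : 0 < m^-1 * expR (k - k') by rewrite mulr_gt0 ?invr_gt0 ?expR_gt0.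
  have h2 : m^-1 * expR (k - k') <= normc (v + A%:C%C).
    apply: le_trans h; rewrite expRD expRN.
    have -> : Re v = Re w * (expR k / expR k') by rewrite /v /=; ring.
    rewrite ler_wpM2r ?divr_ge0 ?expR_ge0//.
    by case: wr => /andP[].
  by rewrite lef_pV2 ?posrE//; exact: lt_le_trans h2.
rewrite mul1r; have h := expRN_le d0.
apply: (@le_trans _ _ (A * m * (4 / (k - k') ^+ 2))); first by rewrite ler_pM2l.
by apply: aux; rewrite ?exprn_gt0// lerDl ltW.
Qed.

Lemma peak_far_parabolic (A r c k k' m : R) w : 1 <= m -> 0 < A -> `|c| = 1 ->
  0 <= k -> 0 <= k' -> k != k' -> in_rect m^-1 m (- m) m w ->
  normc (peak false A r c (relpos false k c k' c w)) <=
    4 * (A ^+ 2 + m ^+ 2) / (k - k') ^+ 2.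
Proof.
move=> m1 A0 c1 k0 k0' kk wr.
have w0 := hrect_gt0 m1 wr; have m0 : 0 < m by lra.
have v0 := Re_relpos false k c k' c w0.
set v := relpos _ _ _ _ _ _ in v0 *.
have d0 : 0 < (k - k') ^+ 2 by rewrite exprn_even_gt0//= subr_eq0.
have cap1 := cap_le1 A0 v0.
rewrite /peak normcX ler_pdivlMr//.
(* Up to [2 * m] the translation may be cancelled by [Im w], and the peak is merely bounded by 1;
   beyond, [|Im v| >= |k - k'| - m >= |k - k'| / 2]. *)
have [h|h] := leP `|k - k'| (2 * m).
  have : normc (A%:C%C / (v + A%:C%C)) ^+ 2 <= 1.
    by rewrite expr_le1 ?normc_ge0.
  have : (k - k') ^+ 2 <= (2 * m) ^+ 2.
    by rewrite -(real_normK (num_real (k - k'))) ler_pXn2r ?nnegrE//; lra.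
  move: (normc _ ^+ 2) => q h1 h2.
  apply: (@le_trans _ _ (1 * (k - k') ^+ 2)); first by rewrite ler_pM2r.
  by have := sqr_ge0 A; rewrite exprMn in h1; lra.
have vE : Im v = Im w + c * (k - k').
  by rewrite /v /relpos /inv_aff /aff /gs /gt/=; field.
have vi : `|k - k'| / 2 <= normc (v + A%:C%C).
  apply: le_trans (ler_Im_normc _); rewrite cImD vE [Im _%:C%C]/= addr0.
  have := lerB_normD (c * (k - k')) (Im w); rewrite [c * _ + _]addrC normrM c1 mul1r.
  by case: wr => _; rewrite -ler_norml; lra.
have vA : 0 < normc (v + A%:C%C) by rewrite normc_gt0 addr_neq0C.
rewrite normcM normcV normc_real gtr0_norm// exprMn exprVn mulrAC ler_pdivrMr ?exprn_gt0//.
apply: (@le_trans _ _ (A ^+ 2 * (4 * normc (v + A%:C%C) ^+ 2))).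
  rewrite ler_pM2l ?exprn_gt0// -(real_normK (num_real (k - k'))).
  have -> : 4 * normc (v + A%:C%C) ^+ 2 = (2 * normc (v + A%:C%C)) ^+ 2 by ring.
  by rewrite ler_pXn2r ?nnegrE//; lra.
have : 0 <= m ^+ 2 * normc (v + A%:C%C) ^+ 2 by rewrite mulr_ge0 ?sqr_ge0.
lra.
Qed.

Lemma expR_sub1_le (x : R) : 0 <= x <= 1 / 2 -> 0 <= expR x - 1 <= 2 * x.
Proof.
move=> /andP[x0 x1]; have h1 := expR_ge1Dx x; have h2 := expR_ge1Dx (- x).
have e0 := expR_gt0 x.
have h3 : (1 - x) * expR x <= 1.
  rewrite -[leRHS](_ : expR (- x) * expR x = 1); last by rewrite expRN mulVf// gt_eqF.
  by rewrite ler_pM2r.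
by apply/andP; split; nra.
Qed.

(** The bound is uniform in [k]: a hyperbolic change of [c] enters through
    [(c - c') * (1 - expR (- k))] only. A parabolic change would drift like [(c - c') * k], hence
    the condition [c = c'] there. The 7 collects [4 m e + 2 m e + e]. *)
Lemma relpos_close hyp (k x c c' e m : R) w : 1 <= m -> 0 <= k -> 0 <= x <= e ->
  e <= 1 / 2 -> `|c| <= m -> `|c - c'| <= e -> (hyp \/ c = c') ->
  in_rect m^-1 m (- m) m w ->
  normc (relpos hyp (k + x) c k c' w - w) <= 7 * m * e.
Proof.
move=> m1 k0 /andP[x0 xe] e2 cm cc hc wr; have wm := hrect_normc m1 wr.
have e0 : 0 <= e by lra.
case: hyp hc => [_|[//|<-]]; last first.
  have -> : relpos false (k + x) c k c w - w = 'i%C * (c * x)%:C%C.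
    by apply: complex_eqP; rewrite /relpos /inv_aff /aff /gs /gt
      !(cReD, cReM, cImD, cImM, cReN, cImN)/=; field.
  rewrite normcM normc_i mul1r normc_real normrM (ger0_norm x0).
  have : `|c| * x <= m * e by apply: ler_pM.
  have : 0 <= m * e by rewrite mulr_ge0//; lra.
  lra.
have ek : expR k != 0 by rewrite gt_eqF// expR_gt0.
have -> : relpos true (k + x) c k c' w - w = (expR x - 1)%:C%C * w +
    'i%C * (c * (expR x - 1) + (c - c') * (1 - expR (- k)))%:C%C.
  rewrite expRN; apply: complex_eqP; rewrite /relpos /inv_aff /aff /gs /gt expRD
    !(cReD, cReM, cImD, cImM, cReN, cImN)/=; by field.
have /andP[q0 q1] : 0 <= expR x - 1 <= 2 * x by apply: expR_sub1_le; rewrite x0; lra.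
have p0 : 0 <= 1 - expR (- k) <= 1.
  by rewrite subr_ge0 -[X in _ <= X]expR0 ler_expR oppr_le0 k0/= gerBl expR_ge0.
apply: (le_trans (ler_normcD _ _)); rewrite !normcM normc_i mul1r !normc_real.
rewrite (ger0_norm q0).
have h1 : (expR x - 1) * normc w <= 2 * e * (2 * m).
  by apply: ler_pM; rewrite ?normc_ge0//; lra.
have h2 : `|c * (expR x - 1) + (c - c') * (1 - expR (- k))| <= m * (2 * e) + e * 1.
  apply: (le_trans (ler_normD _ _)); rewrite !normrM.
  case/andP: p0 => p0 p1.
  by apply: lerD; apply: ler_pM; rewrite ?normr_ge0// ger0_norm//; lra.
have : 1 * e <= m * e by rewrite ler_wpM2r.
lra.
Qed.

End one_parameter_groups.

(** * Density of the functions whose orbits meet a given open set *)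

Section density.
Context {R : realType} {omega : R[i]} (o1 : normc omega = 1).
Implicit Types (z w : R[i]) (f g : holo_space R) (hyp : bool).

Lemma interval_net (c1 c2 e : R) : c1 <= c2 -> 0 < e -> exists cs : seq R,
  (forall c, c \in cs -> c1 <= c <= c2) /\
  forall c, c1 <= c <= c2 -> exists2 c', c' \in cs & `|c - c'| <= e.
Proof.
move=> c12 e0; pose N := Num.truncn ((c2 - c1) / e).
exists [seq Num.min (c1 + k%:R * e) c2 | k <- iota 0 N.+1]; split.
  move=> c /mapP[k _ ->]; rewrite ge_min lexx orbT andbT le_min c12 andbT.
  by rewrite lerDl mulr_ge0// ltW.
move=> c /andP[h1 h2]; pose k := Num.truncn ((c - c1) / e).
have q0 : 0 <= (c - c1) / e by rewrite divr_ge0 ?subr_ge0// ltW.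
have /andP[k1 k2] := truncn_itv q0.
rewrite ler_pdivlMr// in k1; rewrite ltr_pdivrMr// -natr1 mulrDl mul1r in k2.
exists (Num.min (c1 + k%:R * e) c2).
  apply/mapP; exists k => //; rewrite mem_iota/= add0n ltnS /k /N.
  by apply: le_truncn; rewrite ler_pM2r ?invr_gt0// lerB.
rewrite min_l; last by rewrite /k; lra.
by rewrite ger0_norm /k; lra.
Qed.

(** The positivity of [s] sits inside the existential so that [affop], composition with [aff s t] in
    half-plane coordinates, can be a total function; for [s <= 0] its value is arbitrary. *)
Lemma hp_affop_exists (s t : R) f : exists g, 0 < s -> forall w, 0 < Re w ->
  hp omega g w = hp omega f (aff s t w).
Proof.
have [s0|s0] := ltP 0 s; last first.
  by exists f.
have [|g Hg] := @hp_surj _ _ o1 (fun w => hp omega f (aff s t w)); last by exists g.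
move=> w w0; apply: (@holoC_comp _ (hp omega f)); first exact: holoC_aff.
by apply: hp_holo => //=; rewrite mulr_gt0.
Qed.

Definition affop (s t : R) f : holo_space R := projT1 (cid (hp_affop_exists s t f)).

Lemma hp_affop (s t : R) f w : 0 < s -> 0 < Re w ->
  hp omega (affop s t f) w = hp omega f (aff s t w).
Proof. by move=> s0; exact: (projT2 (cid (hp_affop_exists s t f)) s0). Qed.

Lemma aff_inv_aff (s t : R) w : s != 0 -> aff s t (inv_aff s t w) = w.
Proof.
by move=> s0; apply: complex_eqP; rewrite /inv_aff /aff/=; field.
Qed.

Lemma hrect_close (m d : R) w w' : 1 <= m -> d <= (2 * m)^-1 ->
  in_rect m^-1 m (- m) m w -> normc (w' - w) <= d ->
  in_rect (2 * m)^-1 (2 * m) (- (2 * m)) (2 * m) w'.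
Proof.
move=> m1 dm [/andP[a b] /andP[c e]] h.
have i1 : (2 * m)^-1 <= 1 by rewrite invf_le1//; lra.
have i2 : m^-1 = (2 * m)^-1 + (2 * m)^-1 by field; rewrite gt_eqF//; lra.
have := le_trans (ler_Re_normc _) h; have := le_trans (ler_Im_normc _) h.
rewrite cReD cReN cImD cImN !ler_norml => /andP[? ?] /andP[? ?].
by split; apply/andP; split; lra.
Qed.

(* The sum of translates of peaked copies of [h] along the covering sequence
   is close to [g] near the origin of time, and every orbit in the parameter
   rectangle meets one of the copies of [h]. *)
Lemma orbit_density hyp (a1 a2 c1 c2 : R) (U V : set (holo_space R)) :
  0 < a1 -> c1 <= c2 -> (hyp \/ c1 = c2 /\ `|c1| = 1) ->
  open U -> U !=set0 -> open V -> V !=set0 ->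
  exists2 f, U f & forall l c, a1 <= l <= a2 -> c1 <= c <= c2 -> exists2 n : nat,
    (0 < n)%N & V (affop (gs hyp (n%:R * l)) (gt hyp (n%:R * l) c) f).
Proof.
move=> a0 c12 hc oU [g Ug] oV [h Vh].
have /(holo_space_nbhsP o1)[m1 [e1 [m11 e10 H1]]] : nbhs g U by apply: open_nbhs_nbhs.
have /(holo_space_nbhsP o1)[m2 [e2 [m21 e20 H2]]] : nbhs h V by apply: open_nbhs_nbhs.
pose m := m1 + m2 + `|c1| + `|c2|; pose e := Num.min e1 e2.
have e0 : 0 < e by rewrite lt_min e10.
have [ee1 ee2] : e <= e1 /\ e <= e2 by split; rewrite ge_min lexx ?orbT.
have [n1 n2] : 0 <= `|c1| /\ 0 <= `|c2| by [].
have [mm1 mm2 mc1 mc2] : [/\ m1 <= m, m2 <= m, `|c1| <= m & `|c2| <= m].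
  by split; rewrite /m; lra.
have mp : 1 <= m by lra.
clearbody m e.
(* Doubling leaves room for the points of the rectangle of size [m] to move by [(2 * m)^-1]. *)
pose M := 2 * m; have M1 : 1 <= M by rewrite /M; lra.
have mM : m <= M by rewrite /M; lra.
have e4 : 0 < e / 4 by lra.
have [G [Bg Bg0 [GH Gg]]] := bounded_approx o1 g M1 e4.
have [F [Bh Bh0 [FH Fh]]] := bounded_approx o1 h M1 e4.
pose B := Bg + Bh; have B0 : 0 < B by rewrite addr_gt0.
have Fc w : 0 < Re w -> contC F w by move=> /FH[/holoC_cont].
have [d d0 Hd] := unif_cont_hrect mp e4 Fc.
(* A displacement of at most [q] changes [F] by less than [e / 4] and stays in the rectangle of size
   [M]; by [relpos_close], the mesh [r2] in time and in [c] keeps displacements below this bound. *)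
pose q := Num.min (d / 2) (2 * m)^-1.
have q0 : 0 < q by rewrite lt_min divr_gt0// invr_gt0 mulr_gt0//; lra.
have [qd qm] : q <= d / 2 /\ q <= (2 * m)^-1 by split; rewrite ge_min lexx ?orbT.
pose r2 := Num.min (1 / 2) (q / (7 * m)).
have m70 : 0 < 7 * m by lra.
have r20 : 0 < r2 by rewrite lt_min !divr_gt0.
have r2h : r2 <= 1 / 2 by rewrite ge_min lexx.
have r2q : 7 * m * r2 <= q by rewrite mulrC -ler_pdivlMr// ge_min lexx orbT.
clearbody r2 q.
(* The error [2 * B * eps] of [approx_sum] is budgeted at [e / 4]. *)
pose eps := e / (8 * B).
have eps0 : 0 < eps by rewrite divr_gt0// mulr_gt0.
have epsE : 2 * B * eps = e / 4 by rewrite /eps; field; rewrite gt_eqF.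
pose A := 4 * M / eps; pose r := eps / (2 * M).
have A0 : 0 < A by rewrite divr_gt0// mulr_gt0//; lra.
have r0 : 0 < r by rewrite divr_gt0// mulr_gt0//; lra.
pose C := if hyp then 4 * (A * M + 5 * M / r) else 4 * (A ^+ 2 + M ^+ 2).
have M0 : 0 < M by lra.
have C0 : 0 < C.
  rewrite /C; case: (hyp); rewrite mulr_gt0// addr_gt0 ?exprn_gt0//.
    by rewrite mulr_gt0.
  by rewrite divr_gt0// mulr_gt0.
(* [D >= 1] and [D >= 4 * C / eps] give [4 * C / D ^+ 2 <= eps]. [C] depends on the peaks only, so
   [D] is available before the list of times is built. *)
pose D := 1 + 4 * C / eps.
have CE : 0 < 4 * C / eps by rewrite divr_gt0// mulr_gt0.
have D1 : 1 <= D by rewrite /D; lra.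
have D0 : 0 < D by lra.
have CD : 4 * (C / D ^+ 2) <= eps.
  rewrite mulrA ler_pdivrMr ?exprn_gt0// (mulrC eps) -ler_pdivrMr//.
  apply: (@le_trans _ _ D); first by rewrite /D; lra.
  by rewrite expr2 ler_peMl// ltW.
have [cs [csI csN]] := interval_net c12 r20.
have [L [Lp LP LN]] := covering_net a2 D 0 cs a0 r20.
(* An entry at time 0 heads the list and carries the copy of [g]; the entries of [L], with indices
   shifted by one, carry the copies of [h]. *)
pose x0 : nat * (R * R) := (0%N, (0, c1)).
pose x k := nth x0 (x0 :: L) k.
have xP k : 0 <= key (x k) /\ c1 <= (x k).2.2 <= c2.
  have [kL|kL] := ltnP k (size (x0 :: L)); last first.
    by rewrite /x nth_default// /key/= mul0r lexx c12.
  have := mem_nth x0 kL; rewrite inE => /predU1P[xE|/LP[x1 x2 x3]].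
    by rewrite /x xE /key/= mul0r lexx c12.
  by split; [rewrite mulr_ge0//; apply: le_trans x2; exact: ltW|exact: csI].
have cM c : c1 <= c <= c2 -> `|c| <= m.
  move=> /andP[ca cb]; rewrite ler_norml.
  move: mc1 mc2; rewrite !ler_norml => /andP[? ?] /andP[? ?].
  by apply/andP; split; [exact: le_trans ca|exact: le_trans cb _].
have c1E : hyp \/ forall c, c1 <= c <= c2 -> c = c1.
  case: hc => [|[<- _]]; [by left|right=> c cc].
  by apply/le_anti; rewrite andbC.
have hrec k w : 0 < Re w -> holoC ((if k == 0%N then G else F)) w /\
    normc ((if k == 0%N then G else F) w) <= B.
  move=> w0; case: eqP => _; [have [h1 h2] := GH _ w0|have [h1 h2] := FH _ w0];
    by split=> //; apply: (le_trans h2); rewrite /B ?lerDl ?lerDr ltW.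
have [||||f Hf] := @approx_sum _ _ o1 (size (x0 :: L))
  (fun k => gs hyp (key (x k))) (fun k => gt hyp (key (x k)) (x k).2.2)
  (fun k => key (x k)) (fun k => peak hyp A r (x k).2.2)
  (fun k => if k == 0%N then G else F) B C D eps M B0 (ltW C0) D0 M1 CD (fun k => gs_gt0 _ _) hrec.
- by move=> k w w0; exact: holoC_peak.
- by move=> k w wr; apply: peak_near1 wr.
- move=> j k w _ _ jk wr; have [kj cj] := xP j; have [kk ck] := xP k.
  rewrite /C; case: (hyp) hc c1E => [_ _|[//|[ce c11]] [//|c2E]].
    apply: peak_far_hyperbolic => //.
      by apply: le_trans (cM _ cj) _.
    by apply: le_trans (cM _ ck) _.
  have -> : (x j).2.2 = (x k).2.2.
    by rewrite (c2E _ cj) (c2E _ ck).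
  apply: peak_far_parabolic => //.
  by rewrite (c2E _ ck).
- move=> i k ik; have key0 : key x0 = 0 by rewrite /key/= mul0r.
  have E j : (j < size (x0 :: L))%N -> key (x j) = nth 0 (0 :: map key L) j.
    by move=> jL; rewrite -[0 :: map key L]/(_ :: map key L) -{2}key0 -map_cons
      (nth_map x0).
  rewrite !E//; last by apply: leq_ltn_trans ik; exact: leq_addr.
  by apply: path_gap => //; rewrite size_map.
exists f.
  apply: H1 => w wr; have w0 := hrect_gt0 m11 wr.
  have wM : in_rect M^-1 M (- M) M w by apply: hrectS wr => //; exact: le_trans mm1 mM.
  have := Hf 0%N w isT wM; rewrite epsE /x/= /key/= mul0r.
  have -> : aff (gs hyp 0) (gt hyp 0 c1) w = w.
    by apply: complex_eqP; rewrite /aff /gs /gt; case: (hyp); rewrite /= ?expR0; ring.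
  have := Gg _ wM => h1 h2.
  rewrite -(subrK (G w) (hp omega f w)) -addrA.
  apply: (le_lt_trans (ler_normcD _ _)); move: h1 h2 ee1 e0; clear; lra.
move=> l c lP cP; have [c' c's cc] := csN _ cP.
have [y [yL yc /andP[y0 y1]]] := LN _ _ lP c's.
have [yn ya _] := LP _ yL.
exists y.1 => //; apply: H2 => w wr; have w0 := hrect_gt0 m21 wr.
have {}wr : in_rect m^-1 m (- m) m w by apply: hrectS wr.
have wM : in_rect M^-1 M (- M) M w by apply: hrectS wr.
rewrite hp_affop ?gs_gt0//.
have ky : 0 <= key y by rewrite mulr_ge0//; apply: le_trans ya; exact: ltW.
have kE : y.1%:R * l = key y + y.1%:R * (l - y.2.1) by rewrite /key; ring.
have hcc : hyp \/ c = c'.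
  by case: c1E => [|c1E]; [left|right; rewrite (c1E _ cP) (c1E _ (csI _ c's))].
have close := relpos_close mp ky (introT andP (conj y0 y1)) r2h (cM _ cP) cc hcc wr.
(* The iterate [y.1] at the parameter [(l, c)] sends [w] to the point where the copy of [h] at the
   entry [y] is read at [w'], and [w'] is close to [w]. *)
rewrite -kE in close; set w' := relpos _ _ _ _ _ _ in close.
have wq : normc (w' - w) <= q by exact: le_trans close r2q.
have wM' : in_rect M^-1 M (- M) M w' by exact: hrect_close wq.
have := Hf (index y L).+1 w'; rewrite /= ltnS index_mem => /(_ yL wM').
rewrite /x/= nth_index// yc /w' /relpos aff_inv_aff ?gt_eqF ?gs_gt0// -/(relpos _ _ _ _ _ _) -/w'.
rewrite epsE => h1.
have h2 : normc (F w' - F w) < e / 4 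
  by apply: Hd => //; apply: le_lt_trans wq _; move: qd d0; clear; lra.
have h3 := Fh _ wM.
have -> : hp omega f (aff (gs hyp (y.1%:R * l)) (gt hyp (y.1%:R * l) c) w) - hp omega h w =
  (hp omega f (aff (gs hyp (y.1%:R * l)) (gt hyp (y.1%:R * l) c) w) - F w') +
  (F w' - F w) + (F w - hp omega h w) by ring.
apply: (le_lt_trans (ler_normcD _ _)).
apply: (le_lt_trans (lerD (ler_normcD _ _) (lexx _))).
move: h1 h2 h3 ee2 e0; clear; lra.
Qed.

End density.

(** * Openness, return to the automorphisms and the countable intersection *)

Section orbits.
Context {R : realType} {omega : R[i]} (o1 : normc omega = 1).
Implicit Types (z w : R[i]) (f g : holo_space R) (hyp : bool).

Lemma gs_gt_continuous hyp (n : nat) (u v e : R) : 0 < e -> exists2 d : R, 0 < d &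
  forall l c, `|l - u| < d -> `|c - v| < d ->
    `|gs hyp (n%:R * l) - gs hyp (n%:R * u)| <= e /\
    `|gt hyp (n%:R * l) c - gt hyp (n%:R * u) v| <= e.
Proof.
move=> e0; pose phi (l : R) : R := if hyp then expR (n%:R * l) - 1 else n%:R * l.
have phic : continuous phi.
  rewrite /phi; case: (hyp) => l.
    apply: cvgB; last exact: cvg_cst.
    apply: continuous_comp; last exact: continuous_expR.
    by apply: cvgM; [exact: cvg_cst|exact: cvg_id].
  by apply: cvgM; [exact: cvg_cst|exact: cvg_id].
pose K := `|phi u| + `|v| + 1.
have p0 := normr_ge0 (phi u); have v0 := normr_ge0 v.
have K1 : 1 <= K by rewrite /K; lra.
pose e' := Num.min 1 (e / (2 * K)).
have e'0 : 0 < e' by rewrite lt_min ltr01 divr_gt0// mulr_gt0//; lra.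
have e'1 : e' <= 1 by rewrite ge_min lexx.
have e'K : e' * (2 * K) <= e by rewrite -ler_pdivlMr ?ge_min ?lexx ?orbT// mulr_gt0//; lra.
have e'e : e' <= e by apply: le_trans e'K; rewrite ler_peMr//; lra.
have /nbhs_ballP[d d0 Hd] : nbhs u [set l | `|phi u - phi l| < e'].
  by have /cvgrPdist_lt := phic u; apply.
exists (Num.min d e'); first by rewrite lt_min e'0 andbT.
move=> l c; rewrite lt_min => /andP[lu _]; rewrite [_ < Num.min d e']lt_min => /andP[_ cv].
have h : `|phi l - phi u| < e'.
  by rewrite distrC; apply: Hd; rewrite /ball/= distrC.
split.
  rewrite /gs; move: h; rewrite /phi; case: (hyp) => h; last by rewrite subrr normr0 ltW.
  apply: ltW; apply: lt_le_trans e'e; move: h.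
  by rewrite (_ : _ - 1 - _ = expR (n%:R * l) - expR (n%:R * u)) //; ring.
have -> : gt hyp (n%:R * l) c = c * phi l by rewrite /gt /phi; case: (hyp).
have -> : gt hyp (n%:R * u) v = v * phi u by rewrite /gt /phi; case: (hyp).
have -> : c * phi l - v * phi u = (c - v) * phi l + v * (phi l - phi u) by ring.
apply: (le_trans (ler_normD _ _)); rewrite !normrM.
have hl : `|phi l| <= `|phi u| + 1.
  have := ler_normD (phi l - phi u) (phi u); rewrite subrK; lra.
have h1 : `|c - v| * `|phi l| <= e' * K.
  by apply: ler_pM; rewrite ?normr_ge0 ?(ltW cv)//; rewrite /K; lra.
have h2 : `|v| * `|phi l - phi u| <= K * e'.
  by apply: ler_pM; rewrite ?normr_ge0 ?(ltW h)//; rewrite /K; lra.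
lra.
Qed.

Definition hits hyp (a1 a2 c1 c2 : R) (V : set (holo_space R)) : set (holo_space R) :=
  [set f | forall l c, a1 <= l <= a2 -> c1 <= c <= c2 -> exists2 n : nat,
    (0 < n)%N & V (affop o1 (gs hyp (n%:R * l)) (gt hyp (n%:R * l) c) f)].

(** By joint continuity, an iterate that works at one parameter works for all nearby parameters and
    all nearby functions at once; bisection leaves finitely many neighbourhoods of [f] to
    intersect. *)
Lemma open_hits hyp (a1 a2 c1 c2 : R) V : a1 <= a2 -> c1 <= c2 -> open V ->
  open (hits hyp a1 a2 c1 c2 V).
Proof.
move=> a12 c12 oV; rewrite openE => f fE; rewrite /interior.
apply: (@rect_bisect _ (fun a b c d => nbhs f (hits hyp a b c d V))) => //.
  move=> a b c d _ _ _ _ _ _ h1 h2 h3 h4.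
  apply: filterS (filterI (filterI h1 h2) (filterI h3 h4)).
  move=> g [[{}h1 {}h2] [{}h3 {}h4]] l k /andP[la lb] /andP[kc kd].
  have [h|h] := leP l ((a + b) / 2); have [h'|h'] := leP k ((c + d) / 2).
  - by apply: h1; apply/andP; split=> //; exact: ltW.
  - by apply: h3; apply/andP; split=> //; exact: ltW.
  - by apply: h2; apply/andP; split=> //; exact: ltW.
  - by apply: h4; apply/andP; split=> //; exact: ltW.
move=> u v uP vP; have [n n0 Vn] := fE u v uP vP.
set s := gs _ _ in Vn; set t := gt _ _ _ in Vn.
have s0 : 0 < s by exact: gs_gt0.
have /(holo_space_nbhsP o1)[m [e [m1 e0 H]]] : nbhs (affop o1 s t f) V.
  by apply: open_nbhs_nbhs.
(* Large enough for [aff s t] to map the rectangle of size [m] into that of size [M]. *)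
pose M := 1 + m / s + s * m + `|t|.
have ms0 : 0 < m / s by rewrite divr_gt0//; lra.
have sm0 : 0 < s * m by rewrite mulr_gt0//; lra.
have t0 := normr_ge0 t.
have M1 : 1 <= M by rewrite /M; lra.
have imM w : in_rect m^-1 m (- m) m w -> in_rect M^-1 M (- M) M (aff s t w).
  move=> [/andP[h1 h2]]; rewrite -ler_norml => h3; split.
    apply/andP; split; rewrite /aff/=; last first.
      have : s * Re w <= s * m by rewrite ler_pM2l.
      by rewrite /M; lra.
    apply: (@le_trans _ _ (m / s)^-1).
      by rewrite lef_pV2 ?posrE//; rewrite /M; lra.
    by rewrite invf_div ler_pM2l.
  rewrite -ler_norml /aff/=; apply: (le_trans (ler_normD _ _)).
  rewrite normrM gtr0_norm//; have : s * `|Im w| <= s * m by rewrite ler_pM2l.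
  by rewrite /M; lra.
have e2 : 0 < e / 2 by lra.
have fc w : 0 < Re w -> contC (hp omega f) w by move=> w0; apply/holoC_cont/hp_holo.
have [d d0 Hd] := unif_cont_hrect M1 e2 fc.
pose q := Num.min (d / 2) (2 * M)^-1.
have q0 : 0 < q by rewrite lt_min divr_gt0// invr_gt0 mulr_gt0//; lra.
have [qd qm] : q <= d / 2 /\ q <= (2 * M)^-1 by split; rewrite ge_min lexx ?orbT.
have m3 : 0 < 3 * m by lra.
(* Of [q], the dilation error uses [2 * m] shares of [q / (3 * m)], since [normc w <= 2 * m], and
   the translation error at most [m]. *)
have [|r r0 Hr] := @gs_gt_continuous hyp n u v (q / (3 * m)); first by rewrite divr_gt0.
exists r => // a b c k _ _ _ _ /andP[ua ub] /andP[vc vk] ab ck.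
have M21 : 1 <= 2 * M by lra.
have := nbhs_hball o1 f M21 e2.
apply: filterS => g Hg l c' /andP[la lb] /andP[ca cb].
exists n => //; apply: H => w wr; have w0 := hrect_gt0 m1 wr.
have [h1 h2] : `|gs hyp (n%:R * l) - s| <= q / (3 * m) /\
    `|gt hyp (n%:R * l) c' - t| <= q / (3 * m).
  by apply: Hr; rewrite ltr_norml; apply/andP; split; move: ua ub vc vk la lb ca cb ab ck; clear; lra.
rewrite !hp_affop ?gs_gt0//.
set s' := gs _ _ in h1 *; set t' := gt _ _ _ in h2 *.
have close : normc (aff s' t' w - aff s t w) <= q.
  have -> : aff s' t' w - aff s t w = (s' - s)%:C%C * w + 'i%C * (t' - t)%:C%C.
    by apply: complex_eqP; rewrite /aff !(cReD, cReM, cReN, cImD, cImM, cImN)/=; ring.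
  apply: (le_trans (ler_normcD _ _)); rewrite !normcM normc_i mul1r !normc_real.
  have h3 : `|s' - s| * normc w <= q / (3 * m) * (2 * m).
    by apply: ler_pM; rewrite ?normc_ge0//; exact: hrect_normc wr.
  have h4 : q / (3 * m) <= q / (3 * m) * m.
    by rewrite ler_peMr// divr_ge0 ?ltW.
  have -> : q = q / (3 * m) * (2 * m) + q / (3 * m) * m by field; rewrite gt_eqF//; lra.
  by apply: lerD => //; exact: le_trans h4.
have wM := imM _ wr; have wM' := hrect_close M1 qm wM close.
have -> : hp omega g (aff s' t' w) - hp omega f (aff s t w) =
  (hp omega g (aff s' t' w) - hp omega f (aff s' t' w)) +
  (hp omega f (aff s' t' w) - hp omega f (aff s t w)) by ring.
have g1 := Hg _ wM'.
have g2 : normc (hp omega f (aff s' t' w) - hp omega f (aff s t w)) < e / 2.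
  by apply: Hd => //; apply: le_lt_trans close _; move: qd d0; clear; lra.
by apply: (le_lt_trans (ler_normcD _ _)); move: g1 g2; clear; lra.
Qed.

Lemma gs_gtS hyp (n : nat) (l c : R) w :
  aff (gs hyp (n.+1%:R * l)) (gt hyp (n.+1%:R * l) c) w =
  aff (gs hyp (n%:R * l)) (gt hyp (n%:R * l) c) (aff (gs hyp l) (gt hyp l c) w).
Proof.
rewrite aff_comp -natr1 mulrDl mul1r; congr aff; case: hyp; rewrite /gs /gt ?expRD//; ring.
Qed.

Lemma iter_comp_op hyp (phi : disk_aut R) (l c : R) n f :
  is_aff omega phi (gs hyp l) (gt hyp l c) ->
  iter n (comp_op phi) f = affop o1 (gs hyp (n%:R * l)) (gt hyp (n%:R * l) c) f.
Proof.
move=> phiE; apply: (hp_inj o1) => w w0; rewrite hp_affop ?gs_gt0//.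
elim: n w w0 => [|n IH] w w0.
  rewrite mul0r; congr hp; rewrite /gs /gt; apply: complex_eqP;
    by case: (hyp); rewrite /aff/= ?expR0; ring.
rewrite iterS (hp_comp o1 _ _ phiE) ?gs_gt0//.
have w1 : 0 < Re (aff (gs hyp l) (gt hyp l c) w) by apply: mulr_gt0 => //; exact: gs_gt0.
by rewrite (IH _ w1) gs_gtS.
Qed.

(** Expressing the common hypercyclic vectors exactly as an intersection over parameters requires
    that each parameter be realised by an automorphism. *)
Lemma aff_aut_exists (s t : R) : 0 < s -> exists phi : disk_aut R, is_aff omega phi s t.
Proof.
move=> s0; have o0 := normc1_neq0 o1.
have lt1 (s' t' : R) (s'0 : 0 < s') (z : unit_disk R) :
    normc (icay omega (aff s' t' (cay omega (set_val z)))) < 1.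
  apply: normc_icay_lt1 => //=; rewrite mulr_gt0//.
  by apply: Re_cay_gt0 => //; exact: disk_normc.
pose F (s' t' : R) (s'0 : 0 < s') (z : unit_disk R) := mkD (lt1 s' t' s'0 z).
have Fh s' t' s'0 : holomorphic_map (F s' t' s'0).
  have [//|_] := @holomorphicP R (fun z : unit_disk R => set_val (F s' t' s'0 z))
    (fun z => icay omega (aff s' t' (cay omega z))); apply=> z z1.
  have c0 := Re_cay_gt0 o1 z1.
  apply: (@holoC_comp _ (icay omega) (fun z => aff s' t' (cay omega z))).
    apply: (@holoC_comp _ (aff s' t')); last exact: holoC_aff.
    by apply: holoC_cay; exact: disk_neq.
  by apply: holoC_icay; apply: Dp1_neq0; rewrite /= mulr_ge0// ltW.
have is0 : 0 < s^-1 by rewrite invr_gt0.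
have FK s1 t1 (s10 : 0 < s1) s2 t2 (s20 : 0 < s2) :
    (forall w, aff s2 t2 (aff s1 t1 w) = w) -> cancel (F s1 t1 s10) (F s2 t2 s20).
  move=> affK z; apply: val_inj; have z1 := disk_normc z.
  rewrite -[LHS]/(icay omega (aff s2 t2 (cay omega
    (icay omega (aff s1 t1 (cay omega (set_val z))))))).
  rewrite icayK//; last first.
    by apply: Dp1_neq0; rewrite /= mulr_ge0// ltW// Re_cay_gt0.
  by rewrite affK cayK//; exact: disk_neq.
have K1 : cancel (F s t s0) (F s^-1 (- t / s) is0).
  by apply: FK => w; rewrite -/(inv_aff s t _) inv_affK// gt_eqF.
have K2 : cancel (F s^-1 (- t / s) is0) (F s t s0).
  by apply: FK => w; rewrite -/(inv_aff s t _) aff_inv_aff// gt_eqF.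
by exists (@DiskAut R (F s t s0) (@Fh _ _ _)
  (ex_intro _ _ (And3 (@Fh _ _ _) K1 K2))) => z.
Qed.

Lemma common_hypercyclicP f : common_hypercyclic omega f <->
  forall hyp (l c : R), 0 < l -> hyp \/ `|c| = 1 ->
  forall O, open O -> O !=set0 -> exists2 n : nat, (0 < n)%N &
    O (affop o1 (gs hyp (n%:R * l)) (gt hyp (n%:R * l) c) f).
Proof.
split.
  move=> fH hyp l c l0 hc O oO O0.
  have [phi phiE] := aff_aut_exists (gt hyp l c) (gs_gt0 hyp l).
  have /fH/(_ O O0 oO)[g [Og [n n0 ng]]] : attractive_fixed_point phi omega.
    apply/(attractive_affine _ o1); exists (gs hyp l), (gt hyp l c); split=> //.
      by case: (hyp); rewrite /gs ?lexx// -[X in X <= _]expR0 ler_expR ltW.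
    case: (hyp) hc => [_|[//|c1]]; first by left; rewrite /gs gt_eqF// expR_gt1.
    right; rewrite /gt mulf_neq0 ?(gt_eqF l0)//.
    by apply/eqP => c0; move: c1; rewrite c0 normr0 => /eqP; rewrite eq_sym oner_eq0.
  by exists n => //; rewrite -(iter_comp_op _ _ phiE) ng.
move=> H phi /(attractive_affine _ o1)[s [t [s1 st phiE]]] O O0 oO.
(* A parabolic translation splits into its length, the time [l], and its direction, the sign [c]. In
   the hyperbolic case [l = ln s], and [c = t / (s - 1)] makes [- i c] the finite fixed point. *)
have [hyp [l [c [l0 hc sE tE]]]] : exists hyp (l c : R),
    [/\ 0 < l, hyp \/ `|c| = 1, gs hyp l = s & gt hyp l c = t].
  have [es|es] := eqVneq s 1.
    case: st => [|t0]; first by rewrite es eqxx.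
    have n0 : 0 < `|t| by rewrite normr_gt0.
    exists false, `|t|, (t / `|t|); split=> //.
    - by right; rewrite normrM normfV normr_id divff// gt_eqF.
    - by rewrite /gt divfK// gt_eqF.
  have sg : 1 < s by rewrite lt_neqAle eq_sym es.
  exists true, (ln s), (t / (s - 1)); split.
  - by rewrite ln_gt0.
  - by left.
  - by rewrite /gs lnK// posrE; lra.
  - by rewrite /gt lnK ?posrE; [rewrite divfK// subr_eq0|lra].
rewrite -sE -tE in phiE.
have [n n0 On] := H hyp l c l0 hc O oO O0.
exists (iter n (comp_op phi) f); split; last by exists n.
by rewrite (iter_comp_op _ _ phiE).
Qed.

Lemma dense_hits hyp (a1 a2 c1 c2 : R) V : 0 < a1 -> c1 <= c2 ->
  (hyp \/ c1 = c2 /\ `|c1| = 1) -> open V -> V !=set0 ->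
  dense (hits hyp a1 a2 c1 c2 V).
Proof.
move=> a0 c12 hc oV V0 U U0 oU.
by have [f Uf fH] := orbit_density o1 a2 a0 c12 hc oU U0 oV V0; exists f.
Qed.

Lemma common_hypercyclic_bigcap : exists F : nat -> set (holo_space R),
  [/\ forall j, open (F j), forall j, dense (F j) &
  common_hypercyclic omega = \bigcap_j F j].
Proof.
have [V [oV VB]] := holo_space_countable_base o1.
(* [Some true], [Some false] : translations up and down; [None] : dilations *)
pose box (k : option bool) (p : nat) W : set (holo_space R) :=
  match k with
  | None => hits true p.+1%:R^-1 p.+1%:R (- p.+1%:R) p.+1%:R W
  | Some b => hits false p.+1%:R^-1 p.+1%:R ((-1) ^+ b) ((-1) ^+ b) W
  end.
(* Indices that decode to nothing and empty base sets receive the whole space, which keeps every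
   [F j] dense. *)
pose F j := if @unpickle (nat * nat * option bool)%type j is Some (i, p, k) then
  if pselect (V i !=set0) then box k p (V i) else setT else setT.
have p0 (p : nat) : 0 < p.+1%:R^-1 :> R by rewrite invr_gt0.
have p1 (p : nat) : p.+1%:R^-1 <= p.+1%:R :> R.
  apply: (@le_trans _ _ 1); last by rewrite ler1n.
  by rewrite invf_le1// ler1n.
have p2 (p : nat) : - p.+1%:R <= p.+1%:R :> R by rewrite ge0_cp.
have nb (b : bool) : `|(-1) ^+ b| = 1 :> R by rewrite normr_sign.
have obox k p W : open W -> open (box k p W) by case: k => [b|] oW; exact: open_hits.
exists F; split.
- move=> j; rewrite /F; case: unpickle => [[[i p] k]|]; last exact: openT.
  by case: pselect => Vi /=; [exact: obox|exact: openT].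
- have dT : dense [set: holo_space R] by move=> U [g Ug] _; exists g.
  move=> j; rewrite /F; case: unpickle => [[[i p] k]|//].
  case: pselect => //= Vi; case: k => [b|] /=; apply: dense_hits => //; last by left.
  by right; rewrite nb.
apply/seteqP; split=> f.
  move=> /common_hypercyclicP H j _; rewrite /F; case: unpickle => [[[i p] k]|//].
  case: pselect => //= Vi; case: k => [b|] l c /andP[lp _] cP.
    apply: H => //; first exact: lt_le_trans lp.
    by right; have -> : c = (-1) ^+ b by [apply/le_anti; rewrite andbC]; rewrite nb.
  by apply: H => //; [exact: lt_le_trans lp|left].
move=> H; apply/common_hypercyclicP => hyp l c l0 hc O oO [g Og].
have [i Vg VO] := VB O g oO Og.
have V0 : V i !=set0 by exists g.
(* [p + 1] exceeds [l], [l^-1] and [|c|], so the box of index [p] contains the parameter. *)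
pose p := Num.truncn (l + l^-1 + `|c|).
have il0 : 0 < l^-1 by rewrite invr_gt0.
have hp0 : l + l^-1 + `|c| < p.+1%:R by exact: truncnS_gt.
have c0 := normr_ge0 c.
have lP : p.+1%:R^-1 <= l <= p.+1%:R.
  apply/andP; split; last lra.
  by rewrite -(invrK l) lef_pV2 ?posrE//; lra.
have key k : box k p (V i) f.
  have := H (pickle (i, p, k)) I; rewrite /F pickleK.
  by case: pselect.
case: hyp hc => [_|[//|c1]].
  have [|n n0 Vn] := key None l c lP; first by rewrite -ler_norml; lra.
  by exists n => //; exact: VO.
have [b bE] : exists b : bool, c = (-1) ^+ b.
  have : (c == 1) || (c == -1).
    by rewrite -eqf_sqr expr1n -(real_normK (num_real c)) c1 expr1n.
  by case/orP => /eqP ->; [exists false|exists true].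
have [|n n0 Vn] := key (Some b) l c lP; first by rewrite bE lexx.
by exists n => //; exact: VO.
Qed.

End orbits.

Theorem theorem7 (R : realType) (omega : R[i]) (homega : unit_circle R omega) :
  (exists f : holo_space R, common_hypercyclic omega f) /\
  (dense (common_hypercyclic omega) /\ Gdelta (common_hypercyclic omega)).
Proof.
have o1 : normc omega = 1 by exact/unit_circleE.
have [F [Fo Fd FE]] := common_hypercyclic_bigcap o1.
have d : dense (common_hypercyclic omega).
  by rewrite FE; exact: (holo_space_baire o1 Fo Fd).
split; last by split=> //; exists F.
(* Density yields a vector once the whole space is known to be nonempty; the constant 0 inhabits
   it. *)
have [z _] := hp_surj o1 (fun w (_ : 0 < Re w) => holoC_cst 0 w).
have [|f [_ fH]] := d setT _ openT; first by exists z.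
by exists f.
Qed.
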